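(* Let $G$ be a finitely generated nilpotent-by-finite group, let $\mathbb{L}$ be any word-length function on $G$, and let $D=M_{\mathbb{L}}$ be the operator of pointwise multiplication by $\mathbb{L}$ on $\ell^2(G)$. Let $L_D(f)=\|[D,\lambda_f]\|$ for $f\in C_c(G)$. Then the topology on the state space of $C^*_r(G)$ defined by the metric $$\rho_{L_D}(\mu,\nu)=\sup\{|\mu(\lambda_f)-\nu(\lambda_f)|: f\in C_c(G),\ L_D(f)\le 1\}$$ coincides with the weak-$*$ topology.
   Context: A group is nilpotent-by-finite if it has a nilpotent subgroup of finite index. A word-length function on a finitely generated group $G$ is the function $\mathbb{L}$ assigning to $x\in G$ the least number of factors needed to write $x$ as a product of elements of $S\cup S^{-1}$, for some fixed finite generating set $S$ of $G$ (with $\mathbb{L}(e)=0$). $C_c(G)$ is the convolution $*$-algebra of finitely supported functions $G\to\mathbb{C}$. For $f\in C_c(G)$, $\lambda_f$ is the bounded operator on $\ell^2(G)$ given by $(\lambda_f\xi)(x)=\sum_{y\in G}f(xy^{-1})\xi(y)$. The reduced group $C^*$-algebra $C^*_r(G)$ is the operator-norm closure of $\{\lambda_f:f\in C_c(G)\}$. For $f\in C_c(G)$ the commutator $[D,\lambda_f]$ extends to a bounded operator on $\ell^2(G)$, and $\|\cdot\|$ is the operator norm. *)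

(* Defs.v *)
From HB Require Import structures.
From mathcomp Require Import all_boot all_order all_algebra finmap complex lra.
From mathcomp Require Import all_classical all_reals all_analysis.

Set Implicit Arguments.
Unset Strict Implicit.
Unset Printing Implicit Defensive.

Import Order.TTheory GRing.Theory Num.Theory.
Import ComplexField.Normc.
Import numFieldNormedType.Exports.

Local Open Scope classical_set_scope.
Local Open Scope ring_scope.

Section Groups.
Local Open Scope group_scope.
Variable G : groupType.
Implicit Types (A H : set G) (S : {fset G}).

Definition is_subgroup H := H 1 /\ (forall x y, H x -> H y -> H (x * y^-1)).

Definition generated A : set G :=
  \bigcap_(H in [set H | is_subgroup H /\ A `<=` H]) H.

Definition finitely_generated := exists S, generated [set` S] = [set: G].

Fixpoint lower_central H (n : nat) : set G :=
  if n is m.+1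
  then generated [set [~ x, y] | x in lower_central H m & y in H]
  else H.

Definition nilpotent_set H := exists n, lower_central H n = [set 1].

Definition left_cosets H : set (set G) :=
  [set [set x * h | h in H] | x in [set: G]].

Definition nilpotent_by_finite :=
  exists H, [/\ is_subgroup H, nilpotent_set H & finite_set (left_cosets H)].

Definition word_in S (w : seq G) := {in w, forall s, s \in S \/ s^-1 \in S}.

(* w is a word in S and S^-1 whose product is x *)
Definition expresses S x (w : seq G) := word_in S w /\ \prod_(s <- w) s = x.

Definition is_word_length (L : G -> nat) :=
  exists2 S, generated [set` S] = [set: G] &
    forall x, (exists2 w, expresses S x w & size w = L x) /\
              (forall w, expresses S x w -> (L x <= size w)%N).

End Groups.

Section L2.
Variables (R : realType) (G : groupType).
Local Notation C := (R[i]^o).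
Implicit Types xi eta : G -> C.

(* Extended-valued, on all functions; l2 is where it is finite. *)
Definition l2norm xi : \bar R :=
  sqrte (\esum_(x in [set: G]) (normc (xi x) ^+ 2)%:E)%E.

Lemma l2norm_ge0 xi : (0 <= l2norm xi)%E.
Proof. exact: sqrte_ge0. Qed.

Lemma esum_sqr_ge0 xi :
  (0 <= \esum_(x in [set: G]) (normc (xi x) ^+ 2)%:E)%E.
Proof. by apply: esum_ge0 => x _; rewrite lee_fin sqr_ge0. Qed.

Lemma l2norm_le xi (r : R) : 0 <= r ->
  (l2norm xi <= r%:E)%E =
  (\esum_(x in [set: G]) (normc (xi x) ^+ 2)%:E <= (r ^+ 2)%:E)%E.
Proof.
move=> r0; rewrite /l2norm -[r in LHS]ger0_norm// -sqrtr_sqr.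
by rewrite -[(Num.sqrt _)%:E]/(sqrte (r ^+ 2)%:E) lee_sqrt// lee_fin sqr_ge0.
Qed.

Lemma normc_ge0 (a : C) : 0 <= normc a.
Proof. by case: a => u v; exact: sqrtr_ge0. Qed.

Lemma sqr_normcD (a b : C) :
  normc (a + b) ^+ 2 <= 2 * normc a ^+ 2 + 2 * normc b ^+ 2.
Proof.
have h : normc (a + b) <= normc a + normc b by exact: le_normcD.
have {h} : normc (a + b) ^+ 2 <= (normc a + normc b) ^+ 2.
  by rewrite ler_sqr// nnegrE ?addr_ge0// normc_ge0.
move=> /le_trans; apply; have := sqr_ge0 (normc a - normc b).
by rewrite sqrrB sqrrD; lra.
Qed.

Lemma l2normD_le xi eta (r s : R) : 0 <= r -> 0 <= s ->
  (l2norm xi <= r%:E)%E -> (l2norm eta <= s%:E)%E ->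
  (l2norm (xi + eta)%R <= (2 * (r + s))%:E)%E.
Proof.
move=> r0 s0; rewrite !l2norm_le ?mulr_ge0 ?addr_ge0// => hr hs.
apply: (@le_trans _ _ (\esum_(x in [set: G])
  ((normc (xi x) ^+ 2)%:E + (normc (xi x) ^+ 2)%:E +
   ((normc (eta x) ^+ 2)%:E + (normc (eta x) ^+ 2)%:E))))%E.
  apply: le_esum => x _; rewrite -!EFinD lee_fin.
  by apply: le_trans (sqr_normcD _ _) _; rewrite !mulr2n !mulrDl !mul1r.
have p (z : G -> C) x : (0 <= (normc (z x) ^+ 2)%:E)%E.
  by rewrite lee_fin sqr_ge0.
rewrite esumD; [|by move=> *; rewrite adde_ge0..].
rewrite !esumD//.
apply: (@le_trans _ _ ((r ^+ 2)%:E + (r ^+ 2)%:E +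
  ((s ^+ 2)%:E + (s ^+ 2)%:E)))%E; first by rewrite !leeD.
by rewrite -!EFinD lee_fin; nra.
Qed.

Lemma l2normZ_le (a : C) xi (r : R) : 0 <= r ->
  (l2norm xi <= r%:E)%E -> (l2norm (a *: xi)%R <= (normc a * r)%:E)%E.
Proof.
move=> r0; rewrite !l2norm_le ?mulr_ge0 ?normc_ge0// => hr.
apply: ge_ereal_sup => _ [A [finA _] <-].
apply: (@le_trans _ _
  ((normc a ^+ 2)%:E * \sum_(x \in A) (normc (xi x) ^+ 2)%:E))%E.
  rewrite ge0_mule_fsumr; last by move=> x; rewrite lee_fin sqr_ge0.
  apply: lee_fsum => // x _.
  by rewrite -EFinM lee_fin -exprMn -normcM.
rewrite exprMn [leRHS]EFinM; apply: lee_wpmul2l; first by rewrite lee_fin sqr_ge0.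
by apply: le_trans hr; apply: ereal_sup_ubound; exists A.
Qed.

Lemma l2norm_translate xi (z : G) :
  l2norm (fun x => xi (z * x)%g) = l2norm xi.
Proof.
rewrite /l2norm; congr sqrte; apply/esym.
have : set_bij [set: G] [set: G] (fun x => (z * x)%g).
  split=> //; first by move=> x y _ _; exact: mulgI.
  by move=> x _; exists (z^-1 * x)%g => //; rewrite mulVKg.
move=> bij; exact: (reindex_esum [set: G] [set: G] _ _ bij).
Qed.

Definition l2_pred : {pred G -> C} := fun xi => `[< l2norm xi < +oo >]%E.

Lemma l2_predP xi :
  reflect (exists2 r : R, 0 <= r & (l2norm xi <= r%:E)%E) (xi \in l2_pred).
Proof.
apply: (iffP (@asboolP (l2norm xi < +oo)%E)) => [|[r _ h]]; last exact: le_lt_trans (ltry r).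
move: (l2norm_ge0 xi); case: (l2norm xi) => // r r0 _.
by exists r; rewrite ?lexx.
Qed.

Lemma l2norm0 (r : R) : 0 <= r -> (l2norm 0%R <= r%:E)%E.
Proof.
move=> r0; rewrite l2norm_le// esum1 ?lee_fin ?sqr_ge0// => x _.
by rewrite normc0 expr0n.
Qed.

Lemma l2_pred_submod : submod_closed l2_pred.
Proof.
split; first by apply/l2_predP; exists 0 => //; exact: l2norm0.
move=> a u v /l2_predP[r r0 hr] /l2_predP[s s0 hs].
have ar : 0 <= normc a * r by rewrite mulr_ge0 ?normc_ge0.
apply/l2_predP; exists (2 * (normc a * r + s)).
  by rewrite mulr_ge0 ?addr_ge0.
by apply: l2normD_le => //; exact: l2normZ_le.
Qed.

HB.instance Definition _ :=
  GRing.isSubmodClosed.Build R[i] (G -> C) l2_pred l2_pred_submod.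

Record l2 := L2 { l2_fun :> G -> C; l2P : l2_fun \in l2_pred }.

HB.instance Definition _ := [isSub for l2_fun].
HB.instance Definition _ := [Choice of l2 by <:].
HB.instance Definition _ := [SubChoice_isSubLmodule of l2 by <:].

(* Unconditional sums over G: positive part minus negative part. They are
   meaningful for absolutely summable families, such as the ones in inner. *)
Definition rsum (u : G -> R) : R :=
  fine (\esum_(x in [set: G]) (Num.max (u x) 0)%:E)%E -
  fine (\esum_(x in [set: G]) (Num.max (- u x) 0)%:E)%E.

Definition csum (u : G -> C) : C :=
  (rsum (fun x => complex.Re (u x)) +i* rsum (fun x => complex.Im (u x)))%C.

(* +oo exactly when T is unbounded on the unit ball; T takes values in functions
   so that maps not yet known to preserve l2 have a norm. *)
Definition opnorm (T : l2 -> G -> C) : \bar R :=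
  ereal_sup [set l2norm (T xi) | xi in [set xi : l2 | (l2norm xi <= 1)%E]].

Definition inner (xi eta : G -> C) : R[i] :=
  csum (fun x => xi x * (eta x)^*%C).

(* Over the complex numbers 0 <= z means that z is real and nonnegative. *)
Definition positive_op (T : l2 -> l2) := forall xi : l2, 0 <= inner (T xi) xi.

End L2.

Section GroupCstar.
Variables (R : realType) (G : groupType).
Local Notation C := (R[i]^o).
Local Notation l2 := (l2 R G).

Definition Cc := {fsfun G -> C with 0}.
Implicit Types (f g : Cc) (xi : G -> C).

(* The sum has finite support. *)
Definition convol f xi : G -> C :=
  fun x => \sum_(y \in [set: G]) f (x * y^-1)%g * xi y.

Lemma convolE f xi (A : {fset G}) : {subset finsupp f <= A} ->
  convol f xi = \sum_(z <- A) f z *: (fun x => xi (z^-1 * x)%g).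
Proof.
move=> fA; rewrite fct_sumE; apply/funext => x; rewrite /convol.
have bij : bijective (fun z : G => (z^-1 * x)%g).
  exists (fun y => (x * y^-1)%g) => z; first by rewrite invgM invgK mulVKg.
  by rewrite invgM invgK mulgVK.
rewrite (reindex_fsbigT _ _ bij) (@fsbigTE _ _ _ _ A) => [|z zA].
  apply: eq_bigr => z _; rewrite invgM invgK mulVKg.
  by [].
rewrite invgM invgK mulVKg [f z]fsfun_dflt ?mul0r//.
by apply: contra zA => /fA.
Qed.

Lemma convol_l2 f (xi : l2) : convol f xi \in @l2_pred R G.
Proof.
rewrite (@convolE _ _ (finsupp f))//; apply: rpred_sum => z _; apply: rpredZ.
have /l2_predP[r r0 h] := l2P xi.
by apply/l2_predP; exists r; rewrite ?l2norm_translate.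
Qed.

Definition lam f (xi : l2) : l2 := L2 (convol_l2 f xi).

Lemma lam_linear f : linear (lam f).
Proof.
move=> a u v; apply/val_inj; rewrite /= !(@convolE _ _ (finsupp f))//.
rewrite scaler_sumr -big_split; apply: eq_bigr => z _ /=.
by apply/funext => x; rewrite /= scalerDr !scalerA [a * _]mulrC.
Qed.

Definition mult_op (L : G -> nat) xi : G -> C := fun x => (L x)%:R * xi x.

(* D = mult_op L is unbounded on l2, but D and convolution by f act on all
   functions, hence so does [D, lam f]. Its value at a point depends on finitely
   many values of xi, so when the commutator on the domain of D is bounded, this
   formula gives on l2 its unique bounded extension. *)
Definition commutator (L : G -> nat) f xi : G -> C :=
  mult_op L (convol f xi) - convol f (mult_op L xi).

Definition L_D (L : G -> nat) f : \bar R := opnorm (commutator L f).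

(* The closure of the lam f among linear maps; since every lam f is bounded, so
   is every member of the closure. *)
Definition cstar_pred : {pred l2 -> l2} := fun T =>
  `[< linear T /\
      forall e : R, 0 < e -> exists f, (opnorm (T - lam f)%R <= e%:E)%E >].

Lemma opnorm_le (T : l2 -> l2) (e : R) :
  (opnorm T <= e%:E)%E <->
  (forall xi : l2, (l2norm xi <= 1)%E -> (l2norm (T xi) <= e%:E)%E).
Proof.
split=> [h xi xi1|h]; last by apply: ge_ereal_sup => _ [xi /= xi1 <-]; exact: h.
by apply: le_trans h; apply: ereal_sup_ubound; exists xi.
Qed.

Lemma lam_comb (a : R[i]) f g : exists h, lam h = a *: lam f + lam g.
Proof.
pose A := (finsupp f `|` finsupp g)%fset.
pose h : Cc := [fsfun x in A => (a * f x + g x)%R]; exists h.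
have hE x : h x = a * f x + g x.
  rewrite fsfunE; case: ifPn => //; rewrite in_fsetU negb_or => /andP[nf ng].
  by rewrite !fsfun_dflt// mulr0 addr0.
have fA : {subset finsupp f <= A} by move=> x xf; rewrite in_fsetU xf.
have gA : {subset finsupp g <= A} by move=> x xg; rewrite in_fsetU xg orbT.
have hA : {subset finsupp h <= A}.
  move=> x; rewrite mem_finsupp hE; apply: contraNT.
  rewrite in_fsetU negb_or => /andP[nf ng].
  by rewrite !fsfun_dflt// mulr0 addr0.
apply/funext => xi; apply/val_inj => /=.
rewrite (convolE _ hA) (convolE _ fA) (convolE _ gA).
rewrite scaler_sumr -big_split; apply: eq_bigr => z _ /=.
by rewrite hE scalerDl scalerA.
Qed.

Lemma lam_cstar f : lam f \in cstar_pred.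
Proof.
apply/asboolP; split=> [|e e0]; first exact: lam_linear.
exists f; apply/opnorm_le => xi _; rewrite subrr.
by apply: l2norm0; exact: ltW.
Qed.

Lemma id_cstar : id \in cstar_pred.
Proof.
pose delta : Cc := [fsfun x in [fset 1%g]%fset => (1 : C)].
suff <- : lam delta = id by exact: lam_cstar.
have dE x : delta x = if x == 1%g then 1 else 0.
  by rewrite fsfunE in_fset1.
have dA : {subset finsupp delta <= [fset 1%g]%fset}.
  by move=> x; rewrite mem_finsupp dE in_fset1; case: ifP => //; rewrite eqxx.
apply/funext => xi; apply/val_inj; rewrite /= (convolE _ dA) big_seq_fset1.
by rewrite dE eqxx scale1r; apply/funext => x; rewrite invg1 mul1g.
Qed.

Lemma cstar_submod : submod_closed cstar_pred.
Proof.
split.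
  apply/asboolP; split=> [a u v|e e0]; first by rewrite /= scaler0 addr0.
  have [h hE] := lam_comb (-1) [fsfun] [fsfun].
  exists h; rewrite hE scaleN1r addNr subrr.
  by apply/opnorm_le => xi _; apply: l2norm0; exact: ltW.
move=> a S T /asboolP[linS clS] /asboolP[linT clT].
apply/asboolP; split=> [b u v|e e0].
  rewrite !fctE linS linT !scalerDr !scalerA [a * b]mulrC.
  by rewrite -!addrA; congr +%R; rewrite addrCA.
have a1 : 0 < 2 * (normc a + 1) by rewrite mulr_gt0// ltr_wpDl ?normc_ge0.
have [f] := clS (e / (2 * (normc a + 1))) (divr_gt0 e0 a1).
have [g] := clT (e / (2 * (normc a + 1))) (divr_gt0 e0 a1).
have : 0 < e / (2 * (normc a + 1)) by exact: divr_gt0.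
have : 2 * (normc a + 1) * (e / (2 * (normc a + 1))) = e.
  by rewrite mulrC divfK// gt_eqF.
move: (e / _) => d de d0 /opnorm_le Tg /opnorm_le Sf.
have [h hE] := lam_comb a f g; exists h; apply/opnorm_le => xi xi1.
rewrite hE [X in l2norm (l2_fun X)](_ : _ =
  a *: (S - lam f) xi + (T - lam g) xi); last first.
  rewrite !fctE scalerDr scalerN opprD -!addrA; congr +%R.
  by rewrite addrCA.
apply: le_trans (l2normD_le _ _ (l2normZ_le a _ (Sf _ xi1)) (Tg _ xi1)) _.
- by rewrite mulr_ge0 ?normc_ge0// ltW.
- exact: ltW.
- exact: ltW.
by rewrite lee_fin -de; lra.
Qed.

HB.instance Definition _ :=
  GRing.isSubmodClosed.Build R[i] (l2 -> l2) cstar_pred cstar_submod.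

Record cstar := CStar { cstar_fun :> l2 -> l2; cstarP : cstar_fun \in cstar_pred }.

HB.instance Definition _ := [isSub for cstar_fun].
HB.instance Definition _ := [Choice of cstar by <:].
HB.instance Definition _ := [SubChoice_isSubLmodule of cstar by <:].

Definition lambda f : cstar := CStar (lam_cstar f).

Definition cstar1 : cstar := CStar id_cstar.

(* Positive elements of the concrete algebra are its positive operators. *)
Record state := State {
  state_fun :> {scalar cstar};
  state_ge0 : forall a : cstar, positive_op a -> 0 <= state_fun a;
  state1 : state_fun cstar1 = 1
}.

HB.instance Definition _ := gen_eqMixin state.
HB.instance Definition _ := gen_choiceMixin state.

(* The topology of pointwise convergence on the reduced C*-algebra. *)
Definition weak_star :=
  initial_topology (fun mu : state => (mu : cstar -> C) : {ptws cstar -> C}).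

(* A priori +oo is allowed. *)
Definition rho (L : G -> nat) (mu nu : state) : \bar R :=
  ereal_sup [set (normc (mu (lambda f) - nu (lambda f)))%:E |
             f in [set f | (L_D L f <= 1)%E]].

(* U is open for the topology whose neighbourhoods are given by the d-balls. *)
Definition dist_open (T : Type) (d : T -> T -> \bar R) (U : set T) :=
  forall x, U x -> exists2 e : R, 0 < e & [set y | (d x y < e%:E)%E] `<=` U.

Definition weak_star_open (U : set state) := @open weak_star U.

End GroupCstar.

(* Main.v *)
Require Import Defs.
From mathcomp Require Import all_boot all_order all_algebra.
From mathcomp Require Import finmap complex ring lra zify.
From mathcomp Require Import all_classical all_reals all_analysis.

Set Implicit Arguments.
Unset Strict Implicit.
Unset Printing Implicit Defensive.

Import Order.TTheory GRing.Theory Num.Theory.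
Import ComplexField.Normc.
Import numFieldNormedType.Exports.

Local Open Scope classical_set_scope.

(** The seminorm L_D(f) = || [D, lambda_f] || only sees f through the kernel
    f(x y^-1) (L(x) - L(y)), in which the factor L(x) - L(y) vanishes wherever
    x and y have the same length. The point of the proof is to recover f from
    this kernel, with a gain that grows with the distance from the identity.

    Right translations commute with convolution operators and are unitary. So
    if a kernel k is bounded, then so is the average of its translates
    k(x g, y g) with weights psi(x g) phi(y g), and its norm grows at most by
    the factor |phi|_2 |psi|_2 (lemma schur). When k is built from f(x y^-1),
    the average is again a function of x y^-1. Take phi carried by the sphere
    of radius t <= r around the identity, where L is constant, and psi equal to
    1 / (L - t) on an annulus at distance comparable to r: the length factor
    cancels exactly, and what is left is f times a function that equals 1 at
    all points of length comparable to r. If balls are doubling, the cost is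
    O(r^(-1/2)) (lemma convolver_annulus). Cutting f into pieces supported on
    annuli by averaged indicator functions of balls and summing a geometric
    series, the part of f outside a large ball has small operator norm,
    uniformly over all f with L_D(f) <= 1 (lemma uniform_tail).

    A state is bounded by twice the operator norm (lemma state_le; the
    adjoint of an element of the algebra provides its real and imaginary
    parts). So on the set L_D(f) <= 1 two states are uniformly close as soon
    as they are close at finitely many group elements, because the
    coefficients f(z), z <> 1, are bounded by 1. This is one half of the
    theorem. The other half only uses that every commutator [D, lambda_f] is
    bounded and that the lambda_f are dense.

    Doubling is where the group enters. In a nilpotent group with finite
    generating set S, list the iterated commutators [[s1, s2], ..., sw] of
    generators by increasing weight w. The subgroups spanned by the final
    segments of this list form a chain whose successive quotients are cyclic.
    If the quotient generated by x, of weight w, is infinite, then the ball of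
    radius n meets a number of cosets comparable to n^w: at most that many
    because the collection process rewrites a word of length n with O(n^w)
    letters of weight w (lemmas collect and short_all), at least that many
    because [[s1^a, s2^a], ..., sw^a] is x^(a^w) modulo higher weights
    (lemma layer_distortion). Hence balls have size comparable to n^d, and this
    passes to groups with a nilpotent subgroup of finite index. *)

(** * Subgroups and commutators *)

Section Subgroups.
Local Open Scope group_scope.
Variable G : groupType.
Implicit Types (A H : set G).

Lemma subgroupV H x : is_subgroup H -> H x -> H x^-1.
Proof. by move=> [H1 HD] Hx; rewrite -div1g; exact: HD. Qed.

Lemma subgroupM H x y : is_subgroup H -> H x -> H y -> H (x * y).
Proof.
by move=> sH Hx Hy; rewrite -[y]invgK; apply: sH.2 => //; exact: subgroupV.
Qed.

Lemma subgroupX H x n : is_subgroup H -> H x -> H (x ^+ n).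
Proof.
move=> sH Hx; elim: n => [|n IHn]; first by rewrite expg0; exact: sH.1.
by rewrite expgS; exact: subgroupM.
Qed.

Lemma subgroupJ H x y : is_subgroup H -> H x -> H y -> H (x ^ y).
Proof.
move=> sH Hx Hy; rewrite conjgE.
by apply: subgroupM => //; [exact: subgroupV|exact: subgroupM].
Qed.

Lemma subgroupR H x y : is_subgroup H -> H x -> H y -> H [~ x, y].
Proof.
move=> sH Hx Hy; rewrite commgEl.
by apply: subgroupM => //; [exact: subgroupV|exact: subgroupJ].
Qed.

Lemma subgroup_mulr H x y : is_subgroup H -> H y -> H (x * y) -> H x.
Proof. by move=> sH Hy Hxy; rewrite -(mulgK y x); exact: sH.2. Qed.

Lemma subgroup_mull H x y : is_subgroup H -> H x -> H (x * y) -> H y.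
Proof.
move=> sH Hx Hxy; rewrite -(mulKg x y).
by apply: subgroupM => //; exact: subgroupV.
Qed.

Lemma generated_subgroup A : is_subgroup (generated A).
Proof.
split=> [H [[H1 _] _]//|x y Ax Ay H [sH AH]].
by apply: sH.2; [exact: Ax|exact: Ay].
Qed.

Lemma sub_generated A : A `<=` generated A.
Proof. by move=> x Ax H [_ AH]; exact: AH. Qed.

Lemma generated_min A H : is_subgroup H -> A `<=` H -> generated A `<=` H.
Proof. by move=> sH AH x; apply. Qed.

Lemma generated_mono A B : A `<=` B -> generated A `<=` generated B.
Proof.
move=> AB; apply: generated_min; first exact: generated_subgroup.
by move=> x /AB; exact: sub_generated.
Qed.

Lemma generated_word A x : generated A x ->
  exists2 w : seq G, {in w, forall y, A y \/ A y^-1} & \prod_(y <- w) y = x.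
Proof.
move: x; apply: generated_min => [|x Ax]; last first.
  exists [:: x]; last by rewrite big_seq1.
  by move=> y; rewrite inE => /eqP->; left.
split; first by exists [::]; rewrite ?big_nil.
move=> _ _ [v vA <-] [w wA <-].
exists (v ++ rev [seq y^-1 | y <- w]).
  move=> y; rewrite mem_cat mem_rev => /orP[/vA//|/mapP[z /wA zA ->]].
  by rewrite invgK; case: zA; [right|left].
rewrite big_cat/=; congr (_ * _).
elim: w {wA} => [|z w IH]; first by rewrite !big_nil invg1.
by rewrite map_cons rev_cons -cats1 big_cat/= IH big_seq1 big_cons invgM.
Qed.

Lemma commMgJ x y z : [~ x * y, z] = [~ x, z] ^ y * [~ y, z] :> G.
Proof. by rewrite !commgEl !conjgE !gnorm. Qed.

Lemma commgMJ x y z : [~ x, y * z] = [~ x, z] * [~ x, y] ^ z :> G.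
Proof. by rewrite !commgEl !conjgE !gnorm. Qed.

Lemma commVgJ x z : [~ x^-1, z] = ([~ x, z] ^ x^-1)^-1 :> G.
Proof. by rewrite !commgEl !conjgE !gnorm. Qed.

Lemma commgVJ x z : [~ x, z^-1] = ([~ x, z] ^ z^-1)^-1 :> G.
Proof. by rewrite !commgEl !conjgE !gnorm. Qed.

Lemma Hall_Witt x y z :
  [~ x, y^-1, z] ^ y * [~ y, z^-1, x] ^ z * [~ z, x^-1, y] ^ x = 1 :> G.
Proof. by rewrite !commgEl !conjgE !gnorm. Qed.

Definition normalizes H A := forall x h, A x -> H h -> A (x ^ h).

End Subgroups.

(** * The weight filtration by iterated commutators *)

Section Filtration.
Local Open Scope group_scope.
Variables (G : groupType) (S : seq G) (c : nat).
Implicit Types (x y z h : G).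

Let H := generated [set` S].

(** Left-normed commutators of n + 1 generators, that is, of weight n + 1. *)
Fixpoint layer n : seq G :=
  if n is m.+1 then [seq [~ x, s] | x <- layer m, s <- S] else S.

(** Each commutator is paired with its weight; weights are nondecreasing
    along the list. *)
Definition letters : seq (nat * G) :=
  flatten [seq [seq (i.+1, x) | x <- layer i] | i <- iota 0 c].

(** This plays the role of the i-th term of the lower central series. Unlike
    that term, it comes with explicit generators. *)
Definition filt i : set G :=
  generated [set x | exists2 j, (i <= j)%N & (j, x) \in letters].

Lemma lettersP j x :
  reflect (exists2 i, (i < c)%N & j = i.+1 /\ x \in layer i)
          ((j, x) \in letters).
Proof.
apply: (iffP flatten_mapP) => [[k]|[i ic [ji xi]]].
  by rewrite mem_iota add0n => /andP[_ ic] /mapP[y yi [jE xE]]; exists k; rewrite ?jE ?xE.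
by exists i; rewrite ?mem_iota// ji; apply/mapP; exists x.
Qed.

Hypothesis top : {in layer c, forall x, x = 1}.

Lemma filt_subgroup i : is_subgroup (filt i).
Proof. exact: generated_subgroup. Qed.

Lemma filt_mono i j : (i <= j)%N -> filt j `<=` filt i.
Proof.
by move=> ij; apply: generated_mono => x [k jk xk]; exists k => //; exact: leq_trans jk.
Qed.

Lemma filt_letter i x : (i, x) \in letters -> filt i x.
Proof. by move=> xi; apply: sub_generated; exists i. Qed.

Lemma filt_top i x : (c < i)%N -> filt i x -> x = 1.
Proof.
move=> ci; suff Ki : filt i `<=` [set 1] by move=> /Ki.
apply: generated_min.
  by split=> // y z -> ->; rewrite invg1 mulg1.
move=> y [j ij /lettersP[k kc [jk _]]].
by move: ij ci; rewrite jk; lia.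
Qed.

Lemma layer_filt i x : x \in layer i -> filt i.+1 x.
Proof.
move=> xi; case: (ltnP i c) => [ic|ci].
  by apply: filt_letter; apply/lettersP; exists i.
suff -> : x = 1 by exact: (filt_subgroup _).1.
move: xi; have {ci} -> : i = (c + (i - c))%N by rewrite subnKC.
elim: (i - c)%N x => [|k IHk] x; first by rewrite addn0; exact: top.
rewrite addnS => /allpairsP[[y s]] /= [yi sS ->].
by rewrite (IHk y yi) comm1g.
Qed.

Lemma filt_gens i : filt i `<=` H.
Proof.
apply: generated_min; first exact: generated_subgroup.
move=> x [j _ /lettersP[k _ [_]]] {i j}.
elim: k x => [|k IHk] x; first exact: sub_generated.
move=> /allpairsP[[y s]] /= [yi sS ->].
by apply: (subgroupR (generated_subgroup _)); [exact: IHk|exact: sub_generated].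
Qed.

Lemma filt1 x : H x -> filt 1 x.
Proof.
by move: x; apply: generated_min (filt_subgroup _) _ => x xS; exact: layer_filt.
Qed.

(** Downward induction on i: the filtration is trivial above c, and once the
    subgroup of weight i + 1 is known to be normal, commutator identities
    reduce the claim to generators, whose commutators with S are letters of
    the next layer. *)
Lemma filt_comm i x h : filt i x -> H h -> filt i.+1 [~ x, h].
Proof.
have [n] := ubnP (c.+1 - i); elim: n i x h => // n IHn i x h ni xi Hh.
case: (ltnP c i) => ci.
  by rewrite (filt_top ci xi) comm1g; exact: (filt_subgroup _).1.
have sK := filt_subgroup i.+1.
have nK : normalizes H (filt i.+1).
  move=> y k yi Hk; rewrite -(mulVKg y (y ^ k)) -commgEl.
  apply: (subgroupM sK) => //; apply: (@filt_mono _ i.+2) => //.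
  by apply: IHn => //; lia.
have sgen u s : filt i u -> s \in S -> filt i.+1 [~ u, s].
  move=> + sS; move: u.
  have Hs : H s by exact: sub_generated.
  suff Ki : filt i `<=` [set u | H u /\ filt i.+1 [~ u, s]] by move=> u /Ki[].
  apply: generated_min.
    split; first by rewrite /= comm1g; split; [exact: (generated_subgroup _).1|exact: sK.1].
    move=> u v [Hu us] [Hv vs]; split; first exact: (generated_subgroup _).2.
    have HV : H v^-1 by apply: (subgroupV (generated_subgroup _)).
    rewrite commMgJ; apply: (subgroupM sK); first exact: nK.
    by rewrite commVgJ; apply: (subgroupV sK); exact: nK.
  move=> u [j ij uj]; split.
    by apply: (@filt_gens i); apply: sub_generated; exists j.
  have /lettersP[k kc [jk uk]] := uj.
  apply: (@filt_mono _ k.+2); first by rewrite -jk.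
  by apply: layer_filt; apply/allpairsP; exists (u, s).
suff Ki : H `<=` [set k | H k /\ filt i.+1 [~ x, k]] by have [] := Ki _ Hh.
apply: generated_min.
  split; first by rewrite /= commg1; split; [exact: (generated_subgroup _).1|exact: sK.1].
  move=> u v [Hu us] [Hv vs]; split; first exact: (generated_subgroup _).2.
  have HV : H v^-1 by apply: (subgroupV (generated_subgroup _)).
  rewrite commgMJ; apply: (subgroupM sK); last exact: nK.
  by rewrite commgVJ; apply: (subgroupV sK); exact: nK.
by move=> s sS; split; [exact: sub_generated|exact: sgen].
Qed.

Lemma filt_normal i : normalizes H (filt i).
Proof.
move=> x h xi Hh; rewrite -(mulVKg x (x ^ h)) -commgEl.
apply: (subgroupM (filt_subgroup _)) => //.
by apply: (@filt_mono _ i.+1) => //; exact: filt_comm.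
Qed.

(** Induction on j: a letter of weight at least j + 1 is [z, s] with z of
    weight at least j, and the Hall-Witt identity turns [[z, s], x] into two
    double commutators covered by the induction hypothesis. *)
Lemma filt_commutator i j x y : (0 < j)%N ->
  filt i x -> filt j y -> filt (i + j) [~ x, y].
Proof.
move=> j0; elim: j j0 i x y => // j IHj _ i x y xi yj.
have sK := filt_subgroup (i + j.+1).
have [j0|j0] := posnP j.
  by rewrite j0 addn1; apply: filt_comm => //; exact: (filt_gens yj).
have sH : is_subgroup H by exact: generated_subgroup.
have nK := @filt_normal (i + j.+1).
suff Kj : filt j.+1 `<=` [set y | H y /\ filt (i + j.+1) [~ x, y]] by have [] := Kj _ yj.
apply: generated_min.
  split; first by rewrite /= commg1; split; [exact: sH.1|exact: sK.1].
  move=> u v [Hu us] [Hv vs]; split; first exact: sH.2.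
  have HV : H v^-1 by exact: (subgroupV sH).
  rewrite commgMJ; apply: (subgroupM sK); last exact: nK.
  by rewrite commgVJ; apply: (subgroupV sK); exact: nK.
move=> w [m jm /lettersP[n nc [mE wn]]]; rewrite {m}mE in jm.
have [k nE] : exists k, n = k.+1.
  by case: n jm {nc wn} => [|k]; [case: j j0 {IHj yj sK nK}|exists k].
rewrite nE ltnS in nc jm wn *.
move: wn => /allpairsP[[z s]] /= [zk sS ->].
have Hs : H s by exact: sub_generated.
have zj : filt j z by apply: (@filt_mono _ k.+1) => //; exact: layer_filt.
have Hz := filt_gens zj; have Hx := filt_gens xi.
split; first exact: (subgroupR sH).
have VH u : H u -> H u^-1 by exact: (subgroupV sH).
(* z, s^-1 and x are chosen so that the first of the three factors is [[z,
   s], x] up to conjugation. *)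
have := Hall_Witt z s^-1 x; rewrite invgK => HW.
suff : filt (i + j.+1) ([~ z, s, x] ^ s^-1).
  move=> /nK/(_ Hs); rewrite -conjgM mulVg conjg1 => /(subgroupV sK).
  by rewrite invgR.
apply: (subgroup_mulr sK (y := [~ s^-1, x^-1, z] ^ x * [~ x, z^-1, s^-1] ^ z)).
  apply: (subgroupM sK).
    apply: nK => //; rewrite -addSnnS; apply: IHj => //.
    rewrite -invgR; apply: (subgroupV (filt_subgroup _)).
    apply: filt_comm; last exact: VH.
    exact: (subgroupV (filt_subgroup _)).
  apply: nK => //; rewrite addnS; apply: filt_comm; last exact: VH.
  by apply: IHj => //; exact: (subgroupV (filt_subgroup _)).
by rewrite mulgA HW; exact: sK.1.
Qed.

End Filtration.

(** * Weighted words *)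

Lemma seq_bound (T : eqType) (s : seq T) (P : T -> nat -> Prop) :
  (forall t m n, (m <= n)%N -> P t m -> P t n) ->
  {in s, forall t, exists n, P t n} -> exists n, {in s, forall t, P t n}.
Proof.
move=> Pmono; elim: s => [|t s IHs] Ps; first by exists 0%N.
have [|n nP] := IHs; first by move=> u us; apply: Ps; rewrite inE us orbT.
have [|m mP] := Ps t; first by rewrite inE eqxx.
exists (maxn m n) => u; rewrite inE => /orP[/eqP->|us].
  by apply: Pmono mP; rewrite leq_maxl.
by apply: Pmono (nP _ us); rewrite leq_maxr.
Qed.

Section Words.
Local Open Scope group_scope.
Variables (R : realType) (G : groupType).
Implicit Types (x y z h : G) (Y : seq (nat * G)) (u v w : seq (nat * G)).

(** Words may use the inverse of a letter, with the same weight. *)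
Definition symm Y := Y ++ [seq (p.1, p.2^-1) | p <- Y].

Definition wprod w : G := \prod_(p <- w) p.2.

Definition span Y : set G := generated [set x | exists i, (i, x) \in Y].

(** With r = n, a word of length n in the generators, all of weight 1, costs
    at most 1. *)
Definition wcost (r : R) w : R := (\sum_(p <- w) r ^- p.1)%R.

Lemma symmP Y p : reflect (p \in Y \/ (p.1, p.2^-1) \in Y) (p \in symm Y).
Proof.
rewrite mem_cat; apply: (iffP orP) => -[pY|]; try by left.
  by move=> /mapP[[i y] qY -> /=]; right; rewrite invgK.
move=> pY; right; apply/mapP; exists (p.1, p.2^-1) => //=.
by rewrite invgK; case: p {pY}.
Qed.

Lemma symmV Y p : p \in symm Y -> (p.1, p.2^-1) \in symm Y.
Proof.
by case/symmP=> pY; apply/symmP; [right|left] => //; rewrite invgK; case: p pY.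
Qed.

Lemma symm_sub Y Y' : {subset Y <= Y'} -> {subset symm Y <= symm Y'}.
Proof. by move=> YY p /symmP[] /YY pY; apply/symmP; [left|right]. Qed.

Lemma span_subgroup Y : is_subgroup (span Y).
Proof. exact: generated_subgroup. Qed.

Lemma span_letter Y p : p \in symm Y -> span Y p.2.
Proof.
case: p => i y /symmP[] /= pY; first by apply: sub_generated; exists i.
rewrite -[y]invgK; apply: (subgroupV (span_subgroup Y)).
by apply: sub_generated; exists i.
Qed.

Lemma span_wprod Y w : {subset w <= symm Y} -> span Y (wprod w).
Proof.
elim: w => [|p w IHw] wY.
  by rewrite /wprod big_nil; exact: (span_subgroup Y).1.
rewrite /wprod big_cons; apply: (subgroupM (span_subgroup Y)).
  by apply: span_letter; apply: wY; rewrite inE eqxx.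
by apply: IHw => q qw; apply: wY; rewrite inE qw orbT.
Qed.

Lemma span_word Y x : span Y x ->
  exists2 w, {subset w <= symm Y} & wprod w = x.
Proof.
move=> /generated_word[w wY <-]; elim: w wY => [|y w IHw] wY.
  by exists [::]; rewrite // /wprod !big_nil.
have [|v vY vE] := IHw; first by move=> z zw; apply: wY; rewrite inE zw orbT.
have [i iY] : exists i, (i, y) \in symm Y.
  have [|[i iY]|[i iY]] := wY y; first by rewrite inE eqxx.
    by exists i; apply/symmP; left.
  by exists i; apply/symmP; right.
exists ((i, y) :: v); last by rewrite /wprod !big_cons -vE.
by move=> p; rewrite inE => /orP[/eqP->//|/vY].
Qed.

Lemma wprod_cat u v : wprod (u ++ v) = wprod u * wprod v.
Proof. exact: big_cat. Qed.

Lemma wcost_cat r u v : wcost r (u ++ v) = (wcost r u + wcost r v)%R.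
Proof. exact: big_cat. Qed.

Lemma wcost_cons r p v : wcost r (p :: v) = (r ^- p.1 + wcost r v)%R.
Proof. exact: big_cons. Qed.

Lemma wcost_ge0 (r : R) w : (0 <= r -> 0 <= wcost r w)%R.
Proof. by move=> r0; apply: sumr_ge0 => p _; rewrite invr_ge0 exprn_ge0. Qed.

Lemma wcost_size (r : R) i w : (1 <= r)%R -> {in w, forall p, (i <= p.1)%N} ->
  (wcost r w <= (size w)%:R * r ^- i)%R.
Proof.
move=> r1; have r0 : (0 < r)%R by exact: lt_le_trans r1.
elim: w => [|p w IHw] wi; first by rewrite /wcost big_nil mul0r.
rewrite wcost_cons /= -addn1 natrD mulrDl mul1r addrC lerD//.
  by apply: IHw => q qw; apply: wi; rewrite inE qw orbT.
rewrite lef_pV2 ?posrE ?exprn_gt0// ler_weXn2l//.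
by apply: wi; rewrite inE eqxx.
Qed.

Lemma word_inv Y w : {subset w <= symm Y} ->
  exists w', [/\ {subset w' <= symm Y}, wprod w' = (wprod w)^-1 &
                 forall r, wcost r w' = wcost r w].
Proof.
elim: w => [|p w IHw] wY.
  by exists [::]; split=> [p| |r] //; rewrite /wprod big_nil invg1.
have [|w' [w'Y w'E w'c]] := IHw; first by move=> q qw; apply: wY; rewrite inE qw orbT.
exists (w' ++ [:: (p.1, p.2^-1)]); split.
- move=> q; rewrite mem_cat inE => /orP[/w'Y//|/eqP->].
  by apply: symmV; apply: wY; rewrite inE eqxx.
- by rewrite wprod_cat w'E /wprod big_seq1 big_cons invgM.
- by move=> r; rewrite wcost_cat !wcost_cons w'c /= addrC [X in (_ + X + _)%R]big_nil addr0.
Qed.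

Lemma word_exp Y w n : {subset w <= symm Y} ->
  exists w', [/\ {subset w' <= symm Y}, wprod w' = wprod w ^+ n &
                 forall r, wcost r w' = (n%:R * wcost r w)%R].
Proof.
move=> wY; elim: n => [|n [w' [w'Y w'E w'c]]].
  exists [::]; split=> // [|r]; first by rewrite /wprod big_nil.
  by rewrite /wcost big_nil mul0r.
exists (w ++ w'); split.
- by move=> q; rewrite mem_cat => /orP[/wY|/w'Y].
- by rewrite wprod_cat w'E expgS.
- by move=> r; rewrite wcost_cat w'c -add1n natrD mulrDl mul1r.
Qed.

End Words.

(** * The collection process *)

Section Collection.
Local Open Scope group_scope.
Variables (R : realType) (G : groupType).
Variables (S : seq G) (c : nat).
Hypothesis top : {in layer S c, forall x, x = 1}.
Variables (Z Y : seq (nat * G)) (i0 : nat) (x0 : G).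
Hypothesis ZY : letters S c = Z ++ (i0, x0) :: Y.
Implicit Types (x y z h : G) (u v w : seq (nat * G)).

Let H := generated [set` S].

Let lew (p q : nat * G) := (p.1 <= q.1)%N.

Lemma letters_pairwise : pairwise lew (letters S c).
Proof.
rewrite /letters; elim: c 0%N => [|n IHn] k //=.
rewrite pairwise_cat IHn andbT pairwise_map; apply/andP; split.
  apply/allrelP => _ _ /mapP[x _ ->] /flatten_mapP[i ik /mapP[y _ ->]].
  by move: ik; rewrite mem_iota /lew /= => /andP[]; lia.
by elim: (layer S k) => //= x s ->; rewrite andbT; apply/allP => y _ /=; rewrite /lew.
Qed.

Lemma suffix_weight p : p \in Y -> (i0 <= p.1)%N.
Proof.
move=> pY; have := letters_pairwise.
by rewrite ZY pairwise_cat /= => /and4P[_ _ /allP/(_ _ pY)].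
Qed.

Lemma suffix_letter p : p \in letters S c -> (i0 < p.1)%N -> p \in Y.
Proof.
have := letters_pairwise; rewrite ZY pairwise_cat /= => /and4P[/allrelP ZYle _ _ _].
rewrite mem_cat inE => /or3P[pZ|/eqP->|//]; last by rewrite ltnn.
by have := ZYle p (i0, x0) pZ (mem_head _ _); rewrite /lew/=; lia.
Qed.

Lemma weight_gt0 p : p \in letters S c -> (0 < p.1)%N.
Proof. by case: p => i x /lettersP[j _ [->]]. Qed.

Let i0_gt0 : (0 < i0)%N.
Proof. by apply: (weight_gt0 (p := (i0, x0))); rewrite ZY mem_cat mem_head orbT. Qed.

(** Letters of weight larger than i0 all come after x0 in the list. *)
Lemma filt_suffix i x : (i0 < i)%N -> filt S c i x ->
  exists w, [/\ {subset w <= symm Y}, {in w, forall p, (i <= p.1)%N} & wprod w = x].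
Proof.
move=> i0i /generated_word[v vi <-]; elim: v vi => [|y v IHv] vi.
  by exists [::]; split=> //; rewrite /wprod !big_nil.
have [|w [wY wi wE]] := IHv; first by move=> z zv; apply: vi; rewrite inE zv orbT.
have [j ij jY] : exists2 j, (i <= j)%N & (j, y) \in symm Y.
  have [|[j ij yj]|[j ij yj]] := vi y; first by rewrite inE eqxx.
    by exists j => //; apply/symmP; left; apply: suffix_letter => //=; lia.
  by exists j => //; apply/symmP; right; apply: suffix_letter => //=; lia.
exists ((j, y) :: w); split; last by rewrite /wprod !big_cons -wE.
  by move=> p; rewrite inE => /orP[/eqP->//|/wY].
by move=> p; rewrite inE => /orP[/eqP->//|/wi].
Qed.

Lemma symm_letter_filt p : p \in symm (letters S c) -> filt S c p.1 p.2.
Proof.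
case/symmP=> pl; first by apply: filt_letter; case: p pl.
rewrite -[p.2]invgK; apply: (subgroupV (filt_subgroup _ _ _)).
exact: filt_letter pl.
Qed.

Let Ysub : {subset Y <= letters S c}.
Proof. by move=> p pY; rewrite ZY mem_cat inE pY !orbT. Qed.

(** The commutator of a letter of weight i with x0 has weight at least i +
    i0, hence is a word in later letters; the lengths of these finitely many
    words are bounded. *)
Lemma conj_letter : exists l : nat, forall p (e : bool), p \in symm Y ->
  exists v, [/\ {subset v <= symm Y}, {in v, forall q, (p.1 + i0 <= q.1)%N},
    (size v <= l)%N & p.2 ^ (if e then x0 else x0^-1) = p.2 * wprod v].
Proof.
pose P (t : (nat * G) * bool) l := t.1 \in symm Y -> exists v,
   [/\ {subset v <= symm Y}, {in v, forall q, (t.1.1 + i0 <= q.1)%N},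
    (size v <= l)%N & t.1.2 ^ (if t.2 then x0 else x0^-1) = t.1.2 * wprod v].
have [t m n mn mP /mP[v [vY vi vl vE]]||l lP] :=
    @seq_bound _ [seq (p, e) | p <- symm Y, e <- [:: true; false]] P.
- by exists v; split=> //; exact: leq_trans mn.
- move=> [p e] _; case: (boolP (p \in symm Y)) => pY; last by exists 0%N; rewrite /P /= (negbTE pY).
  have x0f : filt S c i0 (if e then x0 else x0^-1).
    by apply: (symm_letter_filt (p := (i0, _))); apply/symmP; case: e; [left|right];
      rewrite ?invgK ZY mem_cat mem_head orbT.
  have pf : filt S c p.1 p.2 by apply: symm_letter_filt; apply: symm_sub pY.
  have [||v [vY vi vE]] := @filt_suffix (p.1 + i0) [~ p.2, if e then x0 else x0^-1].
  - have : (0 < p.1)%N by case/symmP: pY => /Ysub/weight_gt0.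
    lia.
  - exact: filt_commutator i0_gt0 pf x0f.
  by exists (size v) => _; exists v; split=> //=; rewrite vE commgEl mulVKg.
exists l => p e pY; apply: (lP (p, e)) => //.
by apply/allpairsP; exists (p, e); split=> //; case: e.
Qed.

(** Each letter is replaced by itself and at most l letters that are cheaper
    by the factor r^i0. *)
Lemma conj_word : exists l : nat, forall (r : R) u (e : bool), (1 <= r)%R ->
  {subset u <= symm Y} ->
  exists u', [/\ {subset u' <= symm Y},
    wprod u' = wprod u ^ (if e then x0 else x0^-1) &
    (wcost r u' <= wcost r u * (1 + l%:R * r ^- i0))%R].
Proof.
have [l lP] := conj_letter; exists l => r u e r1.
have r0 : (0 < r)%R by exact: lt_le_trans r1.
elim: u => [|p u IHu] uY.
  by exists [::]; split=> //; rewrite /wprod/wcost ?big_nil ?conj1g ?mul0r.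
have [|u' [u'Y u'E u'c]] := IHu; first by move=> q qu; apply: uY; rewrite inE qu orbT.
have pY : p \in symm Y by apply: uY; rewrite mem_head.
have [v [vY vi vl vE]] := lP p e pY.
exists (p :: v ++ u'); split.
- by move=> q; rewrite inE mem_cat => /or3P[/eqP->//|/vY|/u'Y].
- by rewrite /wprod !big_cons conjMg -/(wprod _) wprod_cat mulgA vE u'E.
- rewrite !wcost_cons wcost_cat mulrDl addrA lerD// mulrDr mulr1 lerD2l.
  apply: le_trans (wcost_size r1 vi) _.
  have ri i : (0 <= r ^- i)%R by rewrite invr_ge0 exprn_ge0// ltW.
  by rewrite exprD invfM mulrCA ler_wpM2l// ler_wpM2r// ler_nat.
Qed.

(** All occurrences of x0 and of its inverse are moved to the left, one at a
    time. There are at most r^i0 times the cost of them, so the cost of the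
    rest is multiplied by a factor (1 + l / r^i0)^(a + b) that is bounded
    independently of r. *)
Lemma collect : exists l : nat, forall (r : R) u, (1 <= r)%R ->
  {subset u <= symm ((i0, x0) :: Y)} ->
  exists a b u', [/\ {subset u' <= symm Y},
    wprod u = x0 ^+ a * x0 ^- b * wprod u',
    ((a + b)%:R * r ^- i0 <= wcost r u)%R &
    (wcost r u' <= wcost r u * (1 + l%:R * r ^- i0) ^+ (a + b))%R].
Proof.
have [l lP] := conj_word; exists l => r u r1.
have r0 : (0 < r)%R by exact: lt_le_trans r1.
have d1 : (1 <= 1 + l%:R * r ^- i0)%R.
  by rewrite lerDl mulr_ge0// invr_ge0 exprn_ge0// ltW.
elim/last_ind: u => [|u p IHu] uY.
  exists 0%N, 0%N, [::]; split=> //; first by rewrite /wprod !big_nil !expg0 !gsimp.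
    by rewrite /wcost big_nil mul0r.
  by rewrite /wcost !big_nil mul0r.
have [|a [b [u' [u'Y u'E ab u'c]]]] := IHu.
  by move=> q qu; apply: uY; rewrite mem_rcons inE qu orbT.
have pY : p \in symm ((i0, x0) :: Y) by apply: uY; rewrite mem_rcons mem_head.
have uE : wprod (rcons u p) = wprod u * p.2.
  by rewrite -cats1 wprod_cat /wprod big_seq1.
have uc : wcost r (rcons u p) = (wcost r u + r ^- p.1)%R.
  by rewrite -cats1 wcost_cat /wcost big_seq1.
case: (boolP (p \in symm Y)) => [{}pY|pnY].
  exists a, b, (rcons u' p); split.
  - by move=> q; rewrite mem_rcons inE => /orP[/eqP->//|/u'Y].
  - by rewrite uE u'E -cats1 wprod_cat mulgA; congr (_ * _); rewrite /wprod big_seq1.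
  - by rewrite uc; apply: (le_trans ab); rewrite lerDl invr_ge0 exprn_ge0// ltW.
  - rewrite uc -cats1 wcost_cat mulrDl lerD// [X in (X <= _)%R]big_seq1.
    by rewrite ler_peMr ?invr_ge0 ?exprn_ge0 ?exprn_ege1// ltW.
have [e pE] : exists e : bool, p = (i0, if e then x0 else x0^-1).
  case/symmP: pY; rewrite inE => /orP[/eqP pE|pY].
  - by exists true; rewrite -pE.
  - by case/symmP: pnY; left.
  - by exists false; case: p pE {uY uE uc pnY} => i x [-> <-]; rewrite invgK.
  - by case/symmP: pnY; right.
have [u2 [u2Y u2E u2c]] := lP r u' e r1 u'Y.
exists (a + e)%N, (b + ~~ e)%N, u2; rewrite addnACA.
have -> : (a + b + (e + ~~ e) = (a + b).+1)%N by rewrite -addn1; case: (e).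
split=> //.
- rewrite uE u'E u2E pE /=.
  have -> : x0 ^+ (a + e) * x0 ^- (b + ~~ e) =
    x0 ^+ a * x0 ^- b * (if e then x0 else x0^-1).
    case: (e); rewrite ?addn0 ?addn1 /= -mulgA.
      rewrite expgSr -mulgA; congr (_ * _).
      by apply: commuteV; apply: commuteX.
    by rewrite -invgM -expgS.
  by rewrite conjgE -!mulgA mulVKg.
- by rewrite uc pE/= -addn1 natrD mulrDl mul1r lerD2r.
- apply: le_trans u2c _; rewrite exprSr mulrA.
  rewrite ler_wpM2r ?(le_trans _ d1)//; apply: le_trans u'c _.
  by rewrite ler_wpM2r ?exprn_ge0 ?(le_trans _ d1)// uc lerDl invr_ge0 exprn_ge0// ltW.
Qed.

End Collection.

(** * Balls of the word length *)

Section Balls.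
Local Open Scope group_scope.
Variables (G : groupType) (S : seq G).
Implicit Types (g h : G).

Definition gens : seq G := S ++ [seq s^-1 | s <- S].

Fixpoint word_ball n : {fset G} :=
  if n is m.+1 then (word_ball m `|` [fset s * g | s in gens, g in word_ball m])%fset
  else [fset 1]%fset.

Lemma gensV s : s \in gens -> s^-1 \in gens.
Proof.
rewrite !mem_cat => /orP[sS|/mapP[t tS ->]]; last by rewrite invgK tS.
by apply/orP; right; apply/mapP; exists s.
Qed.

Lemma gensP s : reflect (s \in S \/ s^-1 \in S) (s \in gens).
Proof.
rewrite mem_cat; apply: (iffP orP) => -[sS|]; try by left.
  by move=> /mapP[t tS ->]; right; rewrite invgK.
by move=> sS; right; apply/mapP; exists s^-1; rewrite ?invgK.
Qed.

Lemma word_ballP n g : (exists w : seq G,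
  [/\ {subset w <= gens}, (size w <= n)%N & \prod_(s <- w) s = g]) <-> g \in word_ball n.
Proof.
elim: n g => [|n IHn] g /=.
  split=> [[w [_]]|]; first by case: w => // _ <-; rewrite big_nil inE.
  by rewrite inE => /eqP->; exists [::]; rewrite big_nil.
split=> [[[|s w] [wS wn <-]]|].
- rewrite inE big_nil; apply/orP; left; apply/IHn.
  by exists [::]; rewrite big_nil.
- rewrite inE big_cons; apply/orP; right; apply/imfset2P.
  exists s; first by apply: wS; rewrite mem_head.
  exists (\prod_(j <- w) j) => //; apply/IHn; exists w; split=> //.
  by move=> t tw; apply: wS; rewrite inE tw orbT.
rewrite inE => /orP[/IHn[w [wS wn wE]]|].
  by exists w; split=> //; exact: leqW.
move=> /imfset2P[s /= sS [h /IHn[w [wS wn <-]] ->]].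
exists (s :: w); split=> //; last by rewrite big_cons.
by move=> t; rewrite inE => /orP[/eqP->//|/wS].
Qed.

Lemma word_ball1 n : 1 \in word_ball n.
Proof. by apply/word_ballP; exists [::]; rewrite big_nil. Qed.

Lemma word_ball_gens s : s \in gens -> s \in word_ball 1.
Proof.
move=> sS; apply/word_ballP; exists [:: s]; rewrite big_seq1; split=> //.
by move=> t; rewrite inE => /eqP->.
Qed.

Lemma word_ballM m n g h : g \in word_ball m -> h \in word_ball n -> g * h \in word_ball (m + n).
Proof.
move=> /word_ballP[v [vS vm <-]] /word_ballP[w [wS wn <-]]; apply/word_ballP; exists (v ++ w).
rewrite size_cat big_cat leq_add//; split=> // s.
by rewrite mem_cat => /orP[/vS|/wS].
Qed.

Lemma word_ball_mono m n : (m <= n)%N -> {subset word_ball m <= word_ball n}.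
Proof.
move=> mn g /word_ballP[v [vS vm <-]]; apply/word_ballP; exists v; split=> //.
exact: leq_trans mn.
Qed.

Lemma word_ballV n g : g \in word_ball n -> g^-1 \in word_ball n.
Proof.
move=> /word_ballP[w [wS wn <-]]; elim: w n wS wn => [|s w IHw] [|n] // wS wn.
- by rewrite big_nil invg1 word_ball1.
- by rewrite big_nil invg1 word_ball1.
rewrite big_cons invgM -addn1; apply: word_ballM.
  by apply: IHw => // t tw; apply: wS; rewrite inE tw orbT.
by apply/word_ball_gens/gensV/wS; rewrite mem_head.
Qed.

Lemma word_ballX m n g : g \in word_ball m -> g ^+ n \in word_ball (n * m).
Proof.
move=> gm; elim: n => [|n IHn]; first by rewrite expg0; exact: word_ball1.
by rewrite expgS mulSn; exact: word_ballM.
Qed.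

Lemma word_ball_gen n g : g \in word_ball n -> generated [set` S] g.
Proof.
have sS := generated_subgroup [set` S].
move=> /word_ballP[w [wS _ <-]]; elim: w wS => [|s w IHw] wS.
  by rewrite big_nil; exact: sS.1.
rewrite big_cons; apply: (subgroupM sS); last first.
  by apply: IHw => t tw; apply: wS; rewrite inE tw orbT.
have /gensP[sS'|sS'] := wS _ (mem_head _ _); first exact: sub_generated.
by rewrite -[s]invgK; apply: (subgroupV sS); exact: sub_generated.
Qed.

End Balls.

(** * Short words in the final segments *)

Section ShortWords.
Local Open Scope group_scope.
Variables (R : realType) (G : groupType).
Variables (S : seq G) (c : nat).
Hypothesis top : {in layer S c, forall x, x = 1}.
Implicit Types (x y z g h : G) (u v w : seq (nat * G)).

(** The bound Q on the cost must not depend on the radius n. *)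
Definition short_words (Y : seq (nat * G)) := exists Q : R, forall n g,
  (0 < n)%N -> span Y g -> g \in word_ball S n ->
  exists w, [/\ {subset w <= symm Y}, wprod w = g & (wcost n%:R w <= Q)%R].

Lemma short_letters : short_words (letters S c).
Proof.
exists 1%R => n g n0 gl /word_ballP[w [wS wn wE]].
have n0R : (0 < n%:R :> R)%R by rewrite ltr0n.
have [c0|c0] := posnP c.
  have [[|p v] vl vE] := span_word gl.
    by exists [::]; rewrite /wcost big_nil ler01.
  by have := vl _ (mem_head _ _); rewrite /letters c0 /symm.
exists [seq (1%N, s) | s <- w]; split.
- move=> p /mapP[s sw ->]; apply/symmP => /=.
  by have /gensP[sS|sS] := wS _ sw; [left|right]; apply/lettersP; exists 0%N.
- by rewrite /wprod big_map.
- apply: le_trans (@wcost_size _ _ _ 1%N _ _ _) _; first by rewrite ler1n.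
    by move=> p /mapP[s _ ->].
  by rewrite expr1 size_map ler_pdivrMr// mul1r ler_nat.
Qed.

Section Suffix.
Variables (Z Y : seq (nat * G)) (i0 : nat) (x0 : G).
Hypothesis ZY : letters S c = Z ++ (i0, x0) :: Y.

Let spanY := span_subgroup Y.

Lemma span_cons g : span Y g -> span ((i0, x0) :: Y) g.
Proof. by apply: generated_mono => x [i iY]; exists i; rewrite inE iY orbT. Qed.

(** The factor of collect is bounded by exp(l Q). *)
Lemma short_cons : short_words ((i0, x0) :: Y) -> exists Q : R, forall n g,
  (0 < n)%N -> span ((i0, x0) :: Y) g -> g \in word_ball S n ->
  exists m (e : bool) w, [/\ {subset w <= symm Y},
    g = (if e then x0 ^+ m else x0 ^- m) * wprod w,
    (m%:R <= Q * n%:R ^+ i0)%R & (wcost n%:R w <= Q)%R].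
Proof.
move=> [Q QP]; have [l lP] := collect R top ZY.
exists (Num.max Q (Q * expR (l%:R * Q)))%R => n g n0 gY gn.
have n1R : (1 <= n%:R :> R)%R by rewrite ler1n.
have n0R : (0 < n%:R :> R)%R by rewrite ltr0n.
have [u [uY uE uQ]] := QP n g n0 gY gn.
have [a [b [u' [u'Y u'E ab u'c]]]] := lP _ _ n1R uY.
have Q0 : (0 <= Q)%R by apply: le_trans uQ; apply: wcost_ge0; rewrite ltW.
have abQ : ((a + b)%:R <= Q * n%:R ^+ i0 :> R)%R.
  by rewrite -ler_pdivrMr ?exprn_gt0//; exact: le_trans uQ.
have u'Q : (wcost n%:R u' <= Q * expR (l%:R * Q))%R.
  apply: (le_trans u'c); apply: ler_pM => //.
    by apply: wcost_ge0; rewrite ltW.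
  apply: (@le_trans _ _ (expR (l%:R * n%:R ^- i0) ^+ (a + b))%R).
    by rewrite lerXn2r ?nnegrE ?expR_ge0 ?expR_ge1Dx// addr_ge0// mulr_ge0.
  rewrite -expRM_natl ler_expR mulrCA ler_wpM2l//.
  exact: le_trans uQ.
have ltmax m : (m <= a + b)%N -> (m%:R <= Num.max Q (Q * expR (l%:R * Q)) * n%:R ^+ i0)%R.
  move=> mab; apply: (@le_trans _ _ (Q * n%:R ^+ i0)%R).
    by apply: le_trans abQ; rewrite ler_nat.
  by rewrite ler_wpM2r ?exprn_ge0 ?le_max ?lexx// ltW.
have mc : (wcost n%:R u' <= Num.max Q (Q * expR (l%:R * Q)))%R.
  by rewrite le_max u'Q orbT.
rewrite -uE u'E; case: (leqP b a) => ba.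
  exists (a - b)%N, true, u'; split=> //; first by rewrite expgnFr.
  by apply: ltmax; lia.
exists (b - a)%N, false, u'; split=> //; first by rewrite expgnFr 1?ltnW// invgM invgK.
by apply: ltmax; lia.
Qed.

(** After collecting x0, the remaining power of x0 lies in the span of Y.
    Either it is trivial, or it is a power of the least x0^e in that span,
    which is a fixed word in letters of weight at least that of x0:
    replacing it changes the cost by a bounded amount. *)
Lemma short_suffix : short_words ((i0, x0) :: Y) -> short_words Y.
Proof.
move=> /short_cons[Q QP].
have [[e e0 xe]|nofin] := pselect (exists2 e, (0 < e)%N & span Y (x0 ^+ e)); last first.
  exists Q => n g n0 gY gn.
  have [m [e [w [wY gE mQ wQ]]]] := QP n g n0 (span_cons gY) gn.
  exists w; split=> //; suff m0 : m = 0%N by rewrite gE m0 expg0 invg1 if_same mul1g.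
  apply/eqP; rewrite -leqn0 leqNgt; apply/negP => m0; apply: nofin.
  exists m => //; have xm : span Y (if e then x0 ^+ m else x0 ^- m).
    by apply: (subgroup_mulr spanY (span_wprod wY)); rewrite -gE.
  by case: e xm {gE} => // /(subgroupV spanY); rewrite invgK.
(* The exponents m with x0^m in the span of Y are the multiples of the least
   positive one. *)
pose E e := (0 < e)%N && `[< span Y (x0 ^+ e) >].
have exE : exists e, E e by exists e; rewrite /E e0; apply/asboolP.
have [{}e /andP[{}e0 /asboolP{}xe] emin] := ex_minnP exE.
have [v vY vE] := span_word xe.
exists (Q * (size v)%:R + Q)%R => n g n0 gY gn.
have n1R : (1 <= n%:R :> R)%R by rewrite ler1n.
have n0R : (0 < n%:R :> R)%R by rewrite ltr0n.
have [m [s [w [wY gE mQ wQ]]]] := QP n g n0 (span_cons gY) gn.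
have xm : span Y (x0 ^+ m).
  have : span Y (if s then x0 ^+ m else x0 ^- m).
    by apply: (subgroup_mulr spanY (span_wprod wY)); rewrite -gE.
  by case: s {gE} => // /(subgroupV spanY); rewrite invgK.
have mE : m = (e * (m %/ e))%N.
  apply/esym; rewrite mulnC; apply/eqP; rewrite -dvdn_eq.
  apply/eqP/eqP; rewrite -leqn0 leqNgt; apply/negP => me.
  suff : E (m %% e) by move=> /emin; rewrite leqNgt ltn_mod e0.
  rewrite /E me; apply/asboolP; move: xm; rewrite {1}(divn_eq m e) expgnDr mulnC expgnA.
  by apply: (subgroup_mull spanY); exact: (subgroupX _ spanY xe).
have [v1 [v1Y v1E v1c]] := word_exp R (m %/ e) vY.
have [v2 [v2Y v2E v2c]] := word_inv R v1Y.
have v1x : wprod v1 = x0 ^+ m by rewrite v1E vE -expgnA -mE.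
have v1Q : (wcost (n%:R : R) v1 <= Q * (size v)%:R)%R.
  rewrite v1c; apply: (@le_trans _ _ (m%:R * ((size v)%:R * n%:R ^- i0)))%R.
    apply: ler_pM => //; first by apply: wcost_ge0; rewrite ltW.
      by rewrite ler_nat leq_div.
    apply: wcost_size => // p /vY /symmP[] /(suffix_weight ZY) //.
  rewrite mulrCA mulrC ler_wpM2r//.
  by rewrite ler_pdivrMr// exprn_gt0.
case: s gE => gE.
  exists (v1 ++ w); split; last by rewrite wcost_cat lerD.
    by move=> p; rewrite mem_cat => /orP[/v1Y|/wY].
  by rewrite wprod_cat v1x gE.
exists (v2 ++ w); split; last by rewrite wcost_cat lerD// v2c.
  by move=> p; rewrite mem_cat => /orP[/v2Y|/wY].
by rewrite wprod_cat v2E v1x gE.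
Qed.

End Suffix.

Lemma short_all Z Y : letters S c = Z ++ Y -> short_words Y.
Proof.
elim/last_ind: Z Y => [|Z [i0 x0] IHZ] Y ZY.
  by move: ZY => /= <-; exact: short_letters.
by apply: (short_suffix (Z := Z) (i0 := i0) (x0 := x0));
  [rewrite -cat_rcons|apply: IHZ; rewrite -cat_rcons].
Qed.

End ShortWords.

(** * Growth and cosets *)

Section Counting.
Local Open Scope group_scope.
Variables (G : groupType) (S : seq G).
Implicit Types (A B : set G) (g h t : G).

Definition word_ball_in A n : seq G := [seq g <- word_ball S n | `[< A g >]].

Definition growth A n := size (word_ball_in A n).

Lemma word_ball_inP A n g : reflect (g \in word_ball S n /\ A g) (g \in word_ball_in A n).
Proof.
rewrite mem_filter; apply: (iffP andP) => [[/asboolP Ag gn]|[gn Ag]] //.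
by split=> //; apply/asboolP.
Qed.

Lemma word_ball_in_uniq A n : uniq (word_ball_in A n).
Proof. by rewrite filter_uniq// fset_uniq. Qed.

Lemma growth_sub A B m n : A `<=` B -> (m <= n)%N -> (growth A m <= growth B n)%N.
Proof.
move=> AB mn; apply: uniq_leq_size; first exact: word_ball_in_uniq.
by move=> g /word_ball_inP[gm /AB Ag]; apply/word_ball_inP; split=> //; exact: word_ball_mono gm.
Qed.

(** In each coset of B that meets the ball a base point is chosen; quotients
    of points of the ball by the base point have length at most 2 n. *)
Lemma growth_cosets_le A B (J : seq G) n : is_subgroup B ->
  (forall g, A g -> g \in word_ball S n -> exists2 t, t \in J & B (t^-1 * g)) ->
  (growth A n <= size J * growth B (n + n))%N.
Proof.
move=> sB AJ.
pose meets t g := [/\ A g, g \in word_ball S n & B (t^-1 * g)].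
have [r rP] : {r : G -> G & forall t g, meets t g -> meets t (r t)}.
  apply: (@choice _ _ (fun t u => forall g, meets t g -> meets t u)) => t.
  have [[g tg]|nt] := pselect (exists g, meets t g); first by exists g.
  by exists 1 => g tg; case: nt; exists g.
rewrite -(size_allpairs (fun t h => r t * h)).
apply: uniq_leq_size; first exact: word_ball_in_uniq.
move=> g /word_ball_inP[gn Ag]; have [t tJ Btg] := AJ g Ag gn.
have [_ rn Btr] : meets t (r t) by apply: (rP t g).
apply/allpairsP; exists (t, (r t)^-1 * g); split=> //=; last by rewrite mulVKg.
apply/word_ball_inP; split; first by apply: word_ballM => //; exact: word_ballV.
have -> : (r t)^-1 * g = (t^-1 * r t)^-1 * (t^-1 * g).
  by rewrite invgM invgK -!mulgA mulVKg.
by apply: (subgroupM sB) => //; exact: (subgroupV sB).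
Qed.

Lemma growth_cosets_ge A B (f : nat -> G) m n n' : is_subgroup A -> is_subgroup B ->
  B `<=` A ->
  (forall i, (i < m)%N -> A (f i) /\ f i \in word_ball S n) ->
  (forall i j, (i < j)%N -> (j < m)%N -> ~ B ((f i)^-1 * f j)) ->
  (m * growth B n' <= growth A (n + n'))%N.
Proof.
move=> sA sB BA fA finj.
rewrite -[X in (X * _)%N](size_iota 0 m) -(size_allpairs (fun i h => f i * h)).
apply: uniq_leq_size; last first.
  move=> _ /allpairsP[[i h] /= [im /word_ball_inP[hn Bh] ->]].
  have [|Af fn] := fA i; first by move: im; rewrite mem_iota.
  by apply/word_ball_inP; split; [exact: word_ballM|apply: (subgroupM sA) => //; exact: BA].
apply: allpairs_uniq; [exact: iota_uniq|exact: word_ball_in_uniq|].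
move=> p q /allpairsP[[i h] /= [im /word_ball_inP[_ Bh] ->]].
move=> /allpairsP[[j k] /= [jm /word_ball_inP[_ Bk] ->]] /= ijE.
have BV u v i1 j1 : B u -> B v -> f i1 * u = f j1 * v -> B ((f i1)^-1 * f j1).
  move=> Bu Bv uv; apply: (subgroup_mulr sB Bv).
  by rewrite -mulgA -uv mulKg.
rewrite !mem_iota /= !add0n in im jm.
have ij : i = j.
  case: (ltngtP i j) => // ij.
    by case: (finj _ _ ij jm); apply: BV ijE.
  by case: (finj _ _ ij im); apply: BV (esym ijE).
by move: ijE; rewrite ij => /mulgI ->.
Qed.

(** Only the radii 2^K matter. Using k also to enlarge the radius in the
    lower bound avoids a division. *)
Definition poly_growth A := exists d k : nat, forall K : nat,
  (growth A (2 ^ K) <= k * 2 ^ (d * K))%N /\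
  (2 ^ (d * K) <= k * growth A (2 ^ (K + k)))%N.

Lemma poly_growthI A d k1 k2 :
  (forall K, (growth A (2 ^ K) <= k1 * 2 ^ (d * K))%N) ->
  (forall K, (2 ^ (d * K) <= k2 * growth A (2 ^ (K + k2)))%N) ->
  poly_growth A.
Proof.
move=> ub lb; exists d, (k1 + k2)%N => K; split.
  by apply: (leq_trans (ub K)); rewrite leq_mul2r leq_addr orbT.
apply: (leq_trans (lb K)); apply: leq_mul; first exact: leq_addl.
by apply: growth_sub => //; rewrite leq_exp2l// leq_add2l leq_addl.
Qed.

End Counting.

(** * Powers of commutators that are short words *)

Section Distortion.
Local Open Scope group_scope.
Variables (G : groupType) (S : seq G) (c : nat).
Hypothesis top : {in layer S c, forall x, x = 1}.
Implicit Types (x y z g h u v : G).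

Let H := generated [set` S].
Let sH : is_subgroup H. Proof. exact: generated_subgroup. Qed.
Local Notation filt := (filt S c).

(** Equality of cosets in the quotient by the k-th term of the filtration. *)
Definition cong k x y := filt k (x^-1 * y).

Let sF k : is_subgroup (filt k). Proof. exact: filt_subgroup. Qed.

Lemma congxx k x : cong k x x.
Proof. by rewrite /cong mulVg; exact: (sF k).1. Qed.

Lemma cong_trans k y x z : cong k x y -> cong k y z -> cong k x z.
Proof.
move=> xy yz; rewrite /cong -(mulVKg y z) mulgA.
exact: (subgroupM (sF k)).
Qed.

Lemma congM k x x' y y' : H y -> cong k x x' -> cong k y y' ->
  cong k (x * y) (x' * y').
Proof.
move=> Hy xx yy; rewrite /cong.
have -> : (x * y)^-1 * (x' * y') = (x^-1 * x') ^ y * (y^-1 * y').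
  by rewrite conjgE invgM -!mulgA mulVKg.
by apply: (subgroupM (sF k)) => //; apply: (filt_normal top).
Qed.

Lemma congX k x y n : H x -> cong k x y -> cong k (x ^+ n) (y ^+ n).
Proof.
move=> Hx xy; elim: n => [|n IHn]; first by rewrite !expg0; exact: congxx.
by rewrite !expgS; apply: congM => //; exact: (subgroupX n sH).
Qed.

Lemma congJ k z v : filt k z -> H v -> cong k.+1 z (z ^ v).
Proof. by move=> zk Hv; rewrite /cong -commgEl; exact: (filt_comm top). Qed.

Lemma cong_commXl k x v m : filt k x -> H v -> cong k.+2 ([~ x, v] ^+ m) [~ x ^+ m, v].
Proof.
move=> xk Hv; have Hx := filt_gens xk; have xv := filt_comm top xk Hv.
elim: m => [|m IHm]; first by rewrite !expg0 comm1g; exact: congxx.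
rewrite !expgS commMgJ; apply: congM => //.
  by apply: (subgroupX _ sH); exact: (filt_gens xv).
by apply: congJ => //; exact: (subgroupX _ sH).
Qed.

Lemma cong_commXr k x v m : filt k x -> H v -> cong k.+2 ([~ x, v] ^+ m) [~ x, v ^+ m].
Proof.
move=> xk Hv; have Hx := filt_gens xk; have xv := filt_comm top xk Hv.
elim: m => [|m IHm]; first by rewrite !expg0 commg1; exact: congxx.
rewrite expgSr expgS commgMJ; apply: congM => //; first exact: (filt_gens xv).
by apply: congJ => //; exact: (subgroupX _ sH).
Qed.

Lemma cong_commM k x h v : filt k x -> filt k.+1 h -> H v ->
  cong k.+2 [~ x, v] [~ x * h, v].
Proof.
move=> xk hk Hv; have xv := filt_comm top xk Hv.
rewrite commMgJ -[X in cong _ X]mulg1; apply: congM; first exact: sH.1.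
  by apply: congJ => //; exact: (filt_gens hk).
by rewrite /cong invg1 mul1g; exact: (filt_comm top).
Qed.

(** Commutation is multiplicative in each argument modulo higher weights,
    so taking a-th powers of all generators in a commutator of weight i +
    1 gives its power a^(i + 1), while the word becomes only a times
    longer. *)
Lemma layer_power i x : x \in layer S i -> exists C, forall a,
  exists2 g, g \in word_ball S (C * a) & cong i.+2 (x ^+ (a ^ i.+1)) g.
Proof.
elim: i x => [|i IHi] x /= xi.
  exists 1%N => a; exists (x ^+ a); last by rewrite expn1; exact: congxx.
  by rewrite mul1n -[X in word_ball S X]muln1; apply/word_ballX/word_ball_gens; rewrite mem_cat xi.
have /allpairsP[[y s] /= [yi sS ->]] := xi.
have [C CP] := IHi y yi; exists (C + 1 + (C + 1))%N => a.
have [g gC yg] := CP a.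
have Hs : H s by exact: sub_generated.
have sa : s ^+ a \in word_ball S a.
  by rewrite -[X in word_ball S X]muln1; apply/word_ballX/word_ball_gens; rewrite mem_cat sS.
have yf : filt i.+1 y := layer_filt top yi.
have Hsa : H (s ^+ a) := subgroupX a sH Hs.
have yaf : filt i.+1 (y ^+ (a ^ i.+1)) := subgroupX _ (sF _) yf.
have ysf := filt_comm top yf Hs.
exists [~ g, s ^+ a].
  rewrite commgEl conjgE mulgA -!mulgA mulgA mulnDl mulnDl mul1n.
  by apply: word_ballM; apply: word_ballM => //; exact: word_ballV.
rewrite [X in cong _ X _](_ : _ = [~ y, s] ^+ (a ^ i.+1) ^+ a); last first.
  by rewrite -expgnA -expnSr.
apply: (cong_trans (y := [~ y ^+ (a ^ i.+1), s] ^+ a)).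
  apply: congX; last exact: cong_commXl.
  by apply: (subgroupX _ sH); exact: (filt_gens ysf).
apply: (cong_trans (y := [~ y ^+ (a ^ i.+1), s ^+ a])); first exact: cong_commXr.
rewrite -(mulVKg (y ^+ (a ^ i.+1)) g); exact: cong_commM.
Qed.

(** All exponents below 2^((i + 1) K), not only perfect powers, are reached
    by writing them in base 2^(i + 1): the lengths for the successive digits
    form a geometric series. *)
Lemma layer_distortion i x : x \in layer S i -> exists k, forall K n,
  (n < 2 ^ (i.+1 * K))%N ->
  exists2 g, g \in word_ball S (2 ^ (K + k)) & cong i.+2 (x ^+ n) g.
Proof.
move=> xi; have [C CP] := layer_power xi; exists (i.+1 + C)%N.
have Hx : H x := filt_gens (layer_filt top xi).
suff main : forall K n, (n < 2 ^ (i.+1 * K))%N ->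
    exists2 g, g \in word_ball S (2 ^ (i.+1 + K) * C) & cong i.+2 (x ^+ n) g.
  move=> K n /main[g gK xg]; exists g => //; apply: word_ball_mono gK.
  by rewrite addnA [(K + _)%N]addnC [X in (_ <= X)%N]expnD leq_mul// ltnW// ltn_expl.
elim=> [|K IHK] n nK.
  have -> : n = 0%N by move: nK; rewrite muln0; case: n.
  by exists 1; [exact: word_ball1|rewrite expg0; exact: congxx].
(* M is the place value of the leading digit. *)
pose M := (2 ^ (i.+1 * K))%N; have M0 : (0 < M)%N by rewrite expn_gt0.
have [h hK xh] := IHK (n %% M)%N (ltn_pmod _ M0).
have [g gC xg] := CP (2 ^ K)%N.
exists (g ^+ (n %/ M) * h).
  rewrite addnS expnSr mulnAC muln2 -addnn; apply: word_ballM => //.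
  apply: word_ball_mono (word_ballX _ gC).
  rewrite expnD -mulnA [(C * _)%N]mulnC leq_mul2r; apply/orP; right.
  by rewrite ltnW// ltn_divLR// -expnD -mulnS.
rewrite [in X in cong _ X _](divn_eq n M) expgnDr mulnC expgnA.
apply: congM => //; first exact: (subgroupX _ sH).
apply: congX; first exact: (subgroupX _ sH).
by rewrite /M [(i.+1 * K)%N]mulnC expnM.
Qed.

End Distortion.

(** * Growth of nilpotent groups *)

Section NilpotentGrowth.
Local Open Scope group_scope.
Variables (R : realType) (G : groupType) (S : seq G) (c : nat).
Hypothesis top : {in layer S c, forall x, x = 1}.
Implicit Types (x y z g h u v : G).

Section Step.
Variables (Z Y : seq (nat * G)) (i0 : nat) (x0 : G).
Hypothesis ZY : letters S c = Z ++ (i0, x0) :: Y.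

Let sY := span_subgroup Y.
Let sXY := span_subgroup ((i0, x0) :: Y).

Let x0l : (i0, x0) \in letters S c.
Proof. by rewrite ZY mem_cat mem_head orbT. Qed.

Let x0s : span ((i0, x0) :: Y) x0.
Proof. by apply: sub_generated; exists i0; rewrite mem_head. Qed.

(** A finite cyclic quotient changes the growth by a bounded factor only. *)
Lemma growth_finite_step e : (0 < e)%N -> span Y (x0 ^+ e) ->
  poly_growth S (span Y) -> poly_growth S (span ((i0, x0) :: Y)).
Proof.
move=> e0 xe [d [k dk]].
have xeX m : span Y (x0 ^+ (e * m)) by rewrite expgnA; exact: (subgroupX _ sY xe).
apply: (@poly_growthI _ _ _ d (e * (k * 2 ^ d)) k) => K.
  pose J := [seq x0 ^+ m | m <- iota 0 e].
  apply: (@leq_trans (size J * growth S (span Y) (2 ^ K + 2 ^ K))%N).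
    apply: growth_cosets_le => // g gY gK.
    have [Q QP] := short_cons top ZY (short_all R top (Z := Z) ZY).
    have [|m [s [w [wY gE _ _]]]] := QP (2 ^ K)%N g _ gY gK; first by rewrite expn_gt0.
    have [m' [h [hY xh]]] : exists m' h, span Y h /\
        (if s then x0 ^+ m else x0 ^- m) = x0 ^+ m' * h.
      case: s {gE}; first by exists m, 1; rewrite mulg1; split=> //; exact: sY.1.
      exists (m * e.-1)%N, (x0 ^- (e * m)); split; first exact: (subgroupV sY).
      apply: (mulIg (x0 ^+ (e * m))); rewrite mulgVK.
      by rewrite -{1}(prednK e0) mulSn expgnDr mulKg mulnC.
    exists (x0 ^+ (m' %% e)).
      by apply/mapP; exists (m' %% e)%N; rewrite // mem_iota add0n ltn_pmod.
    rewrite gE xh {2}(divn_eq m' e) addnC expgnDr -!mulgA mulKg.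
    apply: (subgroupM sY); first by rewrite mulnC.
    by apply: (subgroupM sY) => //; exact: span_wprod.
  rewrite addnn -muln2 -expnSr size_map size_iota -!mulnA leq_mul2l; apply/orP; right.
  by apply: leq_trans (dk K.+1).1 _; rewrite mulnS expnD.
apply: leq_trans (dk K).2 _; rewrite leq_mul2l; apply/orP; right.
by apply: growth_sub => // g; exact: span_cons.
Qed.

(** The ball of radius 2^K meets between 2^(i0 K) and O(2^(i0 K)) cosets of
    the span of Y, up to a bounded factor in the radius: the exponent of
    growth increases by i0. *)
Lemma growth_infinite_step : (forall e, (0 < e)%N -> ~ span Y (x0 ^+ e)) ->
  poly_growth S (span Y) -> poly_growth S (span ((i0, x0) :: Y)).
Proof.
move=> nofin [d [k dk]].
have [Q QP] := short_cons top ZY (short_all R top (Z := Z) ZY).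
have [q Qq] : exists q : nat, (Q <= q%:R)%R.
  exists (Num.bound `|Q|%R); apply/ltW; apply: le_lt_trans (ler_norm _) _.
  exact: archi_boundP.
have [i _ [i0E xi]] := lettersP _ _ _ _ x0l.
have [kd kdP] := layer_distortion top xi.
apply: (@poly_growthI _ _ _ (i0 + d) ((q + q + 2) * (k * 2 ^ d)) (k + kd).+1) => K.
  pose M := (q * 2 ^ (i0 * K))%N.
  pose J := [seq x0 ^+ m | m <- iota 0 M.+1] ++ [seq x0 ^- m | m <- iota 0 M.+1].
  apply: (@leq_trans (size J * growth S (span Y) (2 ^ K + 2 ^ K))%N).
    apply: growth_cosets_le => // g gY gK.
    have [|m [s [w [wY gE mQ _]]]] := QP (2 ^ K)%N g _ gY gK; first by rewrite expn_gt0.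
    have mM : (m <= M)%N.
      rewrite -(ler_nat R); apply: (le_trans mQ).
      rewrite natrM -natrX -expnM [(K * _)%N]mulnC ler_wpM2r//.
    exists (if s then x0 ^+ m else x0 ^- m).
      rewrite mem_cat; case: s {gE}; apply/orP; [left|right];
      by apply/mapP; exists m; rewrite // mem_iota add0n ltnS.
    by rewrite gE mulKg; exact: span_wprod.
  rewrite addnn -muln2 -expnSr size_cat !size_map !size_iota.
  apply: leq_trans (leq_mul (leqnn _) (dk K.+1).1) _.
  rewrite [((i0 + d) * K)%N]mulnDl mulnS !expnD.
  rewrite [leqRHS](_ : _ =
    ((q + q + 2) * 2 ^ (i0 * K)) * (k * (2 ^ d * 2 ^ (d * K))))%N; last by nia.
  rewrite leq_mul2r; apply/orP; right; rewrite /M.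
  have : (0 < 2 ^ (i0 * K))%N by rewrite expn_gt0.
  lia.
pose K1 := (K + k + kd)%N.
have [f fP] : {f : nat -> G & forall n, (n < 2 ^ (i0 * K))%N ->
    f n \in word_ball S (2 ^ K1) /\ span Y ((x0 ^+ n)^-1 * f n)}.
  apply: (@choice _ _ (fun n g => (n < 2 ^ (i0 * K))%N ->
    g \in word_ball S (2 ^ K1) /\ span Y ((x0 ^+ n)^-1 * g))) => n.
  have [nK|nK] := ltnP n (2 ^ (i0 * K)); last by exists 1.
  have [|g gK xg] := kdP K n; first by rewrite -i0E.
  exists g => _; split.
    by apply: word_ball_mono gK; rewrite leq_exp2l// /K1; lia.
  have [|w [wY _ <-]] := filt_suffix ZY _ xg; first by rewrite i0E.
  exact: span_wprod.
have := @growth_cosets_ge _ S _ _ f (2 ^ (i0 * K)) (2 ^ K1) (2 ^ (K + k)) sXY sY.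
move=> /(_ (@span_cons _ Y i0 x0)) lb.
apply: (@leq_trans (2 ^ (i0 * K) * (k * growth S (span Y) (2 ^ (K + k))))%N).
  by rewrite mulnDl expnD leq_mul2l (dk K).2 orbT.
rewrite mulnCA; apply: (@leq_trans (k * growth S (span ((i0, x0) :: Y)) (2 ^ K1 + 2 ^ (K + k)))%N).
  rewrite leq_mul2l lb ?orbT// => [n nK|m n mn nK].
    have [fn fY] := fP n nK; split=> //.
    rewrite -(mulVKg (x0 ^+ n) (f n)); apply: (subgroupM sXY).
      exact: (subgroupX _ sXY x0s).
    exact: span_cons.
  have [_ fm] := fP m (ltn_trans mn nK); have [_ fn] := fP n nK.
  move=> fmn; apply: (nofin (n - m)%N); first by rewrite subn_gt0.
  have -> : x0 ^+ (n - m) =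
    ((x0 ^+ m)^-1 * f m) * ((f m)^-1 * f n) * ((x0 ^+ n)^-1 * f n)^-1.
    by rewrite invgM invgK -!mulgA mulVKg mulVKg -[n in RHS](subnKC (ltnW mn)) expgnDr mulKg.
  by apply: (sY.2) => //; exact: (subgroupM sY).
apply: leq_mul; first lia.
apply: growth_sub => //; rewrite !addnS -/K1 addnA -/K1 expnS mul2n -addnn leq_add2l.
by rewrite leq_exp2l// /K1; lia.
Qed.

End Step.

Lemma poly_growth_suffix Z Y : letters S c = Z ++ Y -> poly_growth S (span Y).
Proof.
elim: Y Z => [|[i0 x0] Y IHY] Z ZY.
  exists 0%N, 1%N => K; rewrite mul0n expn0 mul1n.
  have -> : growth S (span [::]) (2 ^ K) = 1%N; last split=> //.
    suff /perm_size : perm_eq (word_ball_in S (span [::]) (2 ^ K)) [:: 1] by [].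
    apply: uniq_perm; [exact: word_ball_in_uniq|by []|] => g; rewrite inE.
    apply/word_ball_inP/eqP => [[_ /span_word[[|p w] wY <-]]|->].
    - by rewrite /wprod big_nil.
    - by have := wY _ (mem_head _ _).
    - by split; [exact: word_ball1|exact: (span_subgroup _).1].
  rewrite mul1n lt0n size_eq0; apply/eqP => g0.
  have : 1 \in word_ball_in S (span [::]) (2 ^ (K + 1)).
    by apply/word_ball_inP; split; [exact: word_ball1|exact: (span_subgroup _).1].
  by rewrite g0.
have /IHY gY : letters S c = rcons Z (i0, x0) ++ Y by rewrite cat_rcons.
have [[e e0 xe]|nofin] := pselect (exists2 e, (0 < e)%N & span Y (x0 ^+ e)).
  exact: (growth_finite_step ZY e0 xe gY).
by apply: (growth_infinite_step ZY _ gY) => e e0 xe; apply: nofin; exists e.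
Qed.

Lemma poly_growth_nilpotent : poly_growth S (generated [set` S]).
Proof.
have [d [k dk]] := @poly_growth_suffix [::] _ erefl; exists d, k => K.
suff -> : generated [set` S] = span (letters S c) by exact: dk.
apply/seteqP; split.
  move=> x /(filt1 top) fx; have := fx; apply: generated_mono.
  by move=> y [j _ yj]; exists j.
apply: generated_min; first exact: generated_subgroup.
by move=> x [j xj]; apply: (@filt_gens _ S c 0); apply: sub_generated; exists j.
Qed.

End NilpotentGrowth.

(** * Passing to a subgroup of finite index *)

Section VirtuallyNilpotent.
Local Open Scope group_scope.
Variables (R : realType) (G : groupType).
Implicit Types (x y z g h t : G) (S T : seq G).

Lemma layer_lower_central S (H : set G) n x : is_subgroup H -> [set` S] `<=` H ->
  x \in layer S n -> lower_central H n x.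
Proof.
move=> sH SH; elim: n x => [|n IHn] x /=; first exact: SH.
move=> /allpairsP[[y s] /= [yn sS ->]]; apply: sub_generated.
by exists y; [exact: IHn|exists s => //; exact: SH].
Qed.

Lemma finite_transversal (H : set G) : is_subgroup H -> finite_set (left_cosets H) ->
  exists2 T : seq G, 1 \in T & forall x, exists2 t, t \in T & H (t^-1 * x).
Proof.
move=> sH /finite_seqP[s sE].
exists (1 :: [seq xget 1 C | C <- s]); first by rewrite mem_head.
move=> x; pose C : set G := [set x * h | h in H].
have /= Cs : [set` s] C by rewrite -sE; exists x.
have [h Hh hE] : C (xget 1 C) by apply: xgetI; exists 1; [exact: sH.1|rewrite mulg1].
exists (xget 1 C); first by rewrite inE; apply/orP; right; apply: map_f.
by rewrite -hE invgM mulgVK; exact: (subgroupV sH).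
Qed.

(** The subgroup is generated by those of the elements t'^-1 s t and t, with
    t, t' in a transversal, that it contains (Schreier), and its word length
    for these generators is comparable to that of G. *)
Lemma poly_growth_virtual S (H : set G) T : is_subgroup H -> nilpotent_set H ->
  1 \in T -> (forall x, exists2 t, t \in T & H (t^-1 * x)) ->
  generated [set` S] = [set: G] -> poly_growth S [set: G].
Proof.
move=> sH [c cH] T1 TH genS.
pose S' := [seq x <- [seq q.1^-1 * (q.2 * t) | q <- [seq (t', s) | t' <- T, s <- gens S],
                                          t <- T] ++ T | `[< H x >]].
have S'H : [set` S'] `<=` H.
  by move=> x /=; rewrite mem_filter => /andP[/asboolP].
have S'T t : t \in T -> H t -> t \in S'.
  by move=> tT Ht; rewrite mem_filter mem_cat tT orbT andbT; apply/asboolP.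
have schreier n g : g \in word_ball S n -> exists t h,
    [/\ t \in T, H h, h \in word_ball S' n & g = t * h].
  move=> /word_ballP[w [wS wn <-]]; elim: w n wS wn => [|s w IHw] [|n] wS wn //.
  - by rewrite big_nil; exists 1, 1; rewrite mulg1 word_ball1; split=> //; exact: sH.1.
  - by rewrite big_nil; exists 1, 1; rewrite mulg1 word_ball1; split=> //; exact: sH.1.
  have [|//|t [h [tT Hh hn wE]]] := IHw n.
    by move=> u uw; apply: wS; rewrite inE uw orbT.
  have [t' t'T t'H] := TH (s * t).
  exists t', (t'^-1 * (s * t) * h); split=> //.
  - exact: (subgroupM sH).
  - rewrite -add1n; apply: word_ballM => //; apply: word_ball_gens; rewrite mem_cat mem_filter.
    apply/orP; left; apply/andP; split; first exact/asboolP.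
    rewrite mem_cat; apply/orP; left; apply/allpairsP; exists ((t', s), t); split=> //=.
    by apply/allpairsP; exists (t', s); split=> //=; apply: wS; rewrite mem_head.
  by rewrite big_cons wE -!mulgA mulVKg.
have schreierH n g : H g -> g \in word_ball S n -> g \in word_ball S' n.+1.
  move=> Hg /schreier[t [h [tT Hh hn gE]]]; rewrite gE -add1n; apply: word_ballM => //.
  apply: word_ball_gens; rewrite mem_cat S'T//.
  by apply: (subgroup_mulr sH Hh); rewrite -gE.
have genS' : generated [set` S'] = H.
  apply/seteqP; split; first exact: generated_min.
  move=> x Hx; have : generated [set` S] x by rewrite genS.
  move=> /generated_word[w wS wE].
  apply: (@word_ball_gen _ _ (size w).+1); apply: schreierH => //.
  by apply/word_ballP; exists w; split=> // s /wS /gensP.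
have top : {in layer S' c, forall x, x = 1}.
  by move=> x /(layer_lower_central sH S'H); rewrite cH.
have [d [k]] := poly_growth_nilpotent R top; rewrite genS' => dk.
have [m S'm] : exists m, {in S', forall s, s \in word_ball S (2 ^ m)}.
  apply: seq_bound => [t m n mn|s sS']; first by apply: word_ball_mono; rewrite leq_exp2l.
  have : generated [set` S] s by rewrite genS.
  move=> /generated_word[w wS wE]; exists (size w).
  apply: (@word_ball_mono _ _ (size w)); first exact/ltnW/ltn_expl.
  by apply/word_ballP; exists w; split=> // t /wS /gensP.
have word_ballS' n g : g \in word_ball S' n -> g \in word_ball S (n * 2 ^ m).
  move=> /word_ballP[w [wS wn <-]]; elim: w n wS wn => [|s w IHw] [|n] wS wn //.
  - by rewrite big_nil word_ball1.
  - by rewrite big_nil word_ball1.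
  rewrite big_cons mulSn; apply: word_ballM.
    have /gensP[/S'm//|/S'm] := wS _ (mem_head _ _).
    by move=> /word_ballV; rewrite invgK.
  by apply: IHw => // u uw; apply: wS; rewrite inE uw orbT.
apply: (@poly_growthI _ _ _ d (size T * (k * 2 ^ (d * 2))) (k + m)) => K.
  apply: (@leq_trans (size T * growth S H (2 ^ K + 2 ^ K))%N).
    by apply: growth_cosets_le => // g _ _; exact: TH.
  rewrite -!mulnA leq_mul2l; apply/orP; right; rewrite -expnD -mulnDr addnC addn2.
  apply: leq_trans (dk K.+2).1; apply: uniq_leq_size; first exact: word_ball_in_uniq.
  move=> g /word_ball_inP[gK Hg]; apply/word_ball_inP; split=> //.
  apply: word_ball_mono (schreierH _ _ Hg gK).
  have : (0 < 2 ^ K)%N by rewrite expn_gt0.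
  by rewrite !expnS; lia.
apply: leq_trans (dk K).2 _; apply: leq_mul; first exact: leq_addr.
apply: uniq_leq_size; first exact: word_ball_in_uniq.
move=> g /word_ball_inP[gK Hg]; apply/word_ball_inP; split=> //.
by rewrite addnA expnD; exact: word_ballS'.
Qed.

(** For K < k, where the lower bound says nothing, the ball of radius 2^(k +
    j) serves as a constant bound. *)
Lemma poly_growth_doubling S j : poly_growth S [set: G] ->
  exists C, forall K, (#|` word_ball S (2 ^ (K + j))| <= C * #|` word_ball S (2 ^ K)|)%N.
Proof.
move=> [d [k dk]].
have gE n : growth S [set: G] n = #|` word_ball S n|.
  rewrite /growth /word_ball_in (eq_filter (a2 := predT)) ?filter_predT// => g.
  by apply/asboolP.
exists (k * 2 ^ (d * (j + k)) * k + #|` word_ball S (2 ^ (k + j))|)%N => K.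
rewrite -!gE; have [kK|Kk] := leqP k K.
  apply: leq_trans (dk _).1 _; rewrite mulnDl.
  apply: leq_trans (leq_addr _ _); rewrite -!mulnA leq_mul2l; apply/orP; right.
  have -> : (d * (K + j) = d * (j + k) + d * (K - k))%N by nia.
  rewrite expnD leq_mul2l; apply/orP; right.
  by have := (dk (K - k)%N).2; rewrite subnK.
apply: (@leq_trans (growth S [set: G] (2 ^ (k + j)))).
  by apply: growth_sub => //; rewrite leq_exp2l// leq_add2r ltnW.
rewrite mulnDl; apply: leq_trans (leq_addl _ _); rewrite leq_pmulr//.
rewrite lt0n size_eq0; apply/eqP => g0.
have : 1 \in word_ball_in S [set: G] (2 ^ K) by apply/word_ball_inP; split => //; exact: word_ball1.
by rewrite g0.
Qed.

End VirtuallyNilpotent.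

(** * Word lengths on nilpotent-by-finite groups *)

Section WordLength.
Local Open Scope group_scope.
Variables (G : groupType).
Implicit Types (x y z g h t : G).

Lemma word_length_ball (L : G -> nat) : is_word_length L -> exists S : seq G,
  generated [set` S] = [set: G] /\ forall n x, (x \in word_ball S n) = (L x <= n)%N.
Proof.
move=> [S genS LS]; exists S; split=> // n x.
have [[w wx wL] Lmin] := LS x; apply/idP/idP => [/word_ballP[v [vS vn vE]]|Ln].
  by apply: leq_trans vn; apply: Lmin; split=> // s /vS /gensP.
case: wx => wS wE; apply/word_ballP; exists w; rewrite wL; split=> //.
by move=> s /wS ?; apply/gensP.
Qed.

Lemma word_length_doubling (R : realType) (L : G -> nat) j :
  nilpotent_by_finite G -> is_word_length L ->
  exists B : nat -> {fset G}, (forall n x, (x \in B n) = (L x <= n)%N) /\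
  exists C, forall K, (#|` B (2 ^ (K + j))| <= C * #|` B (2 ^ K)|)%N.
Proof.
move=> [H [sH nH fH]] /word_length_ball[S [genS SL]]; exists (word_ball S); split=> //.
have [T T1 TH] := finite_transversal sH fH.
by apply: poly_growth_doubling; exact: (poly_growth_virtual R sH nH T1 TH genS).
Qed.

Lemma word_lengthP (L : G -> nat) : is_word_length L ->
  [/\ forall x, (L x = 0%N) <-> (x = 1), forall x, L x^-1 = L x &
      forall x y, (L (x * y)%g <= L x + L y)%N].
Proof.
move=> /word_length_ball[S [_ SL]]; split.
- move=> x; split=> [x0|->]; last by apply/eqP; rewrite -leqn0 -SL word_ball1.
  by have := SL 0%N x; rewrite x0 /= inE => /eqP.
- have VL x : (L x^-1 <= L x)%N by rewrite -SL; apply: word_ballV; rewrite SL.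
  by move=> x; apply/eqP; rewrite eqn_leq VL /= -{1}[x]invgK VL.
- by move=> x y; rewrite -SL; apply: word_ballM; rewrite SL.
Qed.

End WordLength.

Local Open Scope ring_scope.

(** * Bounded kernels and Schur multipliers *)

Section ComplexModulus.
Variable R : realType.
Local Notation C := (R[i]).

Lemma normcR (r : R) : normc (r%:C%C : C) = `|r|.
Proof. by rewrite /normc /= expr0n /= addr0 sqrtr_sqr. Qed.

Lemma normc_nat n : normc (n%:R : C) = n%:R.
Proof. by rewrite -[n%:R](rmorph_nat (real_complex R)) normcR ger0_norm. Qed.

Lemma normc_sum (I : Type) (s : seq I) (P : pred I) (F : I -> C) :
  normc (\sum_(i <- s | P i) F i) <= \sum_(i <- s | P i) normc (F i).
Proof.
elim/big_rec2: _ => [|i x y _ xy]; first by rewrite normc0.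
by apply: le_trans (le_normcD _ _) _; rewrite lerD2l.
Qed.

Lemma normc_conj (z : C) : normc (z^*)%C = normc z.
Proof. by case: z => a b; rewrite /normc /= sqrrN. Qed.

Lemma mulc_conj (z : C) : z * (z^*)%C = ((normc z ^+ 2)%:C)%C.
Proof.
case: z => a b; rewrite /normc /= sqr_sqrtr ?addr_ge0 ?sqr_ge0//.
by apply/eqP; rewrite eq_complex /=; apply/andP; split; apply/eqP; lra.
Qed.

End ComplexModulus.

Section Kernels.
Variables (R : realType) (G : groupType).
Local Notation C := (R[i]).
Implicit Types (F D E : {fset G}) (xi eta : G -> C) (k : G -> G -> C).

Definition nrm2 F xi : R := \sum_(x <- F) normc (xi x) ^+ 2.

Definition form F k xi eta : C := \sum_(x <- F) \sum_(y <- F) k x y * xi y * eta x.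

(** The mean of the two squared norms replaces their geometric mean: this is
    equivalent to the usual bound by rescaling the vectors, and it spares
    square roots. *)
Definition bounded k (M : R) := forall F xi eta,
  2 * normc (form F k xi eta) <= M * (nrm2 F xi + nrm2 F eta).

Lemma nrm2_ge0 F xi : 0 <= nrm2 F xi.
Proof. by apply: sumr_ge0 => x _; exact: sqr_ge0. Qed.

Lemma nrm2Z F (a : C) xi : nrm2 F (fun x => a * xi x) = normc a ^+ 2 * nrm2 F xi.
Proof. by rewrite mulr_sumr; apply: eq_bigr => x _; rewrite normcM exprMn. Qed.

Lemma bounded_weighted k M a F xi eta : bounded k M -> 0 < a ->
  2 * normc (form F k xi eta) <= M * (a * nrm2 F xi + a^-1 * nrm2 F eta).
Proof.
move=> kM a0; pose s := Num.sqrt a.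
have s0 : 0 < s by rewrite sqrtr_gt0.
have sn : s != 0 by rewrite gt_eqF.
have := kM F (fun x => s%:C%C * xi x) (fun x => (s^-1)%:C%C * eta x).
rewrite !nrm2Z !normcR !real_normK ?num_real// exprVn sqr_sqrtr ?(ltW a0)//.
suff -> : form F k (fun x => s%:C%C * xi x) (fun x => (s^-1)%:C%C * eta x) =
  form F k xi eta by [].
apply: eq_bigr => x _; apply: eq_bigr => y _.
have <- : s%:C%C * (s^-1)%:C%C * (k x y * xi y * eta x) = k x y * xi y * eta x.
  by rewrite -rmorphM divff// mul1r.
ring.
Qed.

Lemma bounded_le k M M' : bounded k M -> M <= M' -> bounded k M'.
Proof.
move=> kM MM F xi eta; apply: (le_trans (kM F xi eta)).
by rewrite ler_wpM2r// addr_ge0 ?nrm2_ge0.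
Qed.

Lemma eq_bounded k k' M : (forall x y, k x y = k' x y) -> bounded k M -> bounded k' M.
Proof.
move=> kk kM F xi eta; have := kM F xi eta.
suff -> : form F k xi eta = form F k' xi eta by [].
by apply: eq_bigr => x _; apply: eq_bigr => y _; rewrite kk.
Qed.

Lemma bounded0 : bounded (fun _ _ => 0) 0.
Proof.
move=> F xi eta; rewrite mul0r /form big1 ?normc0 ?mulr0// => x _.
by rewrite big1// => y _; rewrite !mul0r.
Qed.

Lemma boundedD k k' M M' : bounded k M -> bounded k' M' ->
  bounded (fun x y => k x y + k' x y) (M + M').
Proof.
move=> kM kM' F xi eta; rewrite [leRHS]mulrDl.
apply: le_trans (lerD (kM F xi eta) (kM' F xi eta)).
rewrite -mulrDr ler_wpM2l//.
suff -> : form F (fun x y => k x y + k' x y) xi eta = form F k xi eta + form F k' xi eta.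
  exact: le_normcD.
rewrite /form -big_split; apply: eq_bigr => x _; rewrite -big_split.
by apply: eq_bigr => y _ /=; rewrite !mulrDl.
Qed.

Lemma boundedN k M : bounded k M -> bounded (fun x y => - k x y) M.
Proof.
move=> kM F xi eta; have := kM F xi eta; rewrite -[in X in X -> _]normcN.
suff -> : form F (fun x y => - k x y) xi eta = - form F k xi eta by [].
rewrite /form -sumrN; apply: eq_bigr => x _; rewrite -sumrN.
by apply: eq_bigr => y _; rewrite !mulNr.
Qed.

(** Right translation is unitary. *)
Lemma bounded_translate k M g :
  bounded k M -> bounded (fun x y => k (x * g)%g (y * g)%g) M.
Proof.
move=> kM F xi eta.
have inj : {in F &, injective (fun x => x * g)%g} by move=> x y _ _; exact: mulIg.
pose tr (z : G -> C) x := z (x * g^-1)%g.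
have := kM [fset (x * g)%g | x in F]%fset (tr xi) (tr eta).
rewrite /nrm2 /form !big_imfset//=.
under [X in _ <= _ * (X + _)]eq_bigr do rewrite /tr mulgK.
under [X in _ <= _ * (_ + X)]eq_bigr do rewrite /tr mulgK.
under eq_bigr do (rewrite big_imfset//=; under eq_bigr do rewrite /tr !mulgK).
by [].
Qed.

Lemma sum_translate (V : nmodType) D E (h : G -> V) y :
  (forall u, u \notin D -> h u = 0) -> {subset [fset (y^-1 * u)%g | u in D]%fset <= E} ->
  \sum_(u <- D) h u = \sum_(g <- E) h (y * g)%g.
Proof.
move=> hD DE.
rewrite -(@big_imfset _ _ _ G G imfset_key (fun g => y * g)%g (mem E) h)/=; last first.
  by move=> u v _ _; exact: mulgI.
apply: big_fset_incl => [|u _ /hD//]; apply/fsubsetP => u uD; apply/imfsetP.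
exists (y^-1 * u)%g; last by rewrite mulVKg.
by apply: DE; apply/imfsetP; exists u.
Qed.

(** For every g the translated kernel is applied to the vectors phi(y g)
    xi(y) and psi(x g) eta(x). Summed over g, their squared norms are the
    products of those of phi and xi, and of psi and eta. The kernel obtained
    depends on g only through u = y g. *)
Lemma schur k M D (phi psi : G -> R) a m : bounded k M -> 0 <= M -> 0 < a ->
  (forall u, u \notin D -> phi u = 0) -> (forall u, u \notin D -> psi u = 0) ->
  a * (\sum_(u <- D) phi u ^+ 2) <= m -> a^-1 * (\sum_(u <- D) psi u ^+ 2) <= m ->
  bounded (fun x y => \sum_(u <- D)
    (phi u * psi (x * y^-1 * u)%g)%:C%C * k (x * y^-1 * u)%g u) (M * m).
Proof.
move=> kM M0 a0 phiD psiD am bm F xi eta.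
pose E := [fset (y^-1 * u)%g | y in F, u in D]%fset.
have FE y : y \in F -> {subset [fset (y^-1 * u)%g | u in D]%fset <= E}.
  by move=> yF _ /imfsetP[u /= uD ->]; apply/imfset2P; exists y => //; exists u.
pose xi' g y := (phi (y * g)%g)%:C%C * xi y.
pose eta' g x := (psi (x * g)%g)%:C%C * eta x.
set k' := (fun x y => _).
(* For y fixed, u = y g turns the sum over u in D into a sum over g in E. *)
have -> : form F k' xi eta =
    \sum_(g <- E) form F (fun x y => k (x * g)%g (y * g)%g) (xi' g) (eta' g).
  rewrite /form [RHS]exchange_big /=; apply: eq_big_seq => x xF.
  rewrite [RHS]exchange_big /=; apply: eq_big_seq => y yF.
  rewrite /k' (sum_translate (y := y) (E := E)); last first.
  - exact: FE.
  - by move=> u /phiD ->; rewrite mul0r mul0r.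
  rewrite !mulr_suml; apply: eq_bigr => g _; rewrite /xi' /eta' mulgA mulgVK rmorphM.
  ring.
have norm_phi y : y \in F -> \sum_(g <- E) phi (y * g)%g ^+ 2 = \sum_(u <- D) phi u ^+ 2.
  move=> yF; rewrite -(sum_translate (h := fun u => phi u ^+ 2) _ (FE y yF))// => u /phiD ->.
  by rewrite expr0n.
have norm_psi y : y \in F -> \sum_(g <- E) psi (y * g)%g ^+ 2 = \sum_(u <- D) psi u ^+ 2.
  move=> yF; rewrite -(sum_translate (h := fun u => psi u ^+ 2) _ (FE y yF))// => u /psiD ->.
  by rewrite expr0n.
have sum_xi : \sum_(g <- E) nrm2 F (xi' g) = (\sum_(u <- D) phi u ^+ 2) * nrm2 F xi.
  rewrite exchange_big mulr_sumr; apply: eq_big_seq => y yF.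
  rewrite -(norm_phi y yF) mulr_suml; apply: eq_bigr => g _.
  by rewrite normcM normcR exprMn real_normK// num_real.
have sum_eta : \sum_(g <- E) nrm2 F (eta' g) = (\sum_(u <- D) psi u ^+ 2) * nrm2 F eta.
  rewrite exchange_big mulr_sumr; apply: eq_big_seq => y yF.
  rewrite -(norm_psi y yF) mulr_suml; apply: eq_bigr => g _.
  by rewrite normcM normcR exprMn real_normK// num_real.
apply: le_trans (ler_wpM2l _ (normc_sum _ _ _)) _ => //.
rewrite mulr_sumr.
apply: (@le_trans _ _ (\sum_(g <- E) M * (a * nrm2 F (xi' g) + a^-1 * nrm2 F (eta' g)))).
  by apply: ler_sum => g _; apply: bounded_weighted => //; exact: bounded_translate.
rewrite -mulr_sumr big_split -!mulr_sumr sum_xi sum_eta -mulrA ler_wpM2l//.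
by rewrite mulrDr !mulrA; apply: lerD; rewrite ler_wpM2r ?nrm2_ge0.
Qed.

End Kernels.

(** * Kernels and operator norms *)

Section FiniteVectors.
Variables (R : realType) (G : groupType).
Local Notation C := (R[i]^o).
Implicit Types (E F : {fset G}) (xi eta : G -> C).

Lemma esum_le_fset (a : G -> R) r :
  (\esum_(x in [set: G]) (a x)%:E <= r%:E)%E <-> forall F, \sum_(x <- F) a x <= r.
Proof.
have fE F : \sum_(x \in [set` F]) (a x)%:E = (\sum_(x <- F) a x)%:E.
  by rewrite fsbig_finite// set_fsetK sumEFin.
split=> [h F|h].
  rewrite -lee_fin -fE; apply: le_trans h; apply: ereal_sup_ubound.
  by exists [set` F].
apply: ge_ereal_sup => _ [A [/finite_fsetP[F ->] _] <-].
by rewrite fE lee_fin.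
Qed.

Lemma l2norm_leP xi (r : R) : 0 <= r ->
  (l2norm xi <= r%:E)%E <-> forall F, nrm2 F xi <= r ^+ 2.
Proof. by move=> r0; rewrite l2norm_le//; exact: esum_le_fset. Qed.

Definition cut F xi : G -> C := fun x => if x \in F then xi x else 0.

Lemma nrm2_cut_sub E F xi : (F `<=` E)%fset -> nrm2 E (cut F xi) = nrm2 F xi.
Proof.
move=> /[dup] FE /fsubsetP FE'; rewrite /nrm2.
rewrite -(big_fset_incl _ FE) => [|x _ /negbTE xF]; last by rewrite /cut xF normc0 expr0n.
by apply: eq_big_seq => x xF; rewrite /cut xF.
Qed.

Lemma nrm2_cut_le E F xi : nrm2 E (cut F xi) <= nrm2 E xi.
Proof.
apply: ler_sum => x _; rewrite /cut; case: ifP => // _.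
by rewrite normc0 expr0n sqr_ge0.
Qed.

Lemma nrm2_sub E F xi : (F `<=` E)%fset -> nrm2 F xi <= nrm2 E xi.
Proof. by move=> /nrm2_cut_sub <-; exact: nrm2_cut_le. Qed.

Lemma nrm2_cut E F xi : nrm2 E (cut F xi) <= nrm2 F xi.
Proof.
rewrite -(nrm2_cut_sub xi (fsubsetUr E F)).
by apply: nrm2_sub; exact: fsubsetUl.
Qed.

Lemma cut_l2 F xi : cut F xi \in @l2_pred R G.
Proof.
apply/l2_predP; exists (Num.sqrt (nrm2 F xi)); first exact: sqrtr_ge0.
apply/l2norm_leP; first exact: sqrtr_ge0.
by move=> E; rewrite sqr_sqrtr ?nrm2_ge0//; exact: nrm2_cut.
Qed.

Definition cutl2 F xi : l2 R G := L2 (cut_l2 F xi).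

Lemma l2norm_cut F xi r : 0 <= r -> nrm2 F xi <= r ^+ 2 -> (l2norm (cut F xi) <= r%:E)%E.
Proof.
move=> r0 Fr; apply/l2norm_leP => // E.
by apply: le_trans Fr; exact: nrm2_cut.
Qed.

End FiniteVectors.

Section OperatorNorms.
Variables (R : realType) (G : groupType).
Local Notation C := (R[i]^o).
Implicit Types (E F : {fset G}) (xi eta : G -> C) (f : Cc R G) (L : G -> nat).

Lemma opnorm_leP (T : l2 R G -> G -> C) (e : R) :
  (opnorm T <= e%:E)%E <->
  (forall xi : l2 R G, (l2norm xi <= 1)%E -> (l2norm (T xi) <= e%:E)%E).
Proof.
split=> [h xi xi1|h]; last by apply: ge_ereal_sup => _ [xi /= xi1 <-]; exact: h.
by apply: le_trans h; apply: ereal_sup_ubound; exists xi.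
Qed.

Lemma convol_fin f F xi x : (forall y, y \notin F -> f (x * y^-1)%g * xi y = 0) ->
  convol f xi x = \sum_(y <- F) f (x * y^-1)%g * xi y.
Proof. by move=> h; rewrite /convol (fsbigTE F). Qed.

Lemma convol_cut f F xi x :
  convol f (cut F xi) x = \sum_(y <- F) f (x * y^-1)%g * xi y.
Proof.
rewrite (@convol_fin f F) => [|y /negbTE yF]; last by rewrite /cut yF mulr0.
by apply: eq_big_seq => y yF; rewrite /cut yF.
Qed.

Definition comm_kernel L f (x y : G) : C := f (x * y^-1)%g * ((L x)%:R - (L y)%:R).

Lemma commutator_cut L f F xi x :
  commutator L f (cut F xi) x = \sum_(y <- F) comm_kernel L f x y * xi y.
Proof.
have LE : mult_op L (cut F xi) = cut F (fun y => (L y)%:R * xi y).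
  by apply/funext => y; rewrite /mult_op /cut; case: ifP => // _; rewrite mulr0.
rewrite /commutator LE -[LHS]/((L x)%:R * convol f (cut F xi) x - convol f _ x).
rewrite !convol_cut mulr_sumr -sumrB; apply: eq_bigr => y _.
by rewrite /comm_kernel; ring.
Qed.

(** A vector with finite support is rescaled into the unit ball; the small e
    takes care of the zero vector. *)
Lemma commutator_bounded L f : (L_D L f <= 1)%E -> bounded (comm_kernel L f) 1.
Proof.
move=> /opnorm_leP f1 F xi eta; rewrite mul1r.
pose T x := \sum_(y <- F) comm_kernel L f x y * xi y.
suff T2 : nrm2 F T <= nrm2 F xi.
  apply: (@le_trans _ _ (nrm2 F T + nrm2 F eta)); last by rewrite lerD2r.
  have -> : form F (comm_kernel L f) xi eta = \sum_(x <- F) T x * eta x.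
    by apply: eq_bigr => x _; rewrite mulr_suml.
  apply: le_trans (ler_wpM2l _ (normc_sum _ _ _)) _ => //.
  rewrite mulr_sumr -big_split; apply: ler_sum => x _ /=; rewrite normcM.
  by have := sqr_ge0 (normc (T x) - normc (eta x)); lra.
apply/ler_addgt0Pl => e e0; pose s := Num.sqrt (e + nrm2 F xi).
have s2 : s ^+ 2 = e + nrm2 F xi by rewrite sqr_sqrtr// addr_ge0 ?nrm2_ge0// ltW.
have s0 : 0 < s by rewrite sqrtr_gt0 ltr_wpDr ?nrm2_ge0.
have sC : s%:C%C * (s^-1)%:C%C = 1 :> C by rewrite -rmorphM divff ?gt_eqF.
have /l2norm_leP : (l2norm (commutator L f (cut F ((s^-1)%:C%C *: xi))) <= 1%:E)%E.
  apply: (f1 (cutl2 F ((s^-1)%:C%C *: xi))); apply: l2norm_cut => //.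
  rewrite [nrm2 _ _]nrm2Z normcR real_normK ?num_real//.
  by rewrite exprVn s2 expr1n ler_pdivrMl ?mulr1 ?lerDr ?ltW// ltr_wpDr ?nrm2_ge0.
move=> /(_ ler01 F); rewrite expr1n => h; rewrite -s2.
suff -> : nrm2 F T = s ^+ 2 * nrm2 F (commutator L f (cut F ((s^-1)%:C%C *: xi))).
  by rewrite ler_piMr// sqr_ge0.
rewrite -[s ^+ 2]real_normK ?num_real// -normcR -nrm2Z; apply: eq_bigr => x _.
rewrite commutator_cut mulr_sumr; congr (normc _ ^+ 2); apply: eq_bigr => y _.
rewrite [((s^-1)%:C%C *: xi) y]/GRing.scale/=.
rewrite -[LHS]mul1r -sC. by rewrite -mulrA; congr (_ * _); exact: mulrCA.
Qed.

(** Testing the form against the conjugate of T xi, divided by M and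
    restricted to a finite set, bounds the norm of T xi on that set. *)
Lemma kernel_opnorm (T : l2 R G -> G -> C) (k : G -> G -> C) (M : R) :
  (forall x, exists E, forall F (xi : l2 R G), (E `<=` F)%fset ->
     T xi x = \sum_(y <- F) k x y * xi y) ->
  0 < M -> bounded k M -> (opnorm T <= M%:E)%E.
Proof.
move=> Tk M0 kM; apply/opnorm_leP => xi /l2norm_leP; rewrite expr1n => /(_ ler01) xi1.
apply/l2norm_leP => [|F0]; first exact: ltW.
have [E EP] := choice Tk.
pose F := (F0 `|` [fset y | x in F0, y in E x])%fset.
have TE x : x \in F0 -> T xi x = \sum_(y <- F) k x y * xi y.
  move=> xF; apply: EP; apply/fsubsetP => y yE; rewrite in_fsetU; apply/orP; right.
  by apply/imfset2P; exists x => //; exists y.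
set q := nrm2 F0 _.
pose eta := cut F0 (fun x => (M^-1)%:C%C * (T xi x)^*%C).
have := kM F xi eta.
have -> : form F k xi eta = (M^-1 * q)%:C%C.
  rewrite /form -(big_fset_incl _ (fsubsetUl F0 _)) => [|x _ /negbTE xF]; last first.
    by rewrite big1// => y _; rewrite /eta /cut xF mulr0.
  rewrite rmorphM rmorph_sum mulr_sumr; apply: eq_big_seq => x xF.
  rewrite /= -mulr_suml -TE// /eta /cut xF -mulc_conj.
  by rewrite mulrCA.
rewrite normcR ger0_norm; last by rewrite mulr_ge0 ?nrm2_ge0// invr_ge0 ltW.
rewrite nrm2_cut_sub ?fsubsetUl// nrm2Z normcR.
have -> : nrm2 F0 (fun x => (T xi x)^*%C) = q.
  by apply: eq_bigr => x _; rewrite normc_conj.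
rewrite ger0_norm ?invr_ge0 ?(ltW M0)// => h.
have {}h : 2 * (M^-1 * q) <= M * (1 + M^-1 ^+ 2 * q).
  by apply: le_trans h _; rewrite ler_wpM2l ?lerD2r ?(ltW M0)//; exact: xi1.
have MM : M * M^-1 = 1 by rewrite divff ?gt_eqF.
have : M * (2 * (M^-1 * q)) <= M * (M * (1 + M^-1 ^+ 2 * q)) by rewrite ler_wpM2l// ltW.
have -> : M * (2 * (M^-1 * q)) = (M * M^-1) * 2 * q by ring.
have -> : M * (M * (1 + M^-1 ^+ 2 * q)) = M ^+ 2 + (M * M^-1) ^+ 2 * q by ring.
by rewrite MM; lra.
Qed.

Lemma convol_support f xi x F : ([fset (z^-1 * x)%g | z in finsupp f] `<=` F)%fset ->
  convol f xi x = \sum_(y <- F) f (x * y^-1)%g * xi y.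
Proof.
move=> /fsubsetP xF; apply: convol_fin => y yn.
rewrite [f _]fsfun_dflt ?mul0r//; apply: contra yn => yf; apply: xF; apply/imfsetP.
by exists (x * y^-1)%g => //; rewrite invgM invgK mulgVK.
Qed.

Lemma lam_bounded f M : 0 < M -> bounded (fun x y => f (x * y^-1)%g) M ->
  (opnorm (lam f : l2 R G -> G -> C) <= M%:E)%E.
Proof.
apply: kernel_opnorm => x; exists [fset (z^-1 * x)%g | z in finsupp f]%fset => F xi.
exact: convol_support.
Qed.

(** Row and column sums of the kernel are bounded by the sum of w. *)
Lemma bounded_schur_test (k : G -> G -> C) (w : G -> R) (D : {fset G}) :
  (forall x y, normc (k x y) <= w (x * y^-1)%g) -> (forall z, z \notin D -> w z = 0) ->
  bounded k (\sum_(z <- D) w z).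
Proof.
move=> kw wD F xi eta.
have w0 z : 0 <= w z.
  by have := kw z 1%g; rewrite invg1 mulg1; apply: le_trans; exact: normc_ge0.
have sumw (h : G -> G) E : injective h -> \sum_(x <- E) w (h x) <= \sum_(z <- D) w z.
  move=> hinj; rewrite -(@big_imfset _ _ _ _ _ imfset_key h (mem E) w)/=; last first.
    by move=> u v _ _; exact: hinj.
  set E' := imfset _ _ _.
  have -> : \sum_(z <- D) w z = \sum_(z <- (E' `|` D)%fset) w z.
    by apply: big_fset_incl; [exact: fsubsetUr|move=> z _ /wD].
  have -> : \sum_(z <- E') w z = \sum_(z <- (E' `|` D)%fset) (if z \in E' then w z else 0).
    rewrite -(big_fset_incl _ (fsubsetUl E' D)) => [|z _ /negbTE ->//].
    by apply: eq_big_seq => z ->.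
  by apply: ler_sum => z _; case: ifP.
apply: (@le_trans _ _ (\sum_(x <- F) \sum_(y <- F)
    w (x * y^-1)%g * (normc (xi y) ^+ 2 + normc (eta x) ^+ 2))).
  apply: le_trans (ler_wpM2l _ (normc_sum _ _ _)) _ => //.
  rewrite mulr_sumr; apply: ler_sum => x _.
  apply: le_trans (ler_wpM2l _ (normc_sum _ _ _)) _ => //.
  rewrite mulr_sumr; apply: ler_sum => y _; rewrite !normcM.
  have := sqr_ge0 (normc (xi y) - normc (eta x)).
  have := kw x y; have := w0 (x * y^-1)%g.
  have := normc_ge0 (xi y); have := normc_ge0 (eta x); have := normc_ge0 (k x y).
  set a := normc (k x y); set b := normc (xi y); set c := normc (eta x).
  set v := w _ => a0 c0 b0 v0 av bc.
  apply: (@le_trans _ _ (2 * (v * b * c))).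
    by rewrite ler_wpM2l// !ler_wpM2r.
  have -> : 2 * (v * b * c) = v * (2 * (b * c)) by ring.
  by rewrite ler_wpM2l//; lra.
under eq_bigr do under eq_bigr do rewrite mulrDr.
under eq_bigr do rewrite big_split /=.
rewrite big_split /= exchange_big mulrDr /=; apply: lerD.
  rewrite mulr_sumr; apply: ler_sum => y _; rewrite -mulr_suml ler_wpM2r ?sqr_ge0//.
  by apply: sumw; exact: mulIg.
rewrite mulr_sumr; apply: ler_sum => x _; rewrite -mulr_suml ler_wpM2r ?sqr_ge0//.
by apply: (sumw (fun y => x * y^-1)%g) => u v /mulgI /invg_inj.
Qed.

Lemma lam_opnorm f : exists2 M : R, 0 < M & (opnorm (lam f : l2 R G -> G -> C) <= M%:E)%E.
Proof.
pose M := \sum_(z <- finsupp f) normc (f z).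
have M0 : 0 <= M by apply: sumr_ge0 => z _; exact: normc_ge0.
exists (M + 1); first by rewrite ltr_wpDl.
apply: lam_bounded; first by rewrite ltr_wpDl.
apply: (bounded_le (M := M)); last by rewrite lerDl.
apply: (bounded_schur_test (w := fun z => normc (f z))) => // z.
by move=> /fsfun_dflt ->; rewrite normc0.
Qed.

Lemma commutator_opnorm L f :
  (forall x, L x^-1%g = L x) -> (forall x y, (L (x * y)%g <= L x + L y)%N) ->
  exists2 M : R, 0 < M & (L_D L f <= M%:E)%E.
Proof.
move=> LV LM; pose M := \sum_(z <- finsupp f) normc (f z) * (L z)%:R.
have M0 : 0 <= M by apply: sumr_ge0 => z _; rewrite mulr_ge0 ?normc_ge0.
exists (M + 1); first by rewrite ltr_wpDl.
apply: (kernel_opnorm (k := comm_kernel L f)); last 1 first.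
- apply: (bounded_le (M := M)); last by rewrite lerDl.
  apply: (bounded_schur_test (w := fun z => normc (f z) * (L z)%:R)) => [x y|z].
    rewrite /comm_kernel normcM ler_wpM2l ?normc_ge0//.
    have -> : (L x)%:R - (L y)%:R = ((L x)%:R - (L y)%:R)%:C%C :> C.
      by rewrite rmorphB !rmorph_nat.
    rewrite normcR ler_norml lerBlDr lerBrDr -!natrD addrC lerBlDr -natrD !ler_nat.
    apply/andP; split; last by have := LM (x * y^-1)%g y; rewrite mulgVK.
    rewrite addnC -(LV (x * y^-1)%g) invgM invgK.
    by have := LM (y * x^-1)%g x; rewrite mulgVK.
  by move=> /fsfun_dflt ->; rewrite normc0 mul0r.
- move=> x; exists [fset (z^-1 * x)%g | z in finsupp f]%fset => F xi xF.
  rewrite /commutator -[LHS]/((L x)%:R * convol f xi x - convol f _ x).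
  rewrite !(convol_support _ xF) mulr_sumr -sumrB; apply: eq_bigr => y _.
  by rewrite /comm_kernel /mult_op; ring.
- by rewrite ltr_wpDl.
Qed.

End OperatorNorms.

(** * Multipliers given by averages over finite sets *)

Section Averages.
Variables (R : realType) (G : groupType).
Local Notation C := (R[i]^o).
Implicit Types (D A E : {fset G}) (F : G -> R[i]).

Definition convolver F (M : R) := bounded (fun x y => F (x * y^-1)%g) M.

Definition avg D A (z : G) : R :=
  (#|` D|%:R)^-1 * \sum_(u <- D) ((z * u)%g \in A)%:R.

Lemma sum_mem D E (h : G -> R) : (D `<=` E)%fset ->
  \sum_(u <- E) (u \in D)%:R * h u = \sum_(u <- D) h u.
Proof.
move=> DE; rewrite -(big_fset_incl _ DE) => [|u _ /negbTE ->]; last by rewrite mul0r.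
by apply: eq_big_seq => u ->; rewrite mul1r.
Qed.

Lemma sum_const D (a : R) : \sum_(u <- D) a = #|` D|%:R * a.
Proof. by rewrite big_const_seq count_predT iter_addr_0 mulr_natl. Qed.

Lemma sqr_bool (b : bool) : b%:R ^+ 2 = b%:R :> R.
Proof. by case: b; rewrite ?expr1n ?expr0n. Qed.

Lemma avg1 D A z : (0 < #|` D|)%N -> {in D, forall u, (z * u)%g \in A} -> avg D A z = 1.
Proof.
move=> D0 DA; rewrite /avg (eq_big_seq (fun=> 1)); last by move=> u /DA ->.
by rewrite sum_const mulr1 mulVf// pnatr_eq0 -lt0n.
Qed.

Lemma avg0 D A z : {in D, forall u, (z * u)%g \notin A} -> avg D A z = 0.
Proof.
move=> DA; rewrite /avg big_seq big1 ?mulr0// => u /DA /negbTE -> //.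
Qed.

Lemma avg_ge0 D A z : 0 <= avg D A z.
Proof. by rewrite mulr_ge0 ?invr_ge0// sumr_ge0. Qed.

Lemma avg_le1 D A z : avg D A z <= 1.
Proof.
rewrite /avg; have [->|D0] := posnP #|` D|; first by rewrite invr0 mul0r.
rewrite ler_pdivrMl ?ltr0n// -sum_const ler_sum// => u _.
by case: (_ \in _).
Qed.

(** Lemma schur for the normalized indicator function of D and for w
    restricted to A. *)
Lemma bounded_avg k M D A (w : G -> R) m b : bounded k M -> 0 <= M ->
  (0 < #|` D|)%N -> 0 < m -> 0 <= b -> (forall v, v \in A -> w v ^+ 2 <= b) ->
  #|` A|%:R * b <= m ^+ 2 * #|` D|%:R ->
  bounded (fun x y => \sum_(u <- D) ((#|` D|%:R)^-1 *
    (((x * y^-1 * u)%g \in A)%:R * w (x * y^-1 * u)%g))%:C%C * k (x * y^-1 * u)%g u) (M * m).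
Proof.
move=> kM M0 D0 m0 b0 wb Am.
have d0 : 0 < #|` D|%:R :> R by rewrite ltr0n.
pose E := (D `|` A)%fset.
have DE : (D `<=` E)%fset by exact: fsubsetUl.
have AE : (A `<=` E)%fset by exact: fsubsetUr.
pose phi u : R := (u \in D)%:R * (#|` D|%:R)^-1.
pose psi v : R := (v \in A)%:R * w v.
have phiE u : u \notin E -> phi u = 0.
  by rewrite in_fsetU negb_or => /andP[/negbTE uD _]; rewrite /phi uD mul0r.
have psiE u : u \notin E -> psi u = 0.
  by rewrite in_fsetU negb_or => /andP[_ /negbTE uA]; rewrite /psi uA mul0r.
have a0 : 0 < m * #|` D|%:R by rewrite mulr_gt0.
have phi2 : \sum_(u <- E) phi u ^+ 2 = (#|` D|%:R)^-1.
  under eq_bigr do rewrite exprMn sqr_bool.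
  by rewrite sum_mem// sum_const expr2 mulrA divff ?lt0r_neq0// mul1r.
have psi2 : \sum_(u <- E) psi u ^+ 2 <= #|` A|%:R * b.
  under eq_bigr do rewrite exprMn sqr_bool.
  rewrite sum_mem// -sum_const big_seq [leRHS]big_seq.
  by apply: ler_sum => u uA; rewrite wb.
have := schur kM M0 a0 phiE psiE (m := m).
rewrite phi2 mulrK ?unitfE ?lt0r_neq0// => /(_ (lexx _)).
have pm : (m * #|` D|%:R)^-1 * (\sum_(u <- E) psi u ^+ 2) <= m.
  rewrite ler_pdivrMl//; apply: (le_trans psi2); apply: (le_trans Am).
  by rewrite expr2 mulrAC.
move=> /(_ pm); apply: eq_bounded => x y.
rewrite -(big_fset_incl _ DE) => [|u _ /negbTE uD]; last by rewrite /phi uD !mul0r.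
by apply: eq_big_seq => u uD; rewrite /phi uD mul1r.
Qed.

Lemma convolver_avg F M D A c : convolver F M -> 0 <= M -> (0 < #|` D|)%N -> 1 <= c ->
  #|` A|%:R <= c * #|` D|%:R -> convolver (fun z => F z * (avg D A z)%:C%C) (M * c).
Proof.
move=> FM M0 D0 c1 Ac.
have c0 : 0 < c by exact: lt_le_trans c1.
apply: eq_bounded (bounded_avg (w := fun=> 1) (b := 1) FM M0 D0 c0 _ _ _) => //.
- move=> x y; rewrite /avg mulr_sumr rmorph_sum mulr_sumr; apply: eq_bigr => u _.
  by rewrite mulr1 mulgK mulrC.
- by rewrite mulr1; apply: (le_trans Ac); rewrite ler_wpM2r// expr2 ler_peMr// ltW.
Qed.

Lemma convolverD F1 F2 M1 M2 : convolver F1 M1 -> convolver F2 M2 ->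
  convolver (fun z => F1 z + F2 z) (M1 + M2).
Proof. exact: boundedD. Qed.

Lemma convolver0 : convolver (fun=> 0) 0.
Proof. exact: bounded0. Qed.

Lemma convolverN F M : convolver F M -> convolver (fun z => - F z) M.
Proof. exact: boundedN. Qed.

Lemma eq_convolver F1 F2 M : F1 =1 F2 -> convolver F1 M -> convolver F2 M.
Proof. by move=> FF; apply: eq_bounded => x y; exact: FF. Qed.

End Averages.

(** * Uniform decay of the Lipschitz ball *)

Section Tail.
Variables (R : realType) (G : groupType) (L : G -> nat) (B : nat -> {fset G}).
Local Notation C := (R[i]^o).
Hypothesis LV : forall x, L x^-1%g = L x.
Hypothesis LM : forall x y, (L (x * y)%g <= L x + L y)%N.
Hypothesis BL : forall n x, (x \in B n) = (L x <= n)%N.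
Hypothesis L1 : L 1%g = 0%N.
Variable c : nat.
Hypothesis doubling : forall K, (#|` B (2 ^ (K + 6))| <= c * #|` B (2 ^ K)|)%N.

Let BM m n : (m <= n)%N -> (#|` B m| <= #|` B n|)%N.
Proof.
move=> mn; apply: fsubset_leq_card; apply/fsubsetP => x.
by rewrite !BL => /leq_trans; apply.
Qed.

Let B0 n : (0 < #|` B n|)%N.
Proof. by rewrite cardfs_gt0; apply/fset0Pn; exists 1%g; rewrite BL L1. Qed.

Let c0 : (0 < c)%N.
Proof. by have := leq_trans (B0 _) (doubling 0); case: (c). Qed.

Let L_le x y : (L x <= L (x * y)%g + L y)%N.
Proof. by rewrite -{1}(mulgK y x) -(LV y); exact: LM. Qed.

Definition sphere t := [fset u in B t | L u == t]%fset.

(** Pigeonhole: a ball is the union of the spheres it contains. *)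
Lemma big_sphere s : exists2 t, (t <= s)%N & (#|` B s| <= s.+1 * #|` sphere t|)%N.
Proof.
elim: s => [|s [t ts sB]].
  exists 0%N => //; rewrite mul1n; apply: fsubset_leq_card; apply/fsubsetP => x.
  by rewrite !inE /= BL leqn0 => ->.
have BS : (#|` B s.+1| <= #|` B s| + #|` sphere s.+1|)%N.
  apply: leq_trans (leq_card_fsetU _ _).
  apply: fsubset_leq_card; apply/fsubsetP => x.
  by rewrite !inE /= !BL leq_eqVlt ltnS => /orP[/eqP->|->]; rewrite ?leqnn ?eqxx ?orbT.
have [st|st] := leqP #|` sphere t| #|` sphere s.+1|.
  exists s.+1 => //; apply: (leq_trans BS); rewrite [leqRHS]mulSn addnC leq_add2l.
  by apply: (leq_trans sB); rewrite leq_mul2l st orbT.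
exists t; first exact: leqW.
apply: (leq_trans BS); rewrite [leqRHS]mulSn addnC leq_add//; exact: ltnW.
Qed.

(** An averaged indicator function of a ball: it equals 1 at points of
    length at most 3 * 4^i and 0 beyond length 5 * 4^i. Averaging over the
    smaller ball makes it a multiplier of bounded norm, by doubling. *)
Definition cutoff i (z : G) : R := avg R (B (4 ^ i)) (B (4 ^ i.+1)) z.

Definition annulus i := [fset v in B (4 ^ (i + 3)) | (2 * 4 ^ i <= L v)%N]%fset.

Let B4 i j : (j <= 3)%N -> (#|` B (4 ^ (i + j))| <= c * #|` B (4 ^ i)|)%N.
Proof.
move=> j3; apply: (@leq_trans #|` B (4 ^ (i + 3))|).
  by apply: BM; rewrite leq_exp2l// leq_add2l.
by rewrite -[4%N]/(2 ^ 2)%N -!expnM mulnDr; exact: doubling.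
Qed.

Lemma cutoff1 i z : (L z <= 3 * 4 ^ i)%N -> cutoff i z = 1.
Proof.
move=> zi; apply: avg1 => // u; rewrite !BL expnS => ui.
by apply: leq_trans (LM _ _) _; lia.
Qed.

Lemma cutoff0 i z : (5 * 4 ^ i < L z)%N -> cutoff i z = 0.
Proof.
move=> zi; apply: avg0 => u; rewrite !BL expnS => ui; rewrite -ltnNge.
by rewrite -(ltn_add2r (L u)); apply: leq_trans (L_le _ _); lia.
Qed.

Lemma convolver_cutoff F M i : convolver F M -> 0 <= M ->
  convolver (fun z => F z * (cutoff i z)%:C%C) (M * c%:R).
Proof.
move=> FM M0; apply: convolver_avg => //; first by rewrite ler1n.
by rewrite -natrM ler_nat -(addn1 i); exact: B4.
Qed.

Let q : R := 2^-1.

Let q4 i : (4 ^ i)%:R * q ^+ i * q ^+ i = 1 :> R.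
Proof.
rewrite natrX -!exprMn (_ : 4%:R * q * q = 1) ?expr1n// /q.
by rewrite -[4%N]/(2 * 2)%N natrM; lra.
Qed.

(** With phi the indicator function of the sphere of radius t and psi = 1 /
    (L - t) on the annulus, the factor L(x g) - L(y g) of the translated
    commutator kernel cancels. On the annulus L - t is at least 4^i, and the
    annulus has at most 2 c 4^i times as many points as the sphere, which
    gives a norm of order 2^-i. *)
Lemma convolver_annulus (f : Cc R G) i : bounded (comm_kernel L f) 1 ->
  exists2 t, (t <= 4 ^ i)%N & (0 < #|` sphere t|)%N /\
  convolver (fun z => f z * (avg R (sphere t) (annulus i) z)%:C%C) (2 * c%:R * q ^+ i).
Proof.
move=> fM; have [t ti tB] := big_sphere (4 ^ i).
have S0 : (0 < #|` sphere t|)%N.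
  by have := leq_trans (B0 _) tB; rewrite muln_gt0.
exists t => //; split => //.
have q0 : 0 < q ^+ i by rewrite exprn_gt0// invr_gt0.
pose w v : R := ((L v)%:R - t%:R)^-1.
have m0 : 0 < 2 * c%:R * q ^+ i by rewrite !mulr_gt0 ?ltr0n.
have wA v : v \in annulus i -> (4 ^ i)%:R <= (L v)%:R - t%:R :> R.
  rewrite !inE => /andP[_ vi]; rewrite lerBrDr -natrD ler_nat.
  lia.
have i40 : 0 < (4 ^ i)%:R :> R by rewrite ltr0n expn_gt0.
have a0 v : v \in annulus i -> 0 < (L v)%:R - t%:R :> R.
  by move=> /wA; exact: lt_le_trans.
have wb v : v \in annulus i -> w v ^+ 2 <= (4 ^ i)%:R ^- 2.
  move=> vA; rewrite /w exprVn lef_pV2 ?posrE ?exprn_gt0 ?a0//.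
  by rewrite ler_sqr ?nnegrE ?wA ?ltW ?a0.
rewrite -[2 * _ * _]mul1r.
apply: eq_bounded (bounded_avg (D := sphere t) (A := annulus i) fM ler01 S0 m0 _ wb _).
- move=> x y; rewrite /avg mulr_sumr rmorph_sum mulr_sumr.
  apply: eq_big_seq => u uS; rewrite /comm_kernel mulgK [RHS]mulrC.
  have -> : (L u)%:R = t%:R :> C by move: uS; rewrite !inE => /andP[_ /eqP->].
  case: (boolP (_ \in annulus i)) => vA; last by rewrite mul0r mulr0 !mul0r.
  rewrite mul1r mulr1 rmorphM -mulrA /=; congr (_ * _).
  rewrite mulrC -mulrA -[RHS]mulr1; congr (_ * _).
  have -> : (L (x * y^-1 * u)%g)%:R - t%:R = ((L (x * y^-1 * u)%g)%:R - t%:R)%:C%C :> C.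
    by rewrite rmorphB !rmorph_nat.
  by rewrite -rmorphM divff// gt_eqF// a0.
- by rewrite invr_ge0 exprn_ge0.
have cA : (#|` annulus i| <= c * ((4 ^ i + 4 ^ i) * #|` sphere t|))%N.
  apply: (@leq_trans #|` B (4 ^ (i + 3))|).
    by apply: fsubset_leq_card; apply/fsubsetP => v; rewrite !inE => /andP[].
  apply: leq_trans (B4 i (leqnn 3)) _; rewrite leq_mul2l; apply/orP; right.
  apply: (leq_trans tB); rewrite leq_mul2r; apply/orP; right.
  by rewrite -addn1 leq_add2l expn_gt0.
have Xq : (4 ^ i)%:R^-1 = q ^+ i * q ^+ i :> R.
  by apply: (mulfI (lt0r_neq0 i40)); rewrite divff ?lt0r_neq0// mulrA q4.
rewrite ler_pdivrMr ?exprn_gt0//.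
apply: (@le_trans _ _ (c%:R * (((4 ^ i)%:R + (4 ^ i)%:R) * #|` sphere t|%:R))).
  by rewrite -natrD -!natrM ler_nat.
rewrite [leRHS](_ : _ = (4 ^ i)%:R * q ^+ i * q ^+ i *
   (c%:R * (2 * c%:R) * ((4 ^ i)%:R + (4 ^ i)%:R) * #|` sphere t|%:R)); last by ring.
rewrite q4 mul1r !mulrA !ler_wpM2r// ?addr_ge0 ?(ltW i40)//.
by rewrite ler_peMl// -natrM ler1n muln_gt0 c0.
Qed.

(** The difference of two successive cutoffs lives between the lengths 3 *
    4^i and 20 * 4^i, where the averaged annulus function is 1. So f may be
    replaced by its product with that function, which is small by
    convolver_annulus. *)
Lemma convolver_step (f : Cc R G) i : bounded (comm_kernel L f) 1 ->
  convolver (fun z => f z * (cutoff i.+1 z - cutoff i z)%:C%C) (4 * c%:R ^+ 2 * q ^+ i).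
Proof.
move=> fM; have [t ti [S0 th]] := convolver_annulus i fM.
have m0 : 0 <= 2 * c%:R * q ^+ i.
  by rewrite mulr_ge0 ?exprn_ge0 ?invr_ge0// mulr_ge0.
have := convolverD (convolver_cutoff i.+1 th m0)
  (convolverN (convolver_cutoff i th m0)).
rewrite [X in convolver _ X -> _](_ : _ = 4 * c%:R ^+ 2 * q ^+ i); last by ring.
apply: eq_convolver => z; rewrite -mulrBr -rmorphB -mulrA -rmorphM.
congr (_ * _%:C%C); have [zi|iz] := leqP (L z) (3 * 4 ^ i).
  rewrite (cutoff1 zi) cutoff1; first by rewrite subrr mulr0.
  by apply: leq_trans zi _; rewrite expnS; lia.
have [zi|zi] := ltnP (5 * 4 ^ i.+1) (L z).
  rewrite (cutoff0 zi) cutoff0; first by rewrite subrr mulr0.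
  by apply: leq_ltn_trans zi; rewrite expnS; lia.
rewrite avg1 ?mul1r// => u; rewrite !inE BL => /andP[_ /eqP ut].
rewrite expnS in zi; rewrite BL expnD; apply/andP; split.
  by apply: leq_trans (LM _ _) _; lia.
by rewrite -(leq_add2r (L u)); apply: leq_trans (L_le _ _); lia.
Qed.

(** Telescoping. The sum is finite for each f since f has finite support,
    and its bound does not depend on the number of terms. *)
Lemma convolver_tail (f : Cc R G) n : bounded (comm_kernel L f) 1 ->
  convolver (fun z => f z * (1 - cutoff n z)%:C%C) (8 * c%:R ^+ 2 * q ^+ n).
Proof.
move=> fM.
have sum m : convolver (fun z => f z * (cutoff (n + m) z - cutoff n z)%:C%C)
    (8 * c%:R ^+ 2 * (q ^+ n - q ^+ (n + m))).
  elim: m => [|m IHm].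
    rewrite addn0 [q ^+ n - _]subrr mulr0; apply: eq_convolver (@convolver0 R G) => z.
    by rewrite subrr mulr0.
  have := convolverD IHm (convolver_step (n + m) fM).
  rewrite [X in convolver _ X -> _](_ : _ = 8 * c%:R ^+ 2 * (q ^+ n - q ^+ (n + m.+1))).
    apply: eq_convolver => z; rewrite -mulrDr -rmorphD addnS; congr (_ * _%:C%C).
    by rewrite [LHS]addrC addrA subrK.
  rewrite addnS (exprS q) (_ : q * _ = q ^+ (n + m) / 2); last by rewrite mulrC.
  by field.
have [m fm] : exists m, forall z, z \in finsupp f -> (L z <= m)%N.
  exists (\max_(z <- finsupp f) L z) => z zf; exact: leq_bigmax_seq.
have : convolver (fun z => f z * (1 - cutoff n z)%:C%C)
    (8 * c%:R ^+ 2 * (q ^+ n - q ^+ (n + m))).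
  apply: eq_convolver (sum m) => z.
  have [zf|/fsfun_dflt ->] := boolP (z \in finsupp f); last by rewrite !mul0r.
  rewrite (cutoff1 (i := n + m))//; apply: leq_trans (fm z zf) _.
  rewrite (@leq_trans (4 ^ m))//; first exact/ltnW/ltn_expl.
  by rewrite expnD; have := expn_gt0 4 n; have := expn_gt0 4 m; nia.
move=> /bounded_le; apply.
rewrite ler_wpM2l ?mulr_ge0 ?exprn_ge0// lerBlDr lerDl.
by rewrite exprn_ge0// invr_ge0.
Qed.

Lemma lam_split (f g h : Cc R G) : (forall z, f z = g z + h z) -> lam f - lam g = lam h.
Proof.
move=> fE; apply/funext => xi; apply/val_inj/funext => x.
pose A := (finsupp f `|` finsupp g `|` finsupp h)%fset.
have sub (k : Cc R G) : (finsupp k `<=` A)%fset ->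
    convol k xi x = \sum_(z <- A) k z * xi (z^-1 * x)%g.
  move=> /fsubsetP kA; rewrite (convolE _ kA) fct_sumE; apply: eq_bigr => z _.
  by [].
rewrite -[LHS]/(convol f xi x - convol g xi x) -[RHS]/(convol h xi x).
have fA : (finsupp f `<=` A)%fset by rewrite /A -fsetUA fsubsetUl.
have gA : (finsupp g `<=` A)%fset by rewrite /A fsubsetU// fsubsetUr.
have hA : (finsupp h `<=` A)%fset by rewrite /A fsubsetUr.
rewrite !sub// -sumrB; apply: eq_bigr => z _.
by rewrite fE mulrDl addrC addKr.
Qed.

Lemma fsfun_weight (f : Cc R G) (w : G -> R) :
  exists g : Cc R G, forall z, g z = f z * (w z)%:C%C.
Proof.
exists [fsfun z in finsupp f => (f z * (w z)%:C%C : C)] => z; rewrite fsfunE.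
by case: ifPn => // /fsfun_dflt ->; rewrite mul0r.
Qed.

(** The product of f with the cutoff at scale n lives on the ball of radius
    5 * 4^n, and what it misses has norm O(2^-n) by convolver_tail. Letting
    n depend on e only makes the ball independent of f. *)
Lemma uniform_tail (e : R) : 0 < e -> exists E : {fset G}, forall f : Cc R G,
  (L_D L f <= 1)%E -> exists g : Cc R G,
  [/\ (finsupp g `<=` E)%fset, forall z, normc (g z) <= normc (f z) &
       (opnorm (lam f - lam g)%R <= e%:E)%E].
Proof.
move=> e0; have [n ne] : exists n, 8 * c%:R ^+ 2 * q ^+ n <= e.
  pose a := 8 * c%:R ^+ 2 : R; pose n := Num.bound (a / e); exists n.
  have a0 : 0 <= a by rewrite mulr_ge0 ?exprn_ge0.
  have an : a / e < n%:R by apply: archi_boundP; rewrite divr_ge0// ltW.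
  have n2 : n%:R <= 2 ^+ n :> R by rewrite -natrX ler_nat ltnW// ltn_expl.
  rewrite -/a /q exprVn ler_pdivrMr ?exprn_gt0//.
  rewrite mulrC -ler_pdivrMr//; apply: le_trans n2; exact: ltW.
exists (B (5 * 4 ^ n)) => f /commutator_bounded fM.
have [g gE] := fsfun_weight f (cutoff n); have [h hE] := fsfun_weight f (fun z => 1 - cutoff n z).
exists g; split.
- apply/fsubsetP => z; rewrite mem_finsupp BL; apply: contraNT; rewrite -ltnNge => /cutoff0 z0.
  by rewrite gE z0 mulr0.
- move=> z; rewrite gE normcM normcR ger0_norm ?avg_ge0//.
  by rewrite ler_piMr ?normc_ge0 ?avg_le1.
rewrite (lam_split (h := h)) => [|z]; last first.
  by rewrite gE hE -mulrDr -rmorphD addrC subrK mulr1.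
apply: lam_bounded => //; apply: bounded_le ne.
by apply: eq_convolver (convolver_tail n fM) => z; rewrite hE.
Qed.

End Tail.

(** * Unconditional sums *)

Section UnconditionalSums.
Variables (R : realType) (G : groupType).
Local Notation C := (R[i]^o).
Implicit Types (A B F : {fset G}) (u v : G -> C) (s t : C).

Lemma fset_approx (p : G -> R) (M e : R) : (forall x, 0 <= p x) ->
  (forall F, \sum_(x <- F) p x <= M) -> 0 < e ->
  exists A, forall B, (A `<=` B)%fset ->
    `|\sum_(x <- B) p x - fine (\esum_(x in [set: G]) (p x)%:E)%E| <= e.
Proof.
move=> p0 pM e0; set s := (\esum_(x in _) _)%E.
have sM : (s <= M%:E)%E by apply/esum_le_fset.
have s0 : (0 <= s)%E by apply: esum_ge0 => x _; rewrite lee_fin.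
have sE : s = (fine s)%:E by rewrite fineK// ge0_fin_numE// (le_lt_trans sM) ?ltry.
have sub F : \sum_(x <- F) p x <= fine s.
  by move: F; apply/esum_le_fset; rewrite -sE.
have mono A B : (A `<=` B)%fset -> \sum_(x <- A) p x <= \sum_(x <- B) p x.
  move=> AB; have -> : \sum_(x <- A) p x = \sum_(x <- B) (if x \in A then p x else 0).
    rewrite -(big_fset_incl _ AB) => [|x _ /negbTE ->//].
    by apply: eq_big_seq => x ->.
  by apply: ler_sum => x _; case: ifP.
have [A sA] : exists A, fine s - e <= \sum_(x <- A) p x.
  apply: contrapT => /forallNP nA.
  have : (s <= (fine s - e)%:E)%E.
    by apply/esum_le_fset => F; apply/ltW; rewrite ltNge; apply/negP/nA.
  by rewrite sE lee_fin lerBrDr gerDl leNgt e0.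
exists A => B AB; rewrite ler_norml; apply/andP; split.
  by have := mono A B AB; lra.
by have := sub B; lra.
Qed.

Lemma rsum_approx (u : G -> R) (M e : R) :
  (forall F, \sum_(x <- F) `|u x| <= M) -> 0 < e ->
  exists A, forall B, (A `<=` B)%fset -> `|\sum_(x <- B) u x - rsum u| <= e.
Proof.
move=> uM e0; have e2 : 0 < e / 2 by rewrite divr_gt0.
have bnd (p : G -> R) : (forall x, p x <= `|u x|) -> forall F, \sum_(x <- F) p x <= M.
  by move=> pu F; apply: le_trans (uM F); apply: ler_sum => x _.
have [||A AP] := @fset_approx (fun x => Num.max (u x) 0) M _ _ _ e2.
- by move=> x; rewrite le_max lexx orbT.
- by apply: bnd => x; rewrite ge_max ler_norm normr_ge0.
have [||A' AP'] := @fset_approx (fun x => Num.max (- u x) 0) M _ _ _ e2.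
- by move=> x; rewrite le_max lexx orbT.
- by apply: bnd => x; rewrite ge_max normr_ge0 -normrN ler_norm.
exists (A `|` A')%fset => B; rewrite fsubUset => /andP[/AP h /AP' h'].
rewrite /rsum; move: h h'; set P := fine _; set N := fine _ => h h'.
have -> : \sum_(x <- B) u x =
    \sum_(x <- B) Num.max (u x) 0 - \sum_(x <- B) Num.max (- u x) 0.
  rewrite -sumrB; apply: eq_bigr => x _; rewrite /Num.max oppr_lt0.
  by case: (ltgtP (u x) 0) => [_|_|->]; [rewrite sub0r opprK|rewrite subr0|rewrite !oppr0 addr0].
move: h h'; rewrite !ler_norml; lra.
Qed.

(** Convergence along the directed set of finite subsets. *)
Definition has_sum u s := forall e : R, 0 < e -> exists A, forall B,
  (A `<=` B)%fset -> normc (\sum_(x <- B) u x - s) <= e.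

Lemma csum_has_sum u (M : R) : (forall F, \sum_(x <- F) normc (u x) <= M) ->
  has_sum u (csum u).
Proof.
move=> uM e e0; have e2 : 0 < e / 2 by rewrite divr_gt0.
have normRe (z : C) : `|complex.Re z| <= normc z.
  case: z => a b /=; rewrite -sqrtr_sqr ler_wsqrtr// lerDl sqr_ge0//.
have normIm (z : C) : `|complex.Im z| <= normc z.
  case: z => a b /=; rewrite -sqrtr_sqr ler_wsqrtr// lerDr sqr_ge0//.
have norm_le (z : C) : normc z <= `|complex.Re z| + `|complex.Im z|.
  rewrite -[leRHS]ger0_norm ?addr_ge0// -sqrtr_sqr.
  case: z => a b; rewrite /normc /= ler_wsqrtr//.
  rewrite sqrrD !real_normK ?num_real// -addrA lerD2l lerDr.
  by rewrite mulrn_wge0// mulr_ge0.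
have [|A AP] := @rsum_approx (fun x => complex.Re (u x)) M _ _ e2.
  by move=> F; apply: le_trans (uM F); apply: ler_sum => x _.
have [|A' AP'] := @rsum_approx (fun x => complex.Im (u x)) M _ _ e2.
  by move=> F; apply: le_trans (uM F); apply: ler_sum => x _.
exists (A `|` A')%fset => B; rewrite fsubUset => /andP[/AP h /AP' h'].
apply: le_trans (norm_le _) _; rewrite [complex.Re _]raddfB [complex.Im _]raddfB !raddf_sum.
by rewrite (splitr e); apply: lerD; [exact: h|exact: h'].
Qed.

Lemma has_sum_unique u s t : has_sum u s -> has_sum u t -> s = t.
Proof.
move=> us ut; apply/eqP; rewrite -subr_eq0; apply/eqP/(@eq0_normc R).
apply/eqP; rewrite eq_le normc_ge0 andbT; apply/ler_addgt0Pl => e e0; rewrite addr0.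
have e2 : 0 < e / 2 by rewrite divr_gt0.
have [A AP] := us _ e2; have [A' AP'] := ut _ e2.
have hA := AP _ (fsubsetUl A A'); have hA' := AP' _ (fsubsetUr A A').
move: hA hA'; set S := \sum_(x <- _) _ => h h'.
have -> : s - t = - (S - s) + (S - t) by ring.
by apply: le_trans (le_normcD _ _) _; rewrite normcN; lra.
Qed.

Lemma has_sum_fin u F : (forall x, x \notin F -> u x = 0) -> has_sum u (\sum_(x <- F) u x).
Proof.
move=> uF e e0; exists F => B FB; rewrite -(big_fset_incl _ FB) => [|x _ /uF//].
by rewrite subrr normc0 ltW.
Qed.

Lemma has_sumD u v s t : has_sum u s -> has_sum v t -> has_sum (fun x => u x + v x) (s + t).
Proof.
move=> us vt e e0; have e2 : 0 < e / 2 by rewrite divr_gt0.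
have [A AP] := us _ e2; have [A' AP'] := vt _ e2.
exists (A `|` A')%fset => B; rewrite fsubUset => /andP[/AP h /AP' h'].
rewrite big_split /= opprD addrACA.
by apply: le_trans (le_normcD _ _) _; lra.
Qed.

Lemma has_sumZ a u s : has_sum u s -> has_sum (fun x => a * u x) (a * s).
Proof.
move=> us e e0; have a0 : 0 < normc a + 1 by rewrite ltr_wpDl ?normc_ge0.
have [A AP] := us _ (divr_gt0 e0 a0); exists A => B /AP h.
rewrite -mulr_sumr -mulrBr normcM.
apply: le_trans (ler_wpM2l (normc_ge0 a) h) _.
by rewrite mulrCA ler_piMr ?(ltW e0)// ler_pdivrMr// mul1r lerDl.
Qed.

Lemma has_sum_conj u s : has_sum u s -> has_sum (fun x => (u x)^*%C) (s^*%C).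
Proof.
move=> us e e0; have [A AP] := us e e0; exists A => B /AP.
by rewrite -normc_conj raddfB raddf_sum.
Qed.

Lemma has_sum_le u s (M : R) : (forall F, normc (\sum_(x <- F) u x) <= M) ->
  has_sum u s -> normc s <= M.
Proof.
move=> uM us; apply/ler_addgt0Pl => e e0; have [A AP] := us e e0.
have := AP A (fsubset_refl A); have := uM A; set S := \sum_(x <- _) _ => h h'.
have -> : s = - (S - s) + S by ring.
by apply: le_trans (le_normcD _ _) _; rewrite normcN; lra.
Qed.

Lemma eq_has_sum u v s : u =1 v -> has_sum u s -> has_sum v s.
Proof. by move=> /funext ->. Qed.

End UnconditionalSums.

(** * The inner product *)

Section InnerProduct.
Variables (R : realType) (G : groupType).
Local Notation C := (R[i]^o).
Local Notation l2 := (l2 R G).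
Implicit Types (A B F : {fset G}) (xi eta : l2) (a b : R).

Definition sqn_le (xi : G -> C) a := forall F, nrm2 F xi <= a.

Lemma sqn_leP xi : exists2 a, 0 <= a & sqn_le xi a.
Proof.
have /l2_predP[r r0 /(l2norm_leP _ r0) xir] := l2P xi.
by exists (r ^+ 2); rewrite ?sqr_ge0.
Qed.

Lemma sqn_le_ge0 (xi : G -> C) a : sqn_le xi a -> 0 <= a.
Proof. by move=> /(_ fset0); apply: le_trans; exact: nrm2_ge0. Qed.

Lemma sum_mul_le F (x y : G -> C) a b t : sqn_le x a -> sqn_le y b -> 0 < t ->
  \sum_(g <- F) normc (x g * (y g)^*%C) <= (t * a + t^-1 * b) / 2.
Proof.
move=> xa yb t0.
apply: (@le_trans _ _ ((t * nrm2 F x + t^-1 * nrm2 F y) / 2)); last first.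
  by rewrite ler_wpM2r// lerD// ler_wpM2l ?invr_ge0// ltW.
rewrite /nrm2 !mulr_sumr -big_split /= mulr_suml; apply: ler_sum => g _.
rewrite normcM normc_conj; set p := normc (x g); set q := normc (y g).
rewrite ler_pdivlMr// -(ler_pM2l t0).
have -> : t * (t * p ^+ 2 + t^-1 * q ^+ 2) = (t * p) ^+ 2 + (t * t^-1) * q ^+ 2 by ring.
rewrite divff ?gt_eqF//; have := sqr_ge0 (t * p - q); lra.
Qed.

Lemma inner_has_sum xi eta : has_sum (fun x => xi x * (eta x)^*%C) (inner xi eta).
Proof.
have [a _ xia] := sqn_leP xi; have [b _ etab] := sqn_leP eta.
by apply: csum_has_sum => F; exact: (sum_mul_le _ xia etab ltr01).
Qed.

Lemma inner_le xi eta a b t : sqn_le xi a -> sqn_le eta b -> 0 < t ->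
  normc (inner xi eta) <= (t * a + t^-1 * b) / 2.
Proof.
move=> xia etab t0; apply: (has_sum_le _ (inner_has_sum xi eta)) => F.
by apply: le_trans (normc_sum _ _ _) _; exact: sum_mul_le.
Qed.

Lemma inner_linear (c : C) xi xi' eta :
  inner (c *: xi + xi') eta = c * inner xi eta + inner xi' eta.
Proof.
apply: has_sum_unique (inner_has_sum _ _) _.
apply: eq_has_sum (has_sumD (has_sumZ c (inner_has_sum xi eta)) (inner_has_sum xi' eta)).
by move=> x; rewrite [in RHS]/= mulrDl mulrA.
Qed.

Lemma inner0l xi : inner (0 : l2) xi = 0.
Proof.
have := inner_linear 1 0 0 xi; rewrite scale1r addr0 mul1r.
by move=> /(congr1 (fun z => z - inner (0 : l2) xi)); rewrite subrr addrK.
Qed.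

Lemma inner_conj xi eta : inner eta xi = (inner xi eta)^*%C.
Proof.
apply: has_sum_unique (inner_has_sum _ _) _.
apply: eq_has_sum (has_sum_conj (inner_has_sum xi eta)) => x.
by rewrite rmorphM /= conjcK mulrC.
Qed.

Lemma inner_linearr (c : C) xi eta eta' :
  inner xi (c *: eta + eta') = c^*%C * inner xi eta + inner xi eta'.
Proof.
rewrite inner_conj inner_linear [inner xi eta]inner_conj [inner xi eta']inner_conj.
by rewrite rmorphD rmorphM.
Qed.

Lemma inner_self xi : exists N : R, [/\ sqn_le xi N, inner xi xi = N%:C%C &
  forall e : R, 0 < e -> exists A, N - e <= nrm2 A xi].
Proof.
have [a a0 xia] := sqn_leP xi.
have sumE F : \sum_(x <- F) xi x * (xi x)^*%C = (nrm2 F xi)%:C%C.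
  by rewrite rmorph_sum; apply: eq_bigr => x _; rewrite mulc_conj.
have IE := inner_has_sum xi xi.
have Im0 : complex.Im (inner xi xi) = 0.
  apply/eqP; rewrite -normr_eq0 eq_le normr_ge0 andbT; apply/ler_addgt0Pl => e e0.
  rewrite addr0; have [A /(_ A (fsubset_refl A))] := IE e e0; rewrite sumE.
  apply: le_trans; case: (inner xi xi) => p q /=.
  by rewrite sub0r sqrrN -sqrtr_sqr ler_wsqrtr// lerDr sqr_ge0.
exists (complex.Re (inner xi xi)); move: Im0 IE; case: (inner xi xi) => N _ /= -> IE.
have near e : 0 < e -> exists A, forall B, (A `<=` B)%fset -> `|nrm2 B xi - N| <= e.
  move=> e0; have [A AP] := IE e e0; exists A => B /AP; rewrite sumE.
  by rewrite -[(N +i* 0)%C]/(N%:C%C) -rmorphB normcR.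
split=> // [F|e e0].
  apply/ler_addgt0Pl => e e0; have [A AP] := near e e0.
  have := AP _ (fsubsetUl A F); have := nrm2_sub xi (fsubsetUr A F).
  by rewrite ler_norml; lra.
have [A /(_ A (fsubset_refl A))] := near e e0; rewrite ler_norml => h; exists A; lra.
Qed.

Lemma cut_approx xi (e : R) : 0 < e -> exists F, sqn_le (xi - cutl2 F xi) e.
Proof.
move=> e0; have [N [xiN _ Ne]] := inner_self xi; have [A AN] := Ne e e0.
exists A => E.
have split_nrm B (u : G -> C) : (forall x, u x = xi x - cut A xi x) ->
    nrm2 B u + nrm2 B (cut A xi) = nrm2 B xi.
  move=> uE; rewrite /nrm2 -big_split; apply: eq_bigr => x _ /=.
  rewrite uE /cut; case: ifP => _; first by rewrite subrr normc0 expr0n add0r.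
  by rewrite subr0 normc0 expr0n addr0.
apply: le_trans (nrm2_sub _ (fsubsetUl E A)) _.
have := @split_nrm (E `|` A)%fset (xi - cutl2 A xi) (fun x => erefl).
by rewrite nrm2_cut_sub ?fsubsetUr//; have := xiN (E `|` A)%fset; lra.
Qed.

End InnerProduct.

(** * Adjoints *)

Section Adjoint.
Variables (R : realType) (G : groupType).
Local Notation C := (R[i]^o).
Local Notation l2 := (l2 R G).
Implicit Types (A B F : {fset G}) (xi eta : l2) (T : l2 -> l2).

Lemma linear_op0 T : linear T -> T 0 = 0.
Proof.
move=> linT; have := linT 1 0 0; rewrite !scale1r addr0.
by move=> /(congr1 (fun z => z - T 0)); rewrite subrr addrK.
Qed.

(** The bound of an operator norm without the restriction to the unit
    ball. *)
Definition op_le T (e : R) := forall xi a, sqn_le xi a -> sqn_le (T xi) (e ^+ 2 * a).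

Lemma opnorm_op_le T (e : R) : linear T -> 0 <= e -> (opnorm T <= e%:E)%E <-> op_le T e.
Proof.
move=> linT e0; split=> [/opnorm_leP Te xi a xia F|Te]; last first.
  apply/opnorm_leP => xi /l2norm_leP xi1; apply/l2norm_leP => // F.
  have := Te xi 1 _ F; rewrite mulr1; apply => E.
  by have := xi1 ler01 E; rewrite expr1n.
apply/ler_addgt0Pl => d d0.
have a0 := sqn_le_ge0 xia.
have e1 : 0 < e ^+ 2 + 1 by rewrite ltr_wpDl ?sqr_ge0.
pose s := Num.sqrt (a + d / (e ^+ 2 + 1)).
have ad : 0 < a + d / (e ^+ 2 + 1) by rewrite ltr_wpDl// divr_gt0.
have s2 : s ^+ 2 = a + d / (e ^+ 2 + 1) by rewrite sqr_sqrtr// ltW.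
have s0 : 0 < s by rewrite sqrtr_gt0.
have TZ (c : C) eta : T (c *: eta) = c *: T eta.
  by have := linT c eta 0; rewrite !addr0 linear_op0// addr0.
pose c : C := (s^-1)%:C%C.
have /l2norm_leP : (l2norm (T (c *: xi)) <= e%:E)%E.
  apply: Te; apply/l2norm_leP => // E; rewrite expr1n [nrm2 _ _]nrm2Z normcR.
  rewrite real_normK ?num_real// exprVn ler_pdivrMl ?exprn_gt0// mulr1 s2.
  by apply: le_trans (xia E) _; rewrite lerDl ltW// divr_gt0.
move=> /(_ e0 F); rewrite TZ [nrm2 _ _]nrm2Z normcR.
rewrite real_normK ?num_real// exprVn ler_pdivrMl ?exprn_gt0// s2.
move=> h; apply: (le_trans h); rewrite mulrDl addrC [a * _]mulrC lerD2r.
by rewrite -mulrA ler_piMr ?(ltW d0)// mulrC ler_pdivrMr// mul1r lerDl.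
Qed.

Definition delta (x : G) : l2 := cutl2 [fset x]%fset (fun=> 1).

Lemma cutl2_delta F (u : G -> C) : cutl2 F u = \sum_(x <- F) u x *: delta x.
Proof.
apply/val_inj/funext => y.
have -> : val (\sum_(x <- F) u x *: delta x) y = \sum_(x <- F) u x * (y == x)%:R.
  rewrite raddf_sum fct_sumE; apply: eq_bigr => x _.
  rewrite -[LHS]/(u x * cut [fset x]%fset (fun=> 1) y) /cut inE.
  by case: eqP.
rewrite /= /cut; case: ifPn => yF.
  rewrite (big_fsetD1 y)//= eqxx mulr1 big1_fset ?addr0// => x.
  by rewrite in_fsetD1 eq_sym => /andP[/negbTE -> _] _; rewrite mulr0.
rewrite big1_fset// => x xF _; case: eqP => [yx|]; last by rewrite mulr0.
by rewrite -yx (negbTE yF) in xF.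
Qed.

(** The value at x of the adjoint applied to xi, as its inner product with
    the basis vector at x. *)
Definition adj_fun T xi : G -> C := fun x => inner xi (T (delta x)).

Lemma has_sum_cut (u v : G -> C) F :
  has_sum (fun x => u x * (cut F v x)^*%C) (\sum_(x <- F) u x * (v x)^*%C).
Proof.
have -> : \sum_(x <- F) u x * (v x)^*%C = \sum_(x <- F) u x * (cut F v x)^*%C.
  by apply: eq_big_seq => x xF; rewrite /cut xF.
by apply: has_sum_fin => x /negbTE xF; rewrite /cut xF conjc0 mulr0.
Qed.

Lemma linear_sum T F (u : G -> C) : linear T ->
  T (\sum_(x <- F) u x *: delta x) = \sum_(x <- F) u x *: T (delta x).
Proof.
move=> linT; elim: (enum_fset F) => [|x s IHs].
  by rewrite !big_nil linear_op0.
by rewrite !big_cons linT IHs.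
Qed.

Lemma adj_fun_cut T xi F (u : G -> C) : linear T ->
  \sum_(x <- F) adj_fun T xi x * (u x)^*%C = inner xi (T (cutl2 F u)).
Proof.
move=> linT; rewrite cutl2_delta linear_sum//.
elim: (enum_fset F) => [|x s IHs].
  by rewrite !big_nil inner_conj inner0l conjc0.
by rewrite !big_cons inner_linearr IHs /adj_fun mulrC.
Qed.

(** Applied to the vector zeta that equals adj_fun T xi on F and 0
    elsewhere, the inner product of xi with T zeta is the squared norm q of
    zeta; hence q <= (e^2 a + q) / 2. *)
Lemma adj_fun_le T e xi a : linear T -> 0 < e -> op_le T e -> sqn_le xi a ->
  sqn_le (adj_fun T xi) (e ^+ 2 * a).
Proof.
move=> linT e0 Te xia F; pose q := nrm2 F (adj_fun T xi).
have qE : inner xi (T (cutl2 F (adj_fun T xi))) = q%:C%C.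
  rewrite -adj_fun_cut// rmorph_sum; apply: eq_bigr => x _.
  by rewrite mulc_conj.
have cq : sqn_le (cutl2 F (adj_fun T xi)) q by move=> E; exact: nrm2_cut.
have e20 : 0 < e ^+ 2 by rewrite exprn_gt0.
have := inner_le xia (Te _ _ cq) e20.
rewrite qE normcR ger0_norm ?nrm2_ge0// mulKf ?gt_eqF//.
by rewrite -/q; lra.
Qed.

Section BoundedOperator.
Variables (T : l2 -> l2) (e : R).
Hypotheses (linT : linear T) (e0 : 0 < e) (Te : op_le T e).

Lemma adj_l2 xi : adj_fun T xi \in @l2_pred R G.
Proof.
have [a a0 xia] := sqn_leP xi.
have b0 : 0 <= e ^+ 2 * a by rewrite mulr_ge0 ?sqr_ge0.
apply/l2_predP; exists (Num.sqrt (e ^+ 2 * a)); first exact: sqrtr_ge0.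
apply/l2norm_leP; first exact: sqrtr_ge0.
by rewrite sqr_sqrtr//; exact: adj_fun_le.
Qed.

Definition adj xi : l2 := L2 (adj_l2 xi).

Lemma adj_linear : linear adj.
Proof.
by move=> c u v; apply/val_inj/funext => x; rewrite /= /adj_fun inner_linear.
Qed.

Lemma adj_op_le : op_le adj e.
Proof. by move=> xi a xia; exact: adj_fun_le. Qed.

(** Both sides agree when eta has finite support and depend continuously on
    eta. *)
Lemma inner_adj xi eta : inner (adj xi) eta = inner xi (T eta).
Proof.
have [a a0 xia] := sqn_leP xi; have ada := adj_op_le xia.
apply/eqP; rewrite -subr_eq0; apply/eqP/(@eq0_normc R).
apply/eqP; rewrite eq_le normc_ge0 andbT; apply/ler_addgt0Pl => d d0; rewrite addr0.
have e20 : 0 < e ^+ 2 by rewrite exprn_gt0.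
have a1 : 0 < e ^+ 2 * a + 1 by rewrite ltr_wpDl// mulr_ge0// ltW.
pose t := d / (e ^+ 2 * a + 1) / 2.
have t0 : 0 < t by rewrite !divr_gt0.
have dt0 : 0 < d * t / 2 by rewrite divr_gt0// mulr_gt0.
have [F Fd] := cut_approx eta dt0.
have cutE : inner (adj xi) (cutl2 F eta) = inner xi (T (cutl2 F eta)).
  rewrite -adj_fun_cut//; apply: has_sum_unique (inner_has_sum _ _) _.
  exact: has_sum_cut.
pose rest := eta - cutl2 F eta.
have etaE : eta = 1 *: cutl2 F eta + rest by rewrite scale1r addrC subrK.
have -> : inner (adj xi) eta - inner xi (T eta) = inner (adj xi) rest - inner xi (T rest).
  rewrite {1 2}etaE linT !inner_linearr cutE.
  by rewrite opprD addrACA subrr add0r.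
apply: le_trans (le_normcD _ _) _; rewrite normcN.
have h1 := inner_le ada Fd t0.
have et0 : 0 < t * e ^+ 2 by rewrite mulr_gt0.
have h2 := inner_le xia (Te Fd) et0.
have E1 : t * (e ^+ 2 * a) <= d / 2.
  have : t * (e ^+ 2 * a) <= t * (e ^+ 2 * a + 1) by rewrite ler_wpM2l ?lerDl// ltW.
  move=> /le_trans; apply; rewrite le_eqVlt; apply/orP; left; apply/eqP.
  by rewrite /t; field; rewrite gt_eqF.
have E2 : t^-1 * (d * t / 2) = d / 2.
  by rewrite mulrA mulrCA mulVf ?gt_eqF// mulr1.
have E3 : (t * e ^+ 2)^-1 * (e ^+ 2 * (d * t / 2)) = d / 2.
  by field; rewrite (gt_eqF t0) (gt_eqF e0).
have E4 : t * e ^+ 2 * a = t * (e ^+ 2 * a) by rewrite -[LHS]mulrA.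
move: h1 h2; rewrite E2 E3 E4 => h1 h2.
apply: le_trans (lerD h1 h2) _; move: E1; lra.
Qed.

End BoundedOperator.

End Adjoint.

(** * States are bounded *)

Section States.
Variables (R : realType) (G : groupType).
Local Notation C := (R[i]^o).
Local Notation l2 := (l2 R G).
Local Notation cstar := (cstar R G).
Implicit Types (F : {fset G}) (xi eta : l2) (T : l2 -> l2) (f : Cc R G).

Lemma fsfun_star f : exists g : Cc R G, forall z, g z = (f z^-1%g)^*%C.
Proof.
exists [fsfun z in [fset z^-1%g | z in finsupp f]%fset => ((f z^-1%g)^*%C : C)] => z.
rewrite fsfunE; case: ifPn => // zf; rewrite fsfun_dflt ?conjc0//.
by apply: contra zf => zf; apply/imfsetP; exists z^-1%g => //; rewrite invgK.
Qed.

Lemma adj_lam f (g : Cc R G) xi : (forall z, g z = (f z^-1%g)^*%C) ->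
  adj_fun (lam f) xi = convol g xi.
Proof.
move=> gE; apply/funext => x; rewrite (convol_support _ (fsubset_refl _)).
apply: has_sum_unique (inner_has_sum _ _) _.
set F := imfset _ _ _.
have lE y : lam f (delta R x) y = f (y * x^-1)%g.
  by rewrite -[LHS]/(convol f _ y) convol_cut big_seq_fset1 mulr1.
have -> : (fun y => xi y * (lam f (delta R x) y)^*%C) = (fun y => g (x * y^-1)%g * xi y).
  by apply/funext => y; rewrite lE gE invgM invgK mulrC.
apply: has_sum_fin => y yF; rewrite [g _]fsfun_dflt ?mul0r//.
apply: contra yF => yf; apply/imfsetP; exists (x * y^-1)%g => //.
by rewrite invgM invgK mulgVK.
Qed.

Lemma op_linearB T T' : linear T -> linear T' -> linear (T - T').
Proof.
move=> lT lT' a u v; rewrite !fctE lT lT' scalerBr !opprD -!addrA; congr (_ + _).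
by rewrite addrCA.
Qed.

Lemma cstar_op_le (a : cstar) : exists2 e : R, 0 < e & op_le a e.
Proof.
have /asboolP[linT /(_ 1 ltr01)[f]] := cstarP a.
rewrite (opnorm_op_le (op_linearB linT (lam_linear f)) ler01) => af.
have [M M0 /(opnorm_op_le (lam_linear f) (ltW M0)) lf] := lam_opnorm f.
have e0 : 0 < 2 * (1 + M ^+ 2) by rewrite mulr_gt0// ltr_wpDr// sqr_ge0.
exists (Num.sqrt (2 * (1 + M ^+ 2))); first by rewrite sqrtr_gt0.
move=> xi r xir F; rewrite sqr_sqrtr; last exact: ltW.
have := af xi r xir F; have := lf xi r xir F; rewrite expr1n mul1r => h1 h2.
apply: (@le_trans _ _ (2 * nrm2 F ((cstar_fun a - lam f) xi) + 2 * nrm2 F (lam f xi))).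
  rewrite /nrm2 !mulr_sumr -big_split; apply: ler_sum => x _ /=.
  apply: le_trans (sqr_normcD _ _); rewrite le_eqVlt; apply/orP; left.
  by apply/eqP; congr (normc _ ^+ 2); rewrite subrK.
by lra.
Qed.

(** The adjoint of a limit of lam f is the limit of lam g, where g(z) is the
    conjugate of f(z^-1). *)
Lemma cstar_adjoint (a : cstar) : exists b : cstar,
  forall xi eta, inner (b xi) eta = inner xi (a eta).
Proof.
have [e e0 ae] := cstar_op_le a.
have /asboolP[linT clT] := cstarP a.
have bP : adj linT e0 ae \in @cstar_pred R G.
  apply/asboolP; split; first exact: adj_linear.
  move=> d d0; have [f] := clT d d0.
  rewrite (opnorm_op_le (op_linearB linT (lam_linear f)) (ltW d0)) => af.
  have [g gE] := fsfun_star f; exists g.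
  apply/(opnorm_op_le (op_linearB (adj_linear linT e0 ae) (lam_linear g)) (ltW d0)).
  move=> xi r xir F; have := adj_fun_le (op_linearB linT (lam_linear f)) d0 af xir F.
  suff -> : adj_fun (cstar_fun a - lam f) xi = (adj linT e0 ae - lam g) xi by [].
  apply/funext => x; rewrite -[RHS]/(adj_fun a xi x - convol g xi x) -(adj_lam xi gE).
  rewrite /adj_fun.
  have -> : (cstar_fun a - lam f) (delta R x) = (-1) *: lam f (delta R x) + a (delta R x).
    by rewrite scaleN1r addrC.
  by rewrite inner_linearr rmorphN rmorph1 mulN1r addrC.
by exists (CStar bP) => xi eta; exact: inner_adj.
Qed.

Lemma real_squeeze (z : R[i]) (r : R) : 0 <= r%:C%C + z -> 0 <= r%:C%C - z -> normc z <= r.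
Proof.
case: z => p q; rewrite !lecE /= => /andP[/eqP q0 h1] /andP[_ h2].
have -> : q = 0 by move: q0; rewrite add0r.
by rewrite expr0n addr0 sqrtr_sqr ler_norml; lra.
Qed.

(** For a self-adjoint operator a of norm at most r, both r + a and r - a
    are positive. *)
Lemma state_real (mu : state R G) (a : cstar) (r : R) :
  (forall xi, exists2 s : R, inner (a xi) xi = s%:C%C &
     forall N, sqn_le xi N -> `|s| <= r * N) ->
  normc (mu a) <= r.
Proof.
move=> ar.
have pos (c : C) : c = 1 \/ c = -1 -> 0 <= mu (r%:C%C *: cstar1 R G + c *: a).
  move=> cE; apply: state_ge0 => xi.
  have [N [xiN xiE _]] := inner_self xi; have [s sE /(_ N xiN)] := ar xi.
  have -> : (r%:C%C *: cstar1 R G + c *: a : cstar) xi = r%:C%C *: xi + c *: a xi by [].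
  rewrite inner_linear -[c *: a xi]addr0 inner_linear xiE sE.
  rewrite inner0l addr0 ler_norml => /andP[h1 h2].
  case: cE => ->; rewrite ?mul1r ?mulN1r -rmorphM -?rmorphN -rmorphD ler0c; lra.
have muE (c : C) : mu (r%:C%C *: cstar1 R G + c *: a) = r%:C%C + c * mu a.
  by rewrite linearD !linearZ /= state1 mulr1.
apply: real_squeeze.
  by have := pos 1 (or_introl erefl); rewrite muE mul1r.
by have := pos (-1) (or_intror erefl); rewrite muE mulN1r.
Qed.

(** Twice an operator a is (a + b) + i (i (b - a)), where b is its adjoint;
    both a + b and i (b - a) are self-adjoint of norm at most 2 e. *)
Lemma state_le (mu : state R G) (a : cstar) (e : R) : 0 < e ->
  (opnorm (cstar_fun a : l2 -> G -> C) <= e%:E)%E -> normc (mu a) <= 2 * e.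
Proof.
move=> e0; have /asboolP[linT _] := cstarP a.
move=> /(opnorm_op_le linT (ltW e0)) ae.
have [b bE] := cstar_adjoint a.
have binner xi : inner (b xi) xi = (inner (a xi) xi)^*%C by rewrite bE inner_conj.
have ale xi N : sqn_le xi N -> normc (inner (a xi) xi) <= e * N.
  move=> xiN; have ei : 0 < e^-1 by rewrite invr_gt0.
  have := inner_le (ae xi N xiN) xiN ei; rewrite invrK.
  have -> : (e^-1 * (e ^+ 2 * N) + e * N) / 2 = e * N by field; rewrite gt_eqF.
  by [].
have i2 : 'i%C * 'i%C = -1 :> R[i] by rewrite -expr2 sqr_i.
have hA : normc (mu (a + b)) <= 2 * e.
  apply: state_real => xi; exists (2 * complex.Re (inner (a xi) xi)).
    have -> : (a + b : cstar) xi = 1 *: a xi + b xi by rewrite scale1r.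
    rewrite inner_linear mul1r binner; case: (inner _ _) => p q.
    by apply/eqP; rewrite eq_complex /=; apply/andP; split; apply/eqP; lra.
  move=> N /ale; case: (inner _ _) => p q /= h.
  rewrite normrM ger0_norm// -mulrA ler_wpM2l//; apply: le_trans h.
  by rewrite -sqrtr_sqr ler_wsqrtr// lerDl sqr_ge0.
have hB : normc (mu ('i%C *: (b - a))) <= 2 * e.
  apply: state_real => xi; exists (2 * complex.Im (inner (a xi) xi)).
    have -> : ('i%C *: (b - a) : cstar) xi = 'i%C *: ((-1) *: a xi + b xi) + 0.
      by rewrite addr0 scaleN1r addrC.
    rewrite inner_linear inner_linear mulN1r binner inner0l addr0; case: (inner _ _) => p q.
    by apply/eqP; rewrite eq_complex /=; apply/andP; split; apply/eqP; lra.
  move=> N /ale; case: (inner _ _) => p q /= h.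
  rewrite normrM ger0_norm// -mulrA ler_wpM2l//; apply: le_trans h.
  by rewrite -sqrtr_sqr ler_wsqrtr// lerDr sqr_ge0.
have aE : 2 * mu a = mu (a + b) + 'i%C * mu ('i%C *: (b - a)).
  rewrite linearZ /= raddfB /= raddfD /= mulrA i2.
  by ring.
have : normc (2 * mu a) <= 2 * e + 2 * e.
  rewrite aE; apply: le_trans (le_normcD _ _) _; rewrite lerD// normcM.
  by rewrite [normc 'i%C](_ : _ = 1) ?mul1r// /normc /= expr0n add0r expr1n sqrtr1.
rewrite normcM (normc_nat _ 2); lra.
Qed.

End States.

(** * The topology of pointwise convergence *)

Section WeakStar.
Variables (R : realType) (G : groupType).
Local Notation C := (R[i]^o).
Local Notation cstar := (cstar R G).
Local Notation state := (state R G).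
Implicit Types (mu nu : state) (a : cstar) (U : set state).

Lemma normc_ball (z w : C) (d : R) : ball z d%:C%C w <-> normc (z - w) < d.
Proof.
have nE (x : R[i]) : `|x| = (normc x)%:C%C by [].
rewrite -ball_normE /ball_ /=.
rewrite nE ltcR.
by [].
Qed.

Lemma near_preimage (X Y : topologicalType) (f : X -> Y) (x : X) (D : set Y) :
  continuous f -> nbhs (f x) D -> nbhs x (f @^-1` D).
Proof. by move=> fc; apply: fc. Qed.

Lemma weak_star_near mu a (d : R) : 0 < d ->
  nbhs (mu : weak_star R G) [set nu : state | normc (mu a - nu a) < d].
Proof.
move=> d0; pose ev := (fun nu : weak_star R G => (nu : state) a : C).
have evc : continuous ev.
  pose i := (fun mu : state => (mu : cstar -> C) : {ptws cstar -> C}).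
  move=> nu; apply: (@continuous_comp (weak_star R G) {ptws cstar -> C} C i (proj a)).
    exact: (@initial_continuous _ _ i).
  exact: (@proj_continuous cstar (fun=> C) a).
have dC : 0 < (d%:C%C : R[i]) by rewrite ltcR.
have := @near_preimage (weak_star R G) C ev mu _ evc (nbhsx_ballx (ev mu) _ dC).
apply: filterS => nu.
by move=> /normc_ball.
Qed.

Lemma weak_star_cvg (F : set_system state) mu : Filter F ->
  (forall a (d : R), 0 < d -> F [set nu : state | normc (mu a - nu a) < d]) ->
  forall U, weak_star_open U -> U mu -> F U.
Proof.
move=> FF Fa U [V oV VU] Umu.
pose i := (fun mu : state => (mu : cstar -> C) : {ptws cstar -> C}).
have Vmu : V (i mu) by rewrite -VU in Umu.
have : (i @ F) --> (i mu : {ptws cstar -> C}).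
  apply/cvg_sup => a A /= [_ [[D oD <-] Dmu DA]].
  have [e /= e0 eD] : exists2 e : R[i], 0 < e & ball (mu a : C) e `<=` D.
    have : nbhs (mu a : C) D by apply: open_nbhs_nbhs.
    by rewrite -nbhs_ballE => -[e e0 eD]; exists e.
  have [d d0 eE] : exists2 d : R, 0 < d & e = d%:C%C.
    case: e e0 {eD} => p q; rewrite ltcE /= => /andP[/eqP q0 p0].
    by exists p => //; rewrite q0.
  suff : F (i @^-1` A) by [].
  have := Fa a d d0; apply: filterS => nu /= nud.
  by apply: DA; apply: eD; rewrite eE; apply/normc_ball.
move=> /(_ V); rewrite -VU; apply.
exact: open_nbhs_nbhs.
Qed.

End WeakStar.

(** * The two topologies *)

Section Comparison.
Variables (R : realType) (G : groupType) (L : G -> nat).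
Local Notation C := (R[i]^o).
Local Notation cstar := (cstar R G).
Local Notation state := (state R G).
Implicit Types (mu nu : state) (a : cstar) (f g : Cc R G) (U : set state).

Hypothesis L0 : forall x, (L x = 0%N) <-> (x = 1%g).
Hypothesis LV : forall x, L x^-1%g = L x.
Hypothesis LM : forall x y, (L (x * y)%g <= L x + L y)%N.

Lemma bounded_entry (k : G -> G -> R[i]) (M : R) x y : bounded k M -> normc (k x y) <= M.
Proof.
move=> kM; pose F := [fset x; y]%fset.
have pick (h : G -> R[i]) u : u \in F -> \sum_(v <- F) h v * (v == u)%:R = h u.
  move=> uF; rewrite (big_fsetD1 u)//= eqxx mulr1 big1_fset ?addr0// => v.
  by rewrite in_fsetD1 => /andP[/negbTE -> _] _; rewrite mulr0.
have xF : x \in F by rewrite !inE eqxx.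
have yF : y \in F by rewrite !inE eqxx orbT.
have nrm u : u \in F -> nrm2 F (fun v => (v == u)%:R) = 1.
  move=> uF; rewrite /nrm2 (big_fsetD1 u)//= eqxx normc1 expr1n big1_fset ?addr0// => v.
  by rewrite in_fsetD1 => /andP[/negbTE -> _] _; rewrite normc0 expr0n.
have := kM F (fun v => (v == y)%:R) (fun v => (v == x)%:R).
rewrite !nrm// (_ : form _ _ _ _ = k x y); first by lra.
rewrite /form -[RHS](pick (fun u => k u y) x xF); apply: eq_bigr => u _.
by rewrite -mulr_suml pick.
Qed.

(** The entry of the commutator kernel at (z, 1) is f(z) L(z). *)
Lemma coef_le1 f z : (L_D L f <= 1)%E -> z <> 1%g -> normc (f z) <= 1.
Proof.
move=> /commutator_bounded /bounded_entry => /(_ z 1%g); rewrite /comm_kernel invg1 mulg1.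
have -> : L 1%g = 0%N by apply/L0.
rewrite subr0 normcM normc_nat => h z1.
apply: le_trans h; rewrite ler_peMr ?normc_ge0// ler1n lt0n.
by apply/eqP => /L0.
Qed.

Lemma fsfun_dirac (z : G) : exists f, forall x, f x = (x == z)%:R.
Proof.
exists [fsfun x in [fset z]%fset => (1 : C)] => x.
by rewrite fsfunE in_fset1; case: eqP.
Qed.

Lemma lambda_sum f (E : {fset G}) (d : G -> Cc R G) : (finsupp f `<=` E)%fset ->
  (forall z x, d z x = (x == z)%:R) ->
  lambda f = \sum_(z <- E) f z *: lambda (d z).
Proof.
move=> fE dE; apply/val_inj/funext => xi; apply/val_inj/funext => x.
have -> : val (val (\sum_(z <- E) f z *: lambda (d z)) xi) x =
    \sum_(z <- E) f z * xi (z^-1 * x)%g.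
  rewrite raddf_sum fct_sumE raddf_sum fct_sumE; apply: eq_bigr => z _.
  rewrite -[LHS]/(f z * convol (d z) xi x); congr (_ * _).
  rewrite (@convolE _ _ _ _ [fset z]%fset) => [|u]; last first.
    by rewrite mem_finsupp dE in_fset1; case: (u == _) => // /eqP[].
  by rewrite big_seq_fset1 dE eqxx scale1r.
rewrite -[LHS]/(convol f xi x) (convolE _ (fsubsetP fE)) fct_sumE.
by apply: eq_bigr.
Qed.

Lemma lambda_dirac1 f : (forall x, f x = (x == 1%g)%:R) -> lambda f = cstar1 R G.
Proof.
move=> fE; apply/val_inj/funext => xi; apply/val_inj/funext => x.
rewrite -[LHS]/(convol f xi x) (@convolE _ _ _ _ [fset 1%g]%fset) => [|u]; last first.
  by rewrite mem_finsupp fE in_fset1; case: (u == _) => // /eqP[].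
by rewrite big_seq_fset1 fE eqxx scale1r invg1 mul1g.
Qed.

Lemma rho_le mu nu f (e : R) : (L_D L f <= 1)%E -> (rho L mu nu <= e%:E)%E ->
  normc (mu (lambda f) - nu (lambda f)) <= e.
Proof.
by move=> f1 h; rewrite -lee_fin; apply: le_trans h; apply: ereal_sup_ubound; exists f.
Qed.

Lemma L_D_scale f (M : R) : 0 < M -> (L_D L f <= M%:E)%E ->
  exists2 g, (L_D L g <= 1)%E & lambda f = M%:C%C *: lambda g.
Proof.
move=> M0 /opnorm_leP fM; have [g gE] := fsfun_weight f (fun=> M^-1).
have fgE z : f z = M%:C%C * g z.
  by rewrite gE mulrCA -rmorphM divff ?gt_eqF// mulr1.
have cE xi : convol f xi = M%:C%C *: convol g xi.
  apply/funext => x; rewrite /convol -[RHS]/(M%:C%C * _).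
  rewrite (@fsbigTE _ _ _ _ [fset (z^-1 * x)%g | z in finsupp f]%fset); last first.
    move=> y yn; rewrite [f _]fsfun_dflt ?mul0r//; apply: contra yn => yf.
    by apply/imfsetP; exists (x * y^-1)%g => //; rewrite invgM invgK mulgVK.
  rewrite (@fsbigTE _ _ _ _ [fset (z^-1 * x)%g | z in finsupp f]%fset); last first.
    move=> y yn; rewrite gE [f _]fsfun_dflt ?mul0r//; apply: contra yn => yf.
    by apply/imfsetP; exists (x * y^-1)%g => //; rewrite invgM invgK mulgVK.
  by rewrite mulr_sumr; apply: eq_bigr => y _; rewrite fgE mulrA.
exists g; last first.
  by apply/val_inj/funext => xi; apply/val_inj; exact: cE.
apply/opnorm_leP => xi xi1; apply/l2norm_leP => // F.
have /l2norm_leP := fM xi xi1 => /(_ (ltW M0) F).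
have -> : nrm2 F (commutator L f xi) = M ^+ 2 * nrm2 F (commutator L g xi).
  rewrite -[M in RHS]ger0_norm ?(ltW M0)// -normcR -nrm2Z; apply: eq_bigr => x _.
  congr (normc _ ^+ 2); rewrite /commutator !cE.
  rewrite -[LHS]/((L x)%:R * (M%:C%C * convol g xi x) - M%:C%C * convol g _ x).
  rewrite -[X in _ = _ * X]/((L x)%:R * convol g xi x - convol g _ x).
  by rewrite mulrBr mulrCA.
by rewrite expr1n -ler_pdivlMl ?exprn_gt0// mulVf// gt_eqF// exprn_gt0.
Qed.

Lemma stateZ mu (c : C) a : mu (c *: a) = c * mu a.
Proof. by rewrite linearZ. Qed.

(** The balls of the metric generate a filter that converges to the center
    pointwise: on lambda f since [D, lam f] is bounded, on the whole algebra
    by density. *)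
Lemma weak_star_dist_open U : weak_star_open U -> dist_open (rho L) U.
Proof.
move=> oU mu Umu.
pose F := [set A : set state | exists2 e : R, 0 < e &
  [set nu | (rho L mu nu < e%:E)%E] `<=` A].
have FF : Filter F.
  split; first by exists 1.
  - move=> A A' [e e0 eA] [e' e0' eA']; exists (Num.min e e'); first by rewrite lt_min e0.
    move=> nu /= nue; split; [apply: eA|apply: eA'] => /=; apply: lt_le_trans nue _;
    by rewrite lee_fin ge_min lexx ?orbT.
  - by move=> A A' AA [e e0 eA]; exists e => //; exact: subset_trans AA.
suff [e e0 eU] : F U by exists e.
apply: (weak_star_cvg FF _ oU Umu) => a d d0.
have d8 : 0 < d / 8 by rewrite divr_gt0.
have /asboolP[_ /(_ _ d8)[f fa]] := cstarP a.
have [M M0 fM] := commutator_opnorm f LV LM.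
have [g g1 fg] := L_D_scale M0 fM.
exists (d / (4 * M)) => [|nu /= nud]; first by rewrite divr_gt0// mulr_gt0.
have gd := rho_le g1 (ltW nud).
have fd : normc (mu (lambda f) - nu (lambda f)) <= d / 4.
  rewrite fg !stateZ -mulrBr normcM normcR ger0_norm ?(ltW M0)//.
  rewrite -ler_pdivlMl//; apply: le_trans gd _; rewrite le_eqVlt; apply/orP; left.
  by apply/eqP; field; rewrite gt_eqF.
have small (la : state) : normc (la (a - lambda f)) <= 2 * (d / 8) by exact: state_le.
have -> : mu a - nu a = mu (a - lambda f) - nu (a - lambda f) +
    (mu (lambda f) - nu (lambda f)).
  by rewrite !raddfB /=; ring.
apply: le_lt_trans (le_normcD _ _) _.
apply: (@le_lt_trans _ _ (normc (mu (a - lambda f)) + normc (nu (a - lambda f)) + d / 4)).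
  by rewrite lerD//; apply: le_trans (le_normcD _ _) _; rewrite normcN.
have := small mu; have := small nu; lra.
Qed.

Hypothesis tail : forall e : R, 0 < e -> exists E : {fset G}, forall f,
  (L_D L f <= 1)%E -> exists g,
  [/\ (finsupp g `<=` E)%fset, forall z, normc (g z) <= normc (f z) &
       (opnorm (lam f - lam g)%R <= e%:E)%E].

(** On the set L_D(f) <= 1, up to a uniformly small error two states differ
    by a combination of their differences at the elements z <> 1 of a fixed
    finite set, with coefficients at most 1. At z = 1 they agree. *)
Lemma dist_weak_star_open U : dist_open (rho L) U -> weak_star_open U.
Proof.
move=> dU; rewrite /weak_star_open openE => mu /dU[e e0 eU].
have e16 : 0 < e / 16 by rewrite divr_gt0.
have [E EP] := tail e16.
have [d dE] := choice fsfun_dirac.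
pose N : R := (#|` E|%:R + 1) * 4.
have N0 : 0 < N by rewrite mulr_gt0// ltr_wpDl.
have eN : 0 < e / N by rewrite divr_gt0.
have near : nbhs (mu : weak_star R G) (\bigcap_(z in [set` E])
    [set nu : state | normc (mu (lambda (d z)) - nu (lambda (d z))) < e / N]).
  apply: filter_bigI => [|z _]; first exact: (@nbhs_filter (weak_star R G)).
  exact: weak_star_near.
rewrite /interior; suff : nbhs (mu : weak_star R G) U by [].
have FF : Filter (nbhs (mu : weak_star R G)) by exact: (@nbhs_filter (weak_star R G)).
move: near; apply: filterS => nu nuE; apply: eU => /=.
apply: (@le_lt_trans _ _ (e / 2)%:E); last by rewrite lte_fin ltr_pdivrMr// ltr_pMr// ltr1n.
apply: ge_ereal_sup => _ [f /= f1 <-]; rewrite lee_fin.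
have [g [gE gf fg]] := EP f f1.
have small (la : state) : normc (la (lambda f - lambda g)) <= 2 * (e / 16).
  exact: state_le.
have main : normc (mu (lambda g) - nu (lambda g)) <= e / 4.
  have sE (la : state) : la (lambda g) = \sum_(z <- E) g z * la (lambda (d z)).
    by rewrite (lambda_sum gE dE) raddf_sum; apply: eq_bigr => z _; exact: stateZ.
  rewrite !sE -sumrB.
  apply: le_trans (normc_sum _ _ _) _.
  apply: (@le_trans _ _ (\sum_(z <- E) e / N)).
    rewrite big_seq [leRHS]big_seq; apply: ler_sum => z zE.
    rewrite -mulrBr normcM.
    have [->|/eqP z1] := eqVneq z 1%g.
      rewrite (lambda_dirac1 (dE 1%g)) !state1 subrr normc0 mulr0 ltW//.
    rewrite -[leRHS]mul1r; apply: ler_pM; rewrite ?normc_ge0//.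
      exact: le_trans (gf z) (coef_le1 f1 z1).
    exact: ltW (nuE z zE).
  rewrite sum_const mulrCA ler_pM2l// ler_pdivrMr//.
  rewrite /N; lra.
have -> : mu (lambda f) - nu (lambda f) = mu (lambda f - lambda g) -
    nu (lambda f - lambda g) + (mu (lambda g) - nu (lambda g)).
  by rewrite !raddfB /=; ring.
apply: le_trans (le_normcD _ _) _.
apply: (@le_trans _ _ (normc (mu (lambda f - lambda g)) +
    normc (nu (lambda f - lambda g)) + e / 4)).
  by rewrite lerD//; apply: le_trans (le_normcD _ _) _; rewrite normcN.
have := small mu; have := small nu; lra.
Qed.

End Comparison.

Theorem mainTheorem2 (R : realType) (G : groupType)
    (fgG : finitely_generated G) (nfG : nilpotent_by_finite G)
    (L : G -> nat) (wL : is_word_length L) :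
  forall U : set (state R G), dist_open (rho L) U <-> weak_star_open U.
Proof.
have [L0 LV LM] := word_lengthP wL.
have [B [BL [c doubling]]] := word_length_doubling R 6 nfG wL.
move=> U; split; last exact: weak_star_dist_open.
apply: dist_weak_star_open => // e e0.
apply: (uniform_tail LV LM BL _ doubling e0).
exact/L0.
Qed.
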